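(* Let $\mathfrak{b}$ be a Borel subalgebra of the complex simple Lie algebra of type $E_7$. For each integer $m\geq 0$ let $N(m)$ be the number of abelian ideals of $\mathfrak{b}$ of dimension $m$. Then $$(N(0),N(1),\ldots,N(13))=(1,1,1,1,1,2,2,3,3,4,5,6,7,8),$$ $$(N(14),N(15),\ldots,N(27))=(10,11,13,15,11,7,5,3,3,1,1,1,1,1),$$ and $N(m)=0$ for $m\geq 28$; the total number of abelian ideals of $\mathfrak{b}$ is $128$.
   Context: An abelian ideal of $\mathfrak{b}$ is an ideal $I$ of the Lie algebra $\mathfrak{b}$ with $[I,I]=0$ (the zero ideal is included); dimension is over $\mathbb{C}$. *)

(* Defs.v *)
From HB Require Import structures.
From mathcomp Require Import all_boot all_order all_algebra.
From mathcomp Require Import complex.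
From mathcomp Require Import boolp classical_sets functions cardinality reals.

Set Implicit Arguments.
Unset Strict Implicit.
Unset Printing Implicit Defensive.

Import Order.TTheory GRing.Theory Num.Theory.
Local Open Scope ring_scope.

HB.mixin Record Vector_isLieAlgebra (K : fieldType) (L : Type)
    of Vector K L := {
  bracket : L -> L -> L;
  bracket_linearl : forall y : L, linear (bracket^~ y);
  bracket_linearr : forall x : L, linear (bracket x);
  bracketxx : forall x : L, bracket x x = 0;
  bracket_jacobi : forall x y z : L,
    bracket x (bracket y z) + bracket y (bracket z x)
      + bracket z (bracket x y) = 0
}.

#[short(type="lieAlgebraType")]
HB.structure Definition LieAlgebra (K : fieldType) :=
  { L of Vector_isLieAlgebra K L & Vector K L }.

Section LieAlgebras.

Variables (K : fieldType) (L : lieAlgebraType K).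

Implicit Types b c h I U : {vspace L}.

Definition lie_subalgebra b : Prop :=
  forall x y, x \in b -> y \in b -> bracket x y \in b.

Definition lie_ideal b I : Prop :=
  (I <= b)%VS /\ forall x y, x \in b -> y \in I -> bracket x y \in I.

Definition lie_abelian U : Prop :=
  forall x y, x \in U -> y \in U -> bracket x y = 0.

Definition abelian_ideal b I : Prop := lie_ideal b I /\ lie_abelian I.

(* By bilinearity, the span of the brackets of basis vectors is [U, U]. *)
Definition lie_derived U : {vspace L} :=
  (<<[seq bracket x y | x <- vbasis U, y <- vbasis U]>>)%VS.

Definition lie_solvable U : Prop :=
  exists n : nat, iter n lie_derived U = 0%VS.

(* A Borel subalgebra is a maximal solvable subalgebra. *)
Definition borel_subalgebra b : Prop :=
  [/\ lie_subalgebra b, lie_solvable b &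
      forall c, lie_subalgebra c -> lie_solvable c -> (b <= c)%VS -> c = b].

Definition lie_simple : Prop :=
  ~ lie_abelian fullv /\ forall I, lie_ideal fullv I -> I = 0%VS \/ I = fullv.

Definition ad_diagonalizable (t : L) : Prop :=
  exists2 X : (\dim (fullv : {vspace L})).-tuple L,
    basis_of fullv X & forall x, x \in X -> exists a : K, bracket t x = a *: x.

(* Cartan subalgebras in the sense used for complex semisimple Lie algebras:
   maximal abelian subalgebras all of whose elements are ad-semisimple. Over
   an algebraically closed field, semisimple means diagonalizable; an abelian
   subspace is automatically a subalgebra. *)
Definition cartan_subalgebra h : Prop :=
  [/\ lie_abelian h,
      forall c, lie_abelian c -> (h <= c)%VS -> c = h &
      forall t, t \in h -> ad_diagonalizable t].

Definition lie_dual h := 'Hom(subvs_of h, K^o).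

Definition lie_root h (beta : lie_dual h) : Prop :=
  beta != 0 /\
  exists2 x : L, x != 0 &
    forall t : subvs_of h, bracket (vsval t) x = (beta t : K) *: x.

End LieAlgebras.

(* The root system of a Cartan matrix A of finite type, in coordinates with
   respect to the simple roots alpha_i: the orbit of the simple roots under
   the Weyl group, generated by the simple reflections
   s_i v = v - <v, alpha_i^vee> alpha_i, where <alpha_j, alpha_i^vee> = A j i. *)
Inductive weyl_root (n : nat) (A : 'M[int]_n) : 'rV[int]_n -> Prop :=
| weyl_root_simple i : weyl_root A (delta_mx 0 i)
| weyl_root_reflect i v : weyl_root A v ->
    weyl_root A (v - (v *m A) 0 i *: delta_mx 0 i).

(* The Dynkin diagram of E_7 in Bourbaki's labelling, shifted to start at 0:
   the chain 0 - 2 - 3 - 4 - 5 - 6, with 1 attached to 3. *)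
Definition E7_edges : seq (nat * nat) :=
  [:: (0, 2); (2, 3); (3, 4); (4, 5); (5, 6); (1, 3)]%N.

Definition E7_cartan_matrix : 'M[int]_7 :=
  \matrix_(i, j)
    if i == j then 2
    else if (((i : nat), (j : nat)) \in E7_edges)
         || (((j : nat), (i : nat)) \in E7_edges) then -1
    else 0.

(* The simple Lie algebra L has type E_7: for some Cartan subalgebra h, a
   linear isomorphism from the span of the E_7 root system to the dual of h,
   given by the image alpha of the simple roots, maps the E_7 root system
   onto the set of roots of L relative to h. *)
Definition simple_of_type_E7 (K : fieldType) (L : lieAlgebraType K) : Prop :=
  lie_simple L /\
  exists h : {vspace L}, cartan_subalgebra h /\
  exists alpha : 7.-tuple (lie_dual h),
    basis_of fullv alpha /\
    forall beta : lie_dual h,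
      lie_root beta <->
      exists2 v : 'rV[int]_7, weyl_root E7_cartan_matrix v &
        beta = \sum_(i < 7) (v 0 i)%:~R *: tnth alpha i.

Local Open Scope classical_set_scope.

Definition abelian_ideals (K : fieldType) (L : lieAlgebraType K)
    (b : {vspace L}) : set {vspace L} :=
  [set I | abelian_ideal b I].

Definition abelian_ideals_of_dim (K : fieldType) (L : lieAlgebraType K)
    (b : {vspace L}) (m : nat) : set {vspace L} :=
  [set I | abelian_ideal b I /\ \dim I = m].

(* Main.v *)
Require Import Defs.
From HB Require Import structures.
From mathcomp Require Import all_boot all_order all_algebra ring zify.
From mathcomp Require Import complex.
From mathcomp Require Import boolp classical_sets functions cardinality reals.

(** Let [h] be the Cartan subalgebra whose roots form the given E7 system. For
    a Borel subalgebra that contains [h], an abelian ideal is stable under [h]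
    and meets it in zero, so it is a sum of root spaces; abelian ideals are then
    sets of positive roots, closed under adding positive roots, in which no two
    members add up to a root. There are 128 such sets, and they are enumerated
    by computation ([abelian_sets]). The work lies in reaching this situation
    from a maximal solvable subalgebra [b], which is not given with any
    relation to [h].

    The tool is an algebraic form of the fixed point theorem of Borel
    ([solvable_degeneration]). If [s] is a solvable subalgebra, there is a
    limiting process [F] on all subspaces at once which preserves dimensions,
    inclusions, inclusions [[A, B] <= C] and orthogonality for the Killing form,
    and such that every [F U] is stable under [s]. It is built along a chain of
    ideals of [s] with one-dimensional quotients: for one more element [y], the
    derivation [ad y] is split into a semisimple and a nilpotent part, and one
    passes to the limit along the one-parameter groups of the two parts. For
    the semisimple part the limit consists of leading components for a total
    order on the eigenvalues ([semisimple_limit]); for the nilpotent part it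
    consists of leading coefficients of polynomial curves
    ([unipotent_limit]).

    Two consequences are used. Applied to a full flag, [F] gives the theorem of
    Lie, hence [killing x y = 0] when [x] and [y] lie in a solvable subalgebra
    and [ad y] is nilpotent ([killing_solvable]). Applied to a solvable
    subalgebra [c], it gives a solvable subalgebra of the same dimension
    normalised by [b], hence contained in [b], so [b] has at least the
    dimension of [c] ([borel_dim_leq]).

    From the roots and from simplicity one gets the nondegeneracy of the
    Killing form, the dimension 1 of the root spaces ([dim_root_space]) and
    the fact that [[g_u, g_v]] is not zero when [u + v] is a root
    ([root_bracket_sub]), by computing traces of [[x, y]] on root strings.
    Let [hspan 0] be the sum of [h] and of the positive root spaces and
    [hspan 1] the sum of the latter, of dimensions 70 and 63. The two
    consequences and a count of dimensions show that [b] contains an element of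
    the coset [z + hspan 1], where [z] in [h] takes distinct nonzero values at
    the roots ([borel_meets_coset]). That element is conjugate to [z]
    ([coset_conjugate]), so one may assume that [z] lies in [b]. Then [b]
    contains [h], and its roots form a positive system
    ([borel_positive_system]), which some element of the Weyl group maps to the
    standard one ([positive_system_weyl]). *)

Set Implicit Arguments.
Unset Strict Implicit.
Unset Printing Implicit Defensive.

Import Order.TTheory GRing.Theory Num.Theory.
Local Open Scope ring_scope.

(** * Linear algebra *)

Section LinearAlgebra.

Variables (K : fieldType) (V : vectType K).

(** A predicate closed under linear combinations contains a subspace of maximal
    dimension, which exhausts it. *)
Lemma vspace_of_pred (P : V -> Prop) :
  P 0 -> (forall a u v, P u -> P v -> P (a *: u + v)) ->
  exists U : {vspace V}, forall v, v \in U <-> P v.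
Proof.
move=> P0 Plin.
pose Q n := `[< exists2 U : {vspace V}, (forall v, v \in U -> P v) & \dim U = n >].
have Q0 : exists n, Q n.
  exists 0%N; apply/asboolP; exists 0%VS; last exact: dimv0.
  by move=> v; rewrite memv0 => /eqP->.
have Qb n : Q n -> (n <= \dim {:V})%N.
  by move=> /asboolP[U _ <-]; apply/dimvS/subvf.
case: (ex_maxnP Q0 Qb) => n /asboolP[U UP <-] Umax; exists U => v; split; first exact: UP.
move=> Pv; suff /eqP -> : U == (U + <[v]>)%VS.
  by rewrite -[X in X \in _]add0r memv_add ?mem0v ?memv_line.
rewrite eqEdim addvSl; apply: Umax; apply/asboolP; exists (U + <[v]>)%VS => //.
by move=> _ /memv_addP[u Uu [_ /vlineP[k ->] ->]]; rewrite addrC; apply/Plin/UP.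
Qed.

Lemma leq_dim_inj (W : vectType K) (f : 'Hom(V, W)) (U : {vspace V}) (U' : {vspace W}) :
  (forall u, u \in U -> f u \in U') -> (forall u, u \in U -> f u = 0 -> u = 0) ->
  (\dim U <= \dim U')%N.
Proof.
move=> fU fI; rewrite -(@limg_dim_eq _ _ _ f U).
  by apply/dimvS/subvP => _ /memv_imgP[u uU ->]; apply: fU.
apply/eqP; rewrite -subv0; apply/subvP => u; rewrite memv_cap memv_ker memv0.
by move=> /andP[uU /eqP/fI ->].
Qed.

End LinearAlgebra.

(** * Polynomials in an endomorphism *)

Section PolyEnd.

Variables (K : fieldType) (V : vectType K) (D : 'End(V)).

Definition pev (p : {poly K}) (v : V) : V := \sum_(i < size p) p`_i *: iter i D v.

Lemma iter_lfun_linear n : linear (iter n D).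
Proof. by elim: n => [|n IHn] a u v //=; rewrite IHn linearP. Qed.

Lemma pev_wide n (p : {poly K}) v : (size p <= n)%N -> pev p v = \sum_(i < n) p`_i *: iter i D v.
Proof.
move=> le_pn; rewrite /pev (big_ord_widen n (fun i => p`_i *: iter i D v)) //.
rewrite big_mkcond; apply: eq_bigr => i _; case: ltnP => // le_pi.
by rewrite nth_default ?scale0r.
Qed.

Lemma pev_linear p : linear (pev p).
Proof.
move=> a u v; rewrite /pev scaler_sumr -big_split /=; apply: eq_bigr => i _.
by rewrite iter_lfun_linear scalerDr !scalerA mulrC.
Qed.
HB.instance Definition _ p := GRing.isLinear.Build K V V _ (pev p) (pev_linear p).

Lemma pevD p q v : pev (p + q) v = pev p v + pev q v.
Proof.
set n := maxn (size p) (size q).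
rewrite (@pev_wide n (p + q)) ?size_polyD // (@pev_wide n p) ?leq_maxl //.
rewrite (@pev_wide n q) ?leq_maxr // -big_split; apply: eq_bigr => i _.
by rewrite coefD scalerDl.
Qed.

Lemma pevZ a p v : pev (a *: p) v = a *: pev p v.
Proof.
rewrite (@pev_wide (size p) (a *: p)) ?size_scale_leq // scaler_sumr.
by apply: eq_bigr => i _; rewrite coefZ scalerA.
Qed.

Lemma pevC a v : pev a%:P v = a *: v.
Proof. by rewrite (@pev_wide 1) ?size_polyC_leq1 // big_ord1 coefC. Qed.

Lemma pev1 v : pev 1 v = v. Proof. by rewrite -[1]/(1%:P) pevC scale1r. Qed.
Lemma pev0 v : pev 0 v = 0. Proof. by rewrite -[0]/(0%:P) pevC scale0r. Qed.

Lemma pev_sum I r (P : pred I) F v :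
  pev (\sum_(i <- r | P i) F i) v = \sum_(i <- r | P i) pev (F i) v.
Proof. by elim/big_rec2: _ => [|i y x _ <-]; rewrite ?pev0 ?pevD. Qed.

Lemma pevXl p v : pev (p * 'X) v = D (pev p v).
Proof.
rewrite (@pev_wide (size p).+1); last first.
  by apply: (leq_trans (size_polyMleq _ _)); rewrite size_polyX addn2.
rewrite big_ord_recl coefMX scale0r add0r linear_sum.
by apply: eq_bigr => i _; rewrite coefMX /= linearZ.
Qed.

Lemma pevM (p q : {poly K}) v : pev (p * q) v = pev p (pev q v).
Proof.
elim/poly_ind: p v => [|p a IHp] v; first by rewrite mul0r !pev0.
by rewrite mulrDl !pevD mul_polyC pevZ pevC mulrAC !pevXl IHp.
Qed.

Lemma pevMC (p q : {poly K}) v : pev p (pev q v) = pev q (pev p v).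
Proof. by rewrite -!pevM mulrC. Qed.

Lemma pevX v : pev 'X v = D v. Proof. by rewrite -['X]mul1r pevXl pev1. Qed.

Lemma pev_XsubC a v : pev ('X - a%:P) v = D v - a *: v.
Proof. by rewrite -polyCN pevD pevX pevC scaleNr. Qed.

Lemma pevS (q : {poly K}) n v : pev (q ^+ n.+1) v = pev (q ^+ n) (pev q v).
Proof. by rewrite exprSr pevM. Qed.

Lemma pev_stable (U : {vspace V}) (p : {poly K}) v :
  (forall u, u \in U -> D u \in U) -> v \in U -> pev p v \in U.
Proof.
move=> DU Uv; apply: memv_suml => i _; apply: memvZ.
by elim: (i : nat) => //= j; apply: DU.
Qed.

Lemma pev_coprime (p q : {poly K}) v : coprimep p q -> pev p v = 0 -> pev q v = 0 -> v = 0.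
Proof.
move=> /Bezout_eq1_coprimepP[[a b] /= eq1] pv qv.
by rewrite -[v]pev1 -eq1 pevD !pevM pv qv !linear0 addr0.
Qed.

(** On each basis vector the powers of [D] are linearly dependent; the product
    of the resulting polynomials kills everything. *)
Lemma pev_annihilator : exists2 p : {poly K}, p != 0 & forall v, pev p v = 0.
Proof.
have one v : exists2 p : {poly K}, p != 0 & pev p v = 0.
  pose n := (dim V).+1.
  have : ~~ free [tuple iter (i : 'I_n) D v | i < n].
    apply/negP => fr; have := dim_span [tuple iter (i : 'I_n) D v | i < n].
    have /eqP -> := fr; rewrite size_tuple => _.
    have := dimvS (subvf <<[tuple iter (i : 'I_n) D v | i < n]>>).
    by rewrite (eqP fr) size_tuple dimvf ltnn.
  move=> /freeP H; apply: contrapT => noP; apply: H => k Hk i.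
  apply: contrapT => ki; apply: noP; exists (\poly_(j < n) k (inord j)).
    apply: contra_notN ki => /eqP/(congr1 (fun p : {poly K} => p`_i)).
    by rewrite coef_poly ltn_ord inord_val coef0.
  rewrite (@pev_wide n) ?size_poly // -[RHS]Hk; apply: eq_bigr => j _.
  by rewrite coef_poly ltn_ord inord_val -tnth_nth tnth_mktuple.
have /choice[p Hp] : forall v, exists p : {poly K}, p != 0 /\ pev p v = 0.
  by move=> v; have [q] := one v; exists q.
exists (\prod_(x <- vbasis {:V}) p x) => [|v].
  by rewrite prodf_seq_neq0; apply/allP => x _; have [] := Hp x.
have base x : x \in vbasis {:V} -> pev (\prod_(x <- vbasis {:V}) p x) x = 0.
  move=> xb; rewrite (big_rem x) //= mulrC pevM.
  by have [_ ->] := Hp x; rewrite linear0.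
rewrite (coord_vbasis (memvf v)) linear_sum big1 // => i _.
by rewrite linearZ /= base ?scaler0 // mem_nth // size_tuple.
Qed.

End PolyEnd.

Section Primary.

(** The Bezout relation between the cofactors of the prime powers; the term with
    [u] only makes the induction start at the empty list. *)
Lemma partial_fractions (K : fieldType) (A : seq K) n : uniq A ->
  exists (c : K -> {poly K}) (u : {poly K}),
    \sum_(a <- A) c a * \prod_(b <- A | b != a) ('X - b%:P) ^+ n
      + u * \prod_(b <- A) ('X - b%:P) ^+ n = 1.
Proof.
elim: A => [|a A IHA] /=; first by exists (fun=> 0), 1; rewrite !big_nil add0r mulr1.
move=> /andP[aA /IHA[c [u E]]].
have : coprimep (('X - a%:P) ^+ n) (\prod_(b <- A) ('X - b%:P) ^+ n).
  apply: coprimep_expl; elim: A aA {IHA E} => [|b A IHA]; first by rewrite big_nil coprimep1.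
  rewrite inE negb_or big_cons coprimepMr => /andP[ab /IHA ->]; rewrite andbT.
  by apply: coprimep_expr; apply: coprimep_XsubC2; rewrite subr_eq0 eq_sym.
move=> /Bezout_eq1_coprimepP[[s t] /= B].
exists (fun b => if b == a then t else s * c b), (s * u).
rewrite !big_cons eqxx /= -big_filter.
have -> : [seq b <- A | b != a] = A.
  by apply/all_filterP/allP => b bA; apply: contraNneq aA => <-.
have -> : \sum_(j <- A) (if j == a then t else s * c j) *
      \prod_(b <- a :: A | b != j) ('X - b%:P) ^+ n =
    s * ('X - a%:P) ^+ n *
      \sum_(j <- A) c j * \prod_(b <- A | b != j) ('X - b%:P) ^+ n.
  rewrite mulr_sumr; apply: eq_big_seq => b bA.
  have ba : b != a by apply: contraNneq aA => <-.
  by rewrite (negPf ba) big_cons eq_sym ba; ring.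
rewrite -[RHS]B; transitivity (s * ('X - a%:P) ^+ n *
  (\sum_(j <- A) c j * \prod_(b <- A | b != j) ('X - b%:P) ^+ n
   + u * \prod_(b <- A) ('X - b%:P) ^+ n) + t * \prod_(b <- A) ('X - b%:P) ^+ n).
  by ring.
by rewrite E mulr1.
Qed.

Variables (K : closedFieldType) (V : vectType K) (D : 'End(V)).

(** The projections onto the generalised eigenspaces of an endomorphism are
    polynomials in it, so they preserve whatever it preserves. *)
Lemma primary_decomposition :
  exists (A : seq K) (e : K -> {poly K}) (n : nat),
  [/\ forall v, \sum_(a <- A) pev D (e a) v = v,
      forall a v, pev D (('X - a%:P) ^+ n) (pev D (e a) v) = 0,
      forall a b v, a != b -> pev D (e a) (pev D (e b) v) = 0,
      forall a, a \notin A -> e a = 0 & uniq A].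
Proof.
have [p p0 Dp] := pev_annihilator D.
have [r Er] := closed_field_poly_normal p.
have Dr v : pev D (\prod_(z <- r) ('X - z%:P)) v = 0.
  have := Dp v; rewrite Er pevZ => /eqP.
  by rewrite scaler_eq0 lead_coef_eq0 (negPf p0) => /eqP.
pose A := undup r; pose n := size r; pose Q := \prod_(a <- A) ('X - a%:P) ^+ n.
have uA : uniq A by apply: undup_uniq.
have DQ v : pev D Q v = 0.
  have /dvdpP[u Eu] : \prod_(z <- r) ('X - z%:P) %| Q.
    rewrite /Q prodrXl /n.
    have: {subset r <= A} by move=> a; rewrite mem_undup.
    elim: (r) => [|a s IHs] sA; first by rewrite big_nil dvd1p.
    rewrite big_cons /= exprS dvdp_mul ?IHs // => [|b bs]; last by rewrite sA // inE bs orbT.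
    by rewrite dvdp_XsubCl root_prod_XsubC sA ?mem_head.
  by rewrite Eu pevM Dr linear0.
have [c [u E]] := partial_fractions n uA.
pose q a := \prod_(b <- A | b != a) ('X - b%:P) ^+ n.
have Qq a : a \in A -> Q = ('X - a%:P) ^+ n * q a.
  by move=> aA; rewrite /Q (bigD1_seq a).
exists A, (fun a => if a \in A then c a * q a else 0), n; split=> //.
- move=> v; rewrite -[RHS](@pev1 _ _ D) -E pevD [X in _ = _ + X]pevM DQ linear0 addr0.
  by rewrite pev_sum; apply: eq_big_seq => a ->.
- move=> a v; case: ifP => [aA|_]; last by rewrite pev0 linear0.
  by rewrite -pevM mulrCA -Qq // pevM DQ linear0.
- move=> a b v ab; case: ifP => [aA|_]; last by rewrite pev0.
  case: ifP => [bA|_]; last by rewrite pev0 linear0.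
  rewrite -pevM mulrACA pevM.
  have /dvdpP[w ->] : Q %| q a * q b.
    rewrite (Qq a) // mulrC dvdp_mul // /q (big_rem a) //= ab; exact: dvdp_mulr.
  by rewrite pevM DQ !linear0.
- by move=> a /negPf ->.
Qed.

End Primary.

(** * Brackets *)

Notation "<| x , y |>" := (bracket x y) (format "<| x ,  y |>").

Section Bracket.

Variables (K : fieldType) (L : lieAlgebraType K).
Implicit Types (x y z : L) (A B C U : {vspace L}).

HB.instance Definition _ x :=
  GRing.isLinear.Build K L L _ (@bracket K L x) (bracket_linearr x).

Lemma bracketDl x y z : <|x + y, z|> = <|x, z|> + <|y, z|>.
Proof. by have := bracket_linearl z 1 x y; rewrite !scale1r. Qed.

Lemma bracket0l z : <|0, z|> = 0 :> L.
Proof. by apply: (@addrI _ <|0, z|>); rewrite -bracketDl !addr0. Qed.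

Lemma bracketZl a x z : <|a *: x, z|> = a *: <|x, z|>.
Proof. by have := bracket_linearl z a x 0; rewrite bracket0l !addr0. Qed.

Lemma bracketDr x y z : <|x, y + z|> = <|x, y|> + <|x, z|>.
Proof. exact: linearD. Qed.

Lemma bracket0r x : <|x, 0|> = 0 :> L.
Proof. exact: linear0. Qed.

Lemma bracketZr a x y : <|x, a *: y|> = a *: <|x, y|>.
Proof. exact: linearZ. Qed.

Lemma bracketBr x y z : <|x, y - z|> = <|x, y|> - <|x, z|>.
Proof. exact: linearB. Qed.

Lemma bracket_sumr x I r (P : pred I) (F : I -> L) :
  <|x, \sum_(i <- r | P i) F i|> = \sum_(i <- r | P i) <|x, F i|>.
Proof. exact: linear_sum. Qed.

Lemma bracketC x y : <|x, y|> = - <|y, x|>.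
Proof.
have := bracketxx (x + y); rewrite bracketDl !linearD /= !bracketxx add0r addr0.
by move/eqP; rewrite addr_eq0 => /eqP.
Qed.

Lemma bracketNl x z : <|- x, z|> = - <|x, z|>.
Proof. by rewrite -scaleN1r bracketZl scaleN1r. Qed.

Lemma bracketBl x y z : <|x - y, z|> = <|x, z|> - <|y, z|>.
Proof. by rewrite bracketDl bracketNl. Qed.

Lemma bracket_suml I r (P : pred I) (F : I -> L) z :
  <|\sum_(i <- r | P i) F i, z|> = \sum_(i <- r | P i) <|F i, z|>.
Proof. by elim/big_rec2: _ => [|i y x _ <-]; rewrite ?bracket0l ?bracketDl. Qed.

Definition derivation (D : 'End(L)) :=
  forall x y, D <|x, y|> = <|D x, y|> + <|x, D y|>.

Definition ad x : 'End(L) := linfun (bracket x).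

Lemma adE x y : ad x y = <|x, y|>. Proof. by rewrite lfunE. Qed.

Lemma ad_derivation x : derivation (ad x).
Proof.
move=> y z; rewrite !adE; have := bracket_jacobi x y z.
rewrite (bracketC z x) (bracketC z <|x, y|>) linearN /= => /eqP.
by rewrite -addrA -opprD subr_eq0 addrC => /eqP.
Qed.

(** Stands for [[A, B] <= C], without forming the span of the brackets. *)
Definition bracket_sub A B C := forall x y, x \in A -> y \in B -> <|x, y|> \in C.

Lemma bracket_sub_sym A B C : bracket_sub A B C -> bracket_sub B A C.
Proof. by move=> H x y xB yA; rewrite bracketC memvN H. Qed.

Lemma bracket_subS A B C A' B' C' : (A' <= A)%VS -> (B' <= B)%VS -> (C <= C')%VS ->
  bracket_sub A B C -> bracket_sub A' B' C'.
Proof. by move=> /subvP sA /subvP sB /subvP sC H x y /sA xA /sB yB; exact: sC (H _ _ xA yB). Qed.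

Lemma bracket_subDl A A' B C :
  bracket_sub A B C -> bracket_sub A' B C -> bracket_sub (A + A')%VS B C.
Proof.
move=> H H' _ y /memv_addP[x xA [x' xA' ->]] yB.
by rewrite bracketDl memvD; [|exact: H|exact: H'].
Qed.

Lemma bracket_subDr A B B' C :
  bracket_sub A B C -> bracket_sub A B' C -> bracket_sub A (B + B')%VS C.
Proof. by move=> H H'; apply/bracket_sub_sym/bracket_subDl; apply: bracket_sub_sym. Qed.


Lemma lie_derivedP U C : (lie_derived U <= C)%VS <-> bracket_sub U U C.
Proof.
split=> [/span_subvP H x y xU yU | H]; last first.
  apply/span_subvP => _ /allpairsP[[x y] /= [xU yU ->]].
  by apply: H; apply: vbasis_mem.
rewrite (coord_vbasis xU) (coord_vbasis yU) bracket_suml memv_suml // => i _.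
rewrite bracketZl memvZ // linear_sum memv_suml // => j _.
rewrite linearZ memvZ // H //; apply/allpairsP.
by exists ((vbasis U)`_i, (vbasis U)`_j); rewrite !mem_nth ?size_tuple.
Qed.

Lemma lie_derivedS A B : (A <= B)%VS -> (lie_derived A <= lie_derived B)%VS.
Proof.
move=> sAB; apply/lie_derivedP.
by apply: (@bracket_subS B B (lie_derived B)); rewrite ?subvv //; apply/lie_derivedP; rewrite subvv.
Qed.

Lemma iter_lie_derivedS n A B : (A <= B)%VS -> (iter n (@lie_derived _ _) A <= iter n (@lie_derived _ _) B)%VS.
Proof. by move=> sAB; elim: n => //= n IHn; apply: lie_derivedS. Qed.

Lemma lie_solvableS A B : (A <= B)%VS -> lie_solvable B -> lie_solvable A.
Proof.
by move=> sAB [n Bn]; exists n; apply/eqP; rewrite -subv0 -Bn iter_lie_derivedS.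
Qed.

Lemma lie_solvable_ext A B : (lie_derived B <= A)%VS -> lie_solvable A -> lie_solvable B.
Proof. by move=> sBA /(lie_solvableS sBA)[n Bn]; exists n.+1; rewrite iterSr. Qed.

End Bracket.

Import passmx.

(** * Traces and the Killing form *)

Section Trace.

Variables (K : fieldType) (V : vectType K).
Implicit Types (f g : 'End(V)).

Definition lftrace f : K := \tr (mxof (vbasis {:V}) (vbasis {:V}) f).

Lemma lftraceD f g : lftrace (f + g) = lftrace f + lftrace g.
Proof. by rewrite /lftrace linearD mxtraceD. Qed.

Lemma lftraceZ a f : lftrace (a *: f) = a * lftrace f.
Proof. by rewrite /lftrace linearZ mxtraceZ. Qed.

Lemma lftraceB f g : lftrace (f - g) = lftrace f - lftrace g.
Proof. by rewrite /lftrace linearB /= !raddfB. Qed.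

Lemma lftraceC f g : lftrace (f \o g)%VF = lftrace (g \o f)%VF.
Proof. by rewrite /lftrace !(mxof_comp _ _ (vbasisP {:V})) mxtrace_mulC. Qed.

Lemma lftrace_basis (e : (\dim {:V}).-tuple V) f : basis_of {:V} e ->
  lftrace f = \sum_i coord e i (f e`_i).
Proof.
move=> be; pose X := vbasis {:V}; have bX := vbasisP {:V}.
rewrite /lftrace -/X -[f]comp_lfun1r -[f in (f \o _)%VF]comp_lfun1l.
rewrite (mxof_comp _ _ be) (mxof_comp _ _ be) mxtrace_mulC -mulmxA -(mxof_comp _ _ bX).
rewrite comp_lfun1l mxof1 ?(basis_free be) // mulmx1 /mxtrace.
by apply: eq_bigr => i _; rewrite !mxE /= vecof_delta comp_lfun1l comp_lfun1r.
Qed.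

(** A nilpotent endomorphism preserving a full flag acts by zero on each
    quotient of the flag, hence so does its product with another endomorphism
    preserving the flag. *)
Lemma lftrace_flag (F : nat -> {vspace V}) f g n :
  (forall i, (i <= \dim {:V})%N -> \dim (F i) = i) ->
  (forall i, (F i <= F i.+1)%VS) ->
  (forall i v, v \in F i -> f v \in F i) -> (forall i v, v \in F i -> g v \in F i) ->
  (forall v, iter n g v = 0) -> lftrace (f \o g)%VF = 0.
Proof.
move=> dF sF fF gF gn.
have /choice[e He] : forall i, exists v, (i < \dim {:V})%N -> v \in F i.+1 /\ v \notin F i.
  move=> i; case: (ltnP i (\dim {:V})) => [lti|]; last by exists 0.
  suff /subvPn[v v1 v2] : ~~ (F i.+1 <= F i)%VS by exists v.
  by apply/negP => /dimvS; rewrite !dF ?ltnn // ltnW.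
have spanF i : (i <= \dim {:V})%N -> F i = <<mkseq e i>>%VS.
  elim: i => [|i IHi] lti; first by rewrite span_nil; apply/eqP; rewrite -dimv_eq0 dF.
  have [ei1 ei2] := He i lti.
  apply/esym/eqP; rewrite eqEdim; apply/andP; split.
    apply/span_subvP => _ /mapP[j + ->]; rewrite mem_iota add0n ltnS => /andP[_].
    rewrite leq_eqVlt => /orP[/eqP -> //|ltji].
    apply/(subvP (sF i)); rewrite IHi ?(ltnW lti) //.
    by apply/memv_span/map_f; rewrite mem_iota.
  rewrite dF // mkseqS -cats1 span_cat -(IHi (ltnW lti)) dimv_disjoint_sum ?span_seq1 ?dim_vline.
    rewrite dF ?(ltnW lti) //; have -> : e i != 0; last by rewrite addn1.
    by apply: contraNneq ei2 => ->; rewrite mem0v.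
  apply/eqP; rewrite -subv0; apply/subvP => v; rewrite memv_cap => /andP[vF /vlineP[k vk]].
  rewrite memv0 vk; have [->|k0] := eqVneq k 0; first by rewrite scale0r.
  case/negP: ei2; rewrite -[e i](scalerK k0).
  by rewrite memvZ // -vk.
set n0 := \dim {:V} in dF He spanF *.
pose X : n0.-tuple V := [tuple e i | i < n0].
have EX : X = mkseq e n0 :> seq V by rewrite /mkseq -val_enum_ord -map_comp.
have be : basis_of {:V} X.
  rewrite basisEdim size_tuple leqnn andbT EX -spanF //.
  suff -> : F n0 = {:V}%VS by [].
  by apply/eqP; rewrite eqEdim subvf dF ?leqnn.
have Xi (i : 'I_n0) : X`_i = e i by rewrite -tnth_nth tnth_mktuple.
rewrite (lftrace_basis _ be) big1 // => i _; rewrite comp_lfunE Xi.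
have [ei1 ei2] := He i (ltn_ord i).
have coord0 v : v \in F i -> coord X i v = 0.
  rewrite (spanF _ (ltnW (ltn_ord i))) => vi.
  have szi : size (mkseq e i) == i by rewrite size_mkseq.
  rewrite (@coord_span _ _ _ (Tuple szi) v vi) linear_sum big1 // => j _.
  have lj : (j < n0)%N by apply: ltn_trans (ltn_ord i).
  rewrite linearZ /= nth_mkseq // -(Xi (Ordinal lj)) coord_free ?(basis_free be) //.
  by rewrite -val_eqE /= ltn_eqF ?mulr0 //=.
apply/coord0/fF.
have [a [w wF Ew]] : exists a, exists2 w, w \in F i & g (e i) = w + a *: e i.
  have := gF _ _ ei1; rewrite (spanF _ (ltn_ord i)) mkseqS -cats1 span_cat.
  rewrite -(spanF _ (ltnW (ltn_ord i))) span_seq1.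
  by move=> /memv_addP[w wF [_ /vlineP[a ->] ->]]; exists a, w.
have gm m : iter m g (e i) - a ^+ m *: e i \in F i.
  elim: m => [|m IHm]; first by rewrite scale1r subrr mem0v.
  have -> : iter m.+1 g (e i) = g (iter m g (e i) - a ^+ m *: e i) + a ^+ m *: (w + a *: e i).
    by rewrite -Ew -linearZ -linearD subrK.
  by rewrite scalerDr scalerA -exprSr addrA addrK memvD ?gF ?memvZ.
have a0 : a = 0.
  have := gm n; rewrite gn add0r memvN; have [-> // | a0 eF] := eqVneq a 0.
  by case/negP: ei2; rewrite -[e i](scalerK (expf_neq0 n a0)) memvZ.
by rewrite Ew a0 scale0r addr0.
Qed.


(** In a basis adapted to the direct sum the matrix of [f] is diagonal. *)
Lemma lftrace_diag (I : finType) (W : I -> {vspace V}) (c : I -> K) f :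
  directv (\sum_i W i) -> (\sum_i W i)%VS = fullv ->
  (forall i w, w \in W i -> f w = c i *: w) ->
  lftrace f = \sum_i c i * (\dim (W i))%:R.
Proof.
move=> dW sW fW.
have be := @bigcat_basis _ _ I xpredT (fun i => vbasis (W i)) W dW (fun i _ => vbasisP (W i)).
rewrite sW in be; set e := \big[_/_]_i _ in be.
have se : size e == \dim {:V} by rewrite eq_sym; apply/eqP/(size_basis (X := in_tuple e)).
have /choice[k Hk] : forall x, exists a, x \in e -> x != 0 -> f x = a *: x.
  move=> x; case: (boolP (x \in e)) => [|_]; last by exists 0.
  rewrite /e; elim/big_ind: _ => [//|s t Hs Ht|i _ /vbasis_mem xi].
    by rewrite mem_cat => /orP[].
  by exists (c i) => _; rewrite (fW i).
rewrite (lftrace_basis (e := Tuple se)) //.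
transitivity (\sum_(x <- e) k x).
  rewrite (big_nth 0) big_mkord (eqP se); apply: eq_bigr => i _.
  have xi : (Tuple se)`_i \in e by apply: mem_nth; rewrite (eqP se).
  rewrite (Hk _ xi) ?(basis_not0 be xi) // linearZ /= coord_free ?(basis_free be) //.
  by rewrite eqxx mulr1.
have ke i x : x \in vbasis (W i) -> k x = c i.
  move=> xi; have xe : x \in e.
    by rewrite /e (big_morph _ (mem_cat x) (in_nil x)) big_orE; apply/existsP; exists i.
  have x0 := basis_not0 be xe; have := Hk x xe x0.
  rewrite (fW i) ?vbasis_mem // => /eqP; rewrite -subr_eq0 -scalerBl scaler_eq0.
  by rewrite (negPf x0) orbF subr_eq0 => /eqP.
transitivity (\sum_i \sum_(x <- vbasis (W i)) k x).
  rewrite /e; elim/big_rec2: _ => [|i y1 y2 _ <-]; first by rewrite big_nil.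
  by rewrite big_cat.
apply: eq_bigr => i _; rewrite (eq_big_seq (fun=> c i)); last by move=> x; apply: ke.
by rewrite big_const_seq count_predT size_tuple iter_addr_0 mulr_natr.
Qed.

(** The trace of a commutator vanishes on every stable subspace. *)
Lemma lftrace_commutator (I : finType) (W : I -> {vspace V}) (c : I -> K) f g :
  directv (\sum_i W i) ->
  (forall i w, w \in W i -> f w \in (\sum_i W i)%VS) ->
  (forall i w, w \in W i -> g w \in (\sum_i W i)%VS) ->
  (forall i w, w \in W i -> f (g w) - g (f w) = c i *: w) ->
  \sum_i c i * (\dim (W i))%:R = 0.
Proof.
set M := (\sum_i W i)%VS => dW fW gW fgW.
have stab (h : 'End(V)) : (forall i w, w \in W i -> h w \in M) -> forall w, w \in M -> h w \in M.
  move=> hW w /memv_sumP[u uW ->]; rewrite linear_sum; apply: memv_suml => i _.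
  exact/hW/uW.
pose p := projv M; pose f' := (f \o p)%VF; pose g' := (g \o p)%VF.
have E : lftrace ((f' \o g') - (g' \o f'))%VF = 0.
  by rewrite lftraceB lftraceC subrr.
pose W' (i : option I) := if i is Some j then W j else (M^C)%VS.
pose c' (i : option I) := if i is Some j then c j else 0.
have sW' : (\sum_i W' i)%VS = fullv.
  rewrite (bigD1 None) //= (reindex_omap Some id) /=; last by case.
  rewrite addvC -[RHS](addv_complf M); congr (_ + _)%VS.
  by apply: eq_bigl => i; rewrite eqxx.
have dW' : directv (\sum_i W' i).
  apply/directvP; rewrite /= sW' (bigD1 None) //= (reindex_omap Some id) /=; last by case.
  under eq_bigl do rewrite eqxx.
  by have /directvP /= <- := dW; rewrite -/M dimv_compl subnK // dimvS ?subvf.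
have fg' i w : w \in W' i -> ((f' \o g') - (g' \o f'))%VF w = c' i *: w.
  case: i => [i|] /= wW; rewrite add_lfunE opp_lfunE !comp_lfunE.
    have wM : w \in M by apply: (subvP (sumv_sup i _ _)) wW.
    by rewrite /p (projv_id wM) !(projv_id (stab _ _ _ wM)) // (fgW i).
  have -> : p w = 0 by apply/eqP; rewrite -memv_ker lker_proj.
  by rewrite !linear0 addr0 scale0r.
have := lftrace_diag dW' sW' fg'; rewrite E (bigD1 None) //= mul0r add0r.
by rewrite (reindex_omap Some id) /= => [|[]//]; under eq_bigl do rewrite eqxx.
Qed.

End Trace.

Section Killing.

Variables (K : fieldType) (L : lieAlgebraType K).
Implicit Types (x y z : L) (U W : {vspace L}).

Lemma ad_linear : linear (@ad K L).
Proof.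
move=> a x y; apply/lfunP => z.
by rewrite adE add_lfunE scale_lfunE !adE bracketDl bracketZl.
Qed.
HB.instance Definition _ := GRing.isLinear.Build K L 'End(L) _ (@ad K L) ad_linear.

Definition killing x y : K := lftrace (ad x \o ad y)%VF.

Lemma killingC x y : killing x y = killing y x.
Proof. exact: lftraceC. Qed.

Lemma killing_linearl y : scalar (killing^~ y).
Proof.
by move=> a u v; rewrite /killing linearP comp_lfunDl -comp_lfunZl lftraceD lftraceZ.
Qed.

Lemma killing_linearr x : scalar (killing x).
Proof. by move=> a u v; rewrite 3!(killingC x) killing_linearl. Qed.
HB.instance Definition _ x := GRing.isLinear.Build K L K _ (killing x) (killing_linearr x).

Lemma killingDl x y z : killing (x + y) z = killing x z + killing y z.
Proof. by rewrite -[x]scale1r killing_linearl mul1r scale1r. Qed.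

Lemma killingZl a x z : killing (a *: x) z = a * killing x z.
Proof. by rewrite killingC linearZ killingC. Qed.

Lemma killingBl x y z : killing (x - y) z = killing x z - killing y z.
Proof. by rewrite killingDl -scaleN1r killingZl mulN1r. Qed.

Lemma killingZr a x z : killing x (a *: z) = a * killing x z.
Proof. exact: linearZ. Qed.

Lemma killing0l z : killing 0 z = 0.
Proof. by rewrite killingC linear0. Qed.

Lemma killing_sumr x I r (P : pred I) (F : I -> L) :
  killing x (\sum_(i <- r | P i) F i) = \sum_(i <- r | P i) killing x (F i).
Proof. exact: linear_sum. Qed.

Lemma killing_suml I r (P : pred I) (F : I -> L) y :
  killing (\sum_(i <- r | P i) F i) y = \sum_(i <- r | P i) killing (F i) y.
Proof. by rewrite killingC linear_sum; apply: eq_bigr => i _; exact: killingC. Qed.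

(** [ad (D x)] is the commutator of [D] and [ad x], and the trace of a commutator
    vanishes. *)
Lemma killing_derivation (D : 'End(L)) x y : derivation D ->
  killing (D x) y = - killing x (D y).
Proof.
move=> dD; have adD z : ad (D z) = ((D \o ad z) - (ad z \o D))%VF.
  apply/lfunP => u; rewrite add_lfunE opp_lfunE !comp_lfunE !adE dD.
  by rewrite addrK.
apply/eqP; rewrite -subr_eq0 opprK /killing !adD -lftraceD.
rewrite comp_lfunDl comp_lfunDr comp_lfunNl comp_lfunNr !comp_lfunA.
by rewrite addrA subrK lftraceB -comp_lfunA lftraceC subrr.
Qed.

Lemma killing_invariant x y z : killing <|x, y|> z = - killing y <|x, z|>.
Proof. by rewrite -!adE killing_derivation //; apply: ad_derivation. Qed.

Definition automorphism (s : 'End(L)) :=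
  lker s == 0%VS /\ forall x y, s <|x, y|> = <|s x, s y|>.

Lemma killing_automorphism s x y : automorphism s ->
  killing (s x) (s y) = killing x y.
Proof.
move=> [s0 sb]; have ads z : ad (s z) = (s \o ad z \o s^-1)%VF.
  apply/lfunP => u; rewrite !comp_lfunE !adE /=.
  by rewrite sb lker0_lfunVK.
rewrite /killing !ads -!comp_lfunA lker0_compKf // lftraceC -!comp_lfunA.
by rewrite lker0_compVf // comp_lfun1r.
Qed.

Lemma killing_perp U : exists W : {vspace L},
  (forall v, v \in W <-> (forall u, u \in U -> killing u v = 0)) /\
  (\dim {:L} <= \dim U + \dim W)%N.
Proof.
pose F (v : L) : 'rV[K]_(\dim U) := \row_i killing (vbasis U)`_i v.
have Flin : linear F by move=> a u v; apply/rowP => i; rewrite !mxE linearP.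
pose FM := GRing.isLinear.Build _ _ _ _ F Flin.
pose FL : {linear L -> 'rV[K]_(\dim U)} := HB.pack F FM.
exists (lker (linfun FL)); split=> [v|]; last first.
  rewrite -(limg_ker_dim (linfun FL) {:L}) capfv addnC leq_add2r.
  by apply: leq_trans (dimvS (subvf _)) _; rewrite dimvf dim_matrix mul1r.
rewrite memv_ker lfunE /=; split=> [/eqP/rowP vF u uU | vU]; last first.
  apply/eqP/rowP => i; rewrite !mxE vU // vbasis_mem //.
  by apply: mem_nth; rewrite size_tuple.
rewrite (coord_vbasis uU) killing_suml big1 // => i _.
by have := vF i; rewrite killingZl !mxE => ->; rewrite mulr0.
Qed.

Definition nondegenerate := forall x, (forall y, killing x y = 0) -> x = 0.

(** [W] meets the orthogonal of a complement of [U] only in the radical of the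
    form. *)
Lemma dim_killing_perp U W : nondegenerate ->
  (forall u v, u \in U -> v \in W -> killing u v = 0) ->
  (\dim U + \dim W <= \dim {:L})%N.
Proof.
move=> nd UW; have [W' [W'P dW']] := killing_perp (U^C)%VS.
have W0 : (W :&: W')%VS = 0%VS.
  apply/eqP; rewrite -subv0; apply/subvP => v; rewrite memv_cap => /andP[vW /W'P vW'].
  rewrite memv0; apply/eqP/nd => y; rewrite killingC.
  have : y \in (U + U^C)%VS by rewrite addv_complf memvf.
  by move=> /memv_addP[u uU [w wU ->]]; rewrite killingDl UW // vW' // addr0.
have := dimvS (subvf (W + W')); rewrite dimv_disjoint_sum //.
by have := dimvS (subvf U); move: dW'; rewrite dimv_compl; lia.
Qed.

End Killing.

(** * Jordan decomposition of a derivation *)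

Section GeneralizedEigenvectors.

Variables (K : fieldType) (V : vectType K) (D : 'End(V)).

Definition geneig a v := exists n, pev D (('X - a%:P) ^+ n) v = 0.

Lemma pev_eigen (p : {poly K}) a v : D v = a *: v -> pev D p v = p.[a] *: v.
Proof.
move=> Dv; elim/poly_ind: p => [|p c IHp]; first by rewrite pev0 horner0 scale0r.
rewrite pevD pevXl pevC IHp linearZ /= Dv hornerMXaddC scalerDl.
by rewrite scalerA.
Qed.

Lemma geneig_disjoint a b v : a != b -> geneig a v -> geneig b v -> v = 0.
Proof.
move=> ab [n nv] [m mv]; apply: pev_coprime nv mv.
by apply/coprimep_expl/coprimep_expr/coprimep_XsubC2; rewrite subr_eq0 eq_sym.
Qed.

(** The polynomial vanishing at all the eigenvalues but one isolates one term of
    the sum. *)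
Lemma eigen_independent (I : finType) (mu : I -> K) (u : I -> V) : injective mu ->
  (forall i, D (u i) = mu i *: u i) -> \sum_i u i = 0 -> forall i, u i = 0.
Proof.
move=> muI Du su0 i; pose p := \prod_(j | j != i) ('X - (mu j)%:P).
have := congr1 (pev D p) su0; rewrite linear_sum linear0 (bigD1 i) //= big1.
  rewrite addr0 (pev_eigen _ (Du i)) => /eqP; rewrite scaler_eq0 => /orP[|/eqP //].
  rewrite /p horner_prod => /prodf_eq0[j ji].
  by rewrite hornerXsubC subr_eq0 (inj_eq muI) eq_sym (negPf ji).
move=> j ji; rewrite (pev_eigen _ (Du j)) /p horner_prod (bigD1 j) //=.
by rewrite hornerXsubC subrr mul0r scale0r.
Qed.

End GeneralizedEigenvectors.

Section DerivationEigenvectors.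

Variables (K : fieldType) (L : lieAlgebraType K) (D : 'End(L)).
Hypothesis dD : derivation D.


(** [D - (a + b)] acts on a bracket by the Leibniz rule for [D - a] and [D - b],
    so powers of it eventually kill one of the factors. *)
Lemma geneig_bracket a b x y :
  geneig D a x -> geneig D b y -> geneig D (a + b) <|x, y|>.
Proof.
suff H n : forall i j u v, (i + j <= n)%N -> pev D (('X - a%:P) ^+ i) u = 0 ->
    pev D (('X - b%:P) ^+ j) v = 0 -> pev D (('X - (a + b)%:P) ^+ n) <|u, v|> = 0.
  by move=> [i xi] [j yj]; exists (i + j)%N; apply: (H _ i j).
elim: n => [|n IHn] [|i] [|j] u v //= lij.
- by rewrite expr0 pev1 => ->; rewrite bracket0l linear0.
- by rewrite expr0 pev1 => ->; rewrite bracket0l linear0.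
- by rewrite expr0 pev1 => ->; rewrite bracket0l linear0.
- by rewrite [in pev D (_ ^+ 0)]expr0 pev1 => _ ->; rewrite !linear0.
move=> ui vj; rewrite pevS pev_XsubC dD.
have -> : <|D u, v|> + <|u, D v|> - (a + b) *: <|u, v|> =
    <|pev D ('X - a%:P) u, v|> + <|u, pev D ('X - b%:P) v|>.
  by rewrite !pev_XsubC bracketBl bracketBr bracketZl bracketZr scalerDl opprD addrACA.
rewrite linearD /= (IHn i j.+1) ?(IHn i.+1 j) ?addr0 -?pevS //; lia.
Qed.

(** The same induction as for [geneig_bracket]: the invariance of the Killing
    form expresses [(a + b) * killing x y] through pairings where [D - a] or
    [D - b] has been applied once more. *)
Lemma killing_geneig a b x y : a + b != 0 ->
  geneig D a x -> geneig D b y -> killing x y = 0.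
Proof.
move=> ab; suff H n : forall i j u v, (i + j <= n)%N -> pev D (('X - a%:P) ^+ i) u = 0 ->
    pev D (('X - b%:P) ^+ j) v = 0 -> killing u v = 0.
  by move=> [i xi] [j yj]; apply: (H (i + j)%N i j).
elim: n => [|n IHn] [|i] [|j] u v //= lij.
- by rewrite expr0 pev1 => ->; rewrite killingC linear0.
- by rewrite expr0 pev1 => ->; rewrite killingC linear0.
- by rewrite expr0 pev1 => ->; rewrite killingC linear0.
- by rewrite [in pev D (_ ^+ 0)]expr0 pev1 => _ ->; rewrite linear0.
move=> ui vj; apply: (mulfI ab); rewrite mulr0.
have E1 : killing (pev D ('X - a%:P) u) v = 0 by apply: (IHn i j.+1); rewrite -?pevS //; lia.
have E2 : killing u (pev D ('X - b%:P) v) = 0 by apply: (IHn i.+1 j); rewrite -?pevS //; lia.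
move: E1 E2; rewrite !pev_XsubC killingBl killingZl killing_derivation // linearB /= killingZr.
set A := killing u (D v); set B := killing u v => E1 E2.
have -> : (a + b) * B = - (- A - a * B) - (A - b * B) by ring.
by rewrite E1 E2 subr0 oppr0.
Qed.

End DerivationEigenvectors.

(** The additive Jordan decomposition of [D]: [pi a] is the projection onto the
    generalised eigenspace of [a], [A] lists the eigenvalues and [N] is the
    nilpotent part. The stability fields record that [pi a] and [N] are
    polynomials in [D]. *)
Record jordan_grading (K : fieldType) (L : lieAlgebraType K) (D : 'End(L))
  (A : seq K) (pi : K -> 'End(L)) (N : 'End(L)) : Prop := JordanGrading {
  jg_sum : forall v, \sum_(a <- A) pi a v = v;
  jg_orth : forall a b v, a != b -> pi a (pi b v) = 0;
  jg_out : forall a v, a \notin A -> pi a v = 0;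
  jg_geneig : forall a v, geneig D a v -> pi a v = v;
  jg_pi : forall a v, geneig D a (pi a v);
  jg_bracket : forall a b x y, pi (a + b) <|pi a x, pi b y|> = <|pi a x, pi b y|>;
  jg_decomp : forall v, D v = N v + \sum_(a <- A) a *: pi a v;
  jg_nilp : exists n, forall v, iter n N v = 0;
  jg_comm : forall a v, pi a (N v) = N (pi a v);
  jg_der : derivation N;
  jg_pi_stable : forall (U : {vspace L}), (forall u, u \in U -> D u \in U) ->
    forall a u, u \in U -> pi a u \in U;
  jg_N_stable : forall (U : {vspace L}), (forall u, u \in U -> D u \in U) ->
    forall u, u \in U -> N u \in U;
  jg_killing : forall a b x y, a + b != 0 -> killing (pi a x) (pi b y) = 0;
  jg_uniq : uniq A
}.

Lemma derivation_jordan (K : closedFieldType) (L : lieAlgebraType K) (D : 'End(L)) :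
  derivation D -> exists A pi N, jordan_grading D A pi N.
Proof.
move=> dD; have [A [e [n [sume nile orth out uA]]]] := primary_decomposition D.
pose pi a : 'End(L) := linfun (pev D (e a)).
pose N : 'End(L) := D - \sum_(a <- A) a *: pi a.
have piE a v : pi a v = pev D (e a) v by rewrite lfunE.
have gpi a v : geneig D a (pi a v) by exists n; rewrite piE nile.
have outpi a v : a \notin A -> pi a v = 0 by move=> /out E; rewrite piE E pev0.
have sumpi v : \sum_(a <- A) pi a v = v.
  by rewrite -[RHS]sume; apply: eq_bigr => a _; rewrite piE.
have pi0 a b v : a != b -> geneig D a v -> pi b v = 0.
  move=> ab av; apply: (geneig_disjoint ab) (gpi b v).
  by have [m mv] := av; exists m; rewrite piE pevMC mv linear0.
have pi1 a v : geneig D a v -> pi a v = v.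
  move=> av; rewrite -[RHS]sumpi; have [aA|aA] := boolP (a \in A).
    by rewrite (bigD1_seq a) //= big1 ?addr0 // => b ba; rewrite (pi0 a) // eq_sym.
  rewrite outpi // big1_seq // => b /andP[_ bA]; rewrite (pi0 a) //.
  by apply: contraNneq aA => ->.
have NE v : N v = D v - \sum_(a <- A) a *: pi a v.
  rewrite add_lfunE opp_lfunE sum_lfunE; congr (_ - _).
  by apply: eq_bigr => a _; rewrite scale_lfunE.
have Nhom a v : geneig D a v -> N v = D v - a *: v.
  move=> av; rewrite NE; congr (_ - _); have [aA|aA] := boolP (a \in A).
    rewrite (bigD1_seq a) //= big1 ?addr0 ?pi1 // => b ba.
    by rewrite (pi0 a) ?scaler0 // eq_sym.
  have -> : v = 0 by rewrite -(pi1 a v av) outpi.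
  by rewrite scaler0 big1 // => b _; rewrite linear0 scaler0.
have gD a v : geneig D a v -> geneig D a (D v).
  by move=> [m mv]; exists m; rewrite -pevX pevMC mv linear0.
have comm a v : pi a (N v) = N (pi a v).
  rewrite (Nhom a (pi a v)) // NE linearB /= linear_sum /=; congr (_ - _).
    by rewrite !piE -!pevX pevMC.
  have [aA|aA] := boolP (a \in A).
    rewrite (bigD1_seq a) //= big1 ?addr0 ?linearZ /= ?(pi1 a (pi a v)) // => b ba.
    by rewrite linearZ /= (pi0 b a (pi b v)) ?scaler0 //.
  by rewrite (outpi a v) // scaler0 big1 // => b _; rewrite (outpi a).
exists A, pi, N; split=> //.
- by move=> a b v ab; rewrite (pi0 b) // eq_sym.
- by move=> a b x y; apply: pi1; apply: geneig_bracket.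
- by move=> v; rewrite NE subrK.
- exists n => v; rewrite -[v]sumpi.
  have itlin : linear (iter n N) by apply: iter_lfun_linear.
  pose itL : {linear L -> L} := HB.pack (iter n N) (GRing.isLinear.Build _ _ _ _ (iter n N) itlin).
  rewrite -[iter n N _]/(itL _) linear_sum big1 // => a _ /=.
  suff -> : iter n N (pi a v) = pev D (('X - a%:P) ^+ n) (pi a v) by rewrite piE nile.
  elim: (n) => [|m IHm]; first by rewrite expr0 pev1.
  rewrite iterS IHm (Nhom a); last first.
    by have [k kv] := gpi a v; exists k; rewrite pevMC kv linear0.
  by rewrite -pev_XsubC -pevM -exprS.
- move=> x y; rewrite -[x]sumpi -[y]sumpi; set X := \sum_(a <- A) pi a x.
  rewrite bracket_sumr linear_sum [X in _ = X]addrC linear_sum !bracket_sumr -big_split.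
  apply: eq_bigr => b _ /=; rewrite /X linear_sum !bracket_suml linear_sum -big_split.
  apply: eq_bigr => a _ /=; rewrite addrC.
  rewrite (Nhom (a + b)) ?(Nhom a (pi a x)) ?(Nhom b (pi b y)) //; last exact: geneig_bracket.
  by rewrite dD bracketBl bracketBr bracketZl bracketZr scalerDl opprD addrACA.
- by move=> U DU a u uU; rewrite piE pev_stable.
- move=> U DU u uU; rewrite NE memvB ?DU // memv_suml // => a _.
  by rewrite memvZ // piE pev_stable.
- by move=> a b x y ab; apply: killing_geneig ab _ _.
Qed.

(** * Polynomial curves and exponentials *)

(** Reordering a double sum by the total degree [l], as in a product of two
    polynomials of degrees less than [M] and [M']. *)
Lemma triangle_sum (V : zmodType) (F : nat -> nat -> V) M M' :
  (forall i j, (M <= i)%N || (M' <= j)%N -> F i j = 0) ->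
  \sum_(i < M) \sum_(j < M') F i j = \sum_(l < M + M') \sum_(i < l.+1) F i (l - i)%N.
Proof.
move=> F0; set P := (M + M')%N.
transitivity (\sum_(i < P) \sum_(l < P | (i <= l)%N) F i (l - i)%N); last first.
  rewrite (exchange_big_dep xpredT) //=; apply: eq_bigr => l _.
  by rewrite (big_ord_widen_cond P xpredT (fun i => F i (l - i)%N)).
rewrite /P big_split_ord /= [X in _ = _ + X]big1 ?addr0; last first.
  by move=> i _; rewrite big1 // => j _; rewrite F0 // leq_addr.
apply: eq_bigr => i _; rewrite -/P.
rewrite -(big_mkord (fun j => (i <= j)%N) (fun j => F i (j - i)%N)).
have E := @big_nat_widenl _ 0 +%R i 0 P xpredT (fun j => F i (j - i)%N) (leq0n _).
have E' := @big_addn _ 0 +%R 0 P i xpredT (fun j => F i (j - i)%N).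
rewrite add0n /= in E'; rewrite /= in E; rewrite -E E'.
have ltiM := ltn_ord i; rewrite (big_cat_nat _ (n := M')) //=; last by rewrite /P; lia.
rewrite big_mkord [X in _ = _ + X]big_nat [X in _ = _ + X]big1 ?addr0; last first.
  by move=> j; case/andP=> Mj _; rewrite addnK F0 // Mj orbT.
by apply: eq_bigr => j _; rewrite addnK.
Qed.

Section Curves.

Variables (K : numFieldType) (V : vectType K).
Implicit Types (c : nat -> V) (t : K) (U : {vspace V}).

(** The value at [t] of the polynomial with coefficients [c 0], ..., [c (M - 1)] in
    [V]. *)
Definition curve c M t : V := \sum_(i < M) t ^+ i *: c i.

(** Modulo [U], the coordinates of the curve are polynomials with infinitely many
    roots. *)
Lemma curve_mem c M U : (forall t, curve c M t \in U) -> forall i, (i < M)%N -> c i \in U.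
Proof.
move=> cU; pose q : 'End(V) := (\1%VF - projv U).
move=> i iM; suff : q (c i) = 0.
  rewrite add_lfunE opp_lfunE id_lfunE => /eqP; rewrite subr_eq0 => /eqP ->.
  exact: memv_proj.
have qc t : curve (q \o c) M t = 0.
  rewrite -[RHS](subrr (curve c M t)) -[X in _ - X](projv_id (cU t)).
  rewrite -[X in X - _]id_lfunE -opp_lfunE -add_lfunE -/q linear_sum.
  by apply: eq_bigr => j _; rewrite linearZ.
rewrite (coord_vbasis (memvf (q (c i)))) big1 // => j _.
pose p := \poly_(l < M) coord (vbasis {:V}) j (q (c l)).
suff p0 : p = 0 by have := coef_poly M (fun l => coord (vbasis {:V}) j (q (c l))) i;
  rewrite -/p p0 coef0 iM => <-; rewrite scale0r.
have roots : all (root p) [seq l%:R | l <- iota 0 M].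
  apply/allP => _ /mapP[l _ ->]; apply/eqP; rewrite horner_poly.
  have := congr1 (coord (vbasis {:V}) j) (qc l%:R); rewrite linear0 /curve linear_sum => E.
  by rewrite -[RHS]E; apply: eq_bigr => m _; rewrite [RHS]linearZ mulrC.
apply/eqP; apply: contraTT (size_poly M (fun l => coord (vbasis {:V}) j (q (c l)))) => p0.
rewrite -/p -ltnNge; have := max_poly_roots p0 roots; rewrite size_map size_iota; apply.
by rewrite map_inj_uniq ?iota_uniq //; apply: mulrIn; apply: oner_neq0.
Qed.

End Curves.

Section CurveOperations.

Variable K : numFieldType.

(** Translating the parameter does not change the leading coefficient. *)
Lemma curve_shift (V : vectType K) (c : nat -> V) m s :
  exists2 d : nat -> V, d m = c m & forall t, curve d m.+1 t = curve c m.+1 (t + s).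
Proof.
exists (fun j => \sum_(i < m.+1) (s ^+ (i - j) *+ 'C(i, j)) *: c i) => [|t].
  rewrite big_ord_recr /= subnn binn expr0 scale1r big1 ?add0r // => i _.
  by rewrite bin_small // mulr0n scale0r.
rewrite /curve; under eq_bigr do rewrite scaler_sumr.
rewrite exchange_big; apply: eq_bigr => i _ /=.
rewrite -(big_mkord xpredT (fun j => t ^+ j *: ((s ^+ (i - j) *+ 'C(i, j)) *: c i))).
rewrite (big_cat_nat _ (n := i.+1)) //= [X in _ + X]big_nat [X in _ + X]big1 ?addr0.
  rewrite big_mkord addrC exprDn scaler_suml; apply: eq_bigr => j _.
  by rewrite scalerA mulrnAr mulrC.
by move=> j /andP[ij _]; rewrite bin_small // mulr0n scale0r scaler0.
Qed.

Lemma curve_widen (V : vectType K) (c : nat -> V) m j :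
  exists2 d : nat -> V, d (j + m)%N = c m &
    forall t, curve d (j + m).+1 t = t ^+ j *: curve c m.+1 t.
Proof.
exists (fun i => if (i < j)%N then 0 else c (i - j)%N) => [|t].
  by rewrite ltnNge leq_addr addKn.
rewrite /curve -addnS big_split_ord /= big1 ?add0r => [|i _]; last by rewrite ltn_ord scaler0.
rewrite scaler_sumr; apply: eq_bigr => i _.
by rewrite ltnNge leq_addr addKn scalerA exprD.
Qed.

Section Bilinear.

Variables (V V' W : vectType K) (B : V -> V' -> W).
Hypotheses (Bl : forall y, linear (B^~ y)) (Br : forall x, linear (B x)).

Let B0l y : B 0 y = 0.
Proof. by have := Bl y (-1) 0 0; rewrite scaleN1r oppr0 addr0 scaleN1r addNr. Qed.
Let B0r x : B x 0 = 0.
Proof. by have := Br x (-1) 0 0; rewrite scaleN1r oppr0 addr0 scaleN1r addNr. Qed.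
Let BDl x x' y : B (x + x') y = B x y + B x' y.
Proof. by have := Bl y 1 x x'; rewrite !scale1r. Qed.
Let BDr x y y' : B x (y + y') = B x y + B x y'.
Proof. by have := Br x 1 y y'; rewrite !scale1r. Qed.
Let BZl a x y : B (a *: x) y = a *: B x y.
Proof. by have := Bl y a x 0; rewrite B0l !addr0. Qed.
Let BZr a x y : B x (a *: y) = a *: B x y.
Proof. by have := Br x a y 0; rewrite B0r !addr0. Qed.
Let Bsuml n (F : 'I_n -> V) y : B (\sum_i F i) y = \sum_i B (F i) y.
Proof. by elim/big_rec2: _ => [|i u v _ <-]; rewrite ?B0l ?BDl. Qed.
Let Bsumr n (F : 'I_n -> V') x : B x (\sum_i F i) = \sum_i B x (F i).
Proof. by elim/big_rec2: _ => [|i u v _ <-]; rewrite ?B0r ?BDr. Qed.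

Lemma bilinear_curves (c : nat -> V) (c' : nat -> V') M M' s t :
  (forall i, (M <= i)%N -> c i = 0) -> (forall i, (M' <= i)%N -> c' i = 0) ->
  B (curve c M s) (curve c' M' t) = \sum_(l < M + M')
     \sum_(i < l.+1) (s ^+ i * t ^+ (l - i)) *: B (c i) (c' (l - i)%N).
Proof.
move=> c0 c'0; rewrite -(triangle_sum (F := fun i j => (s ^+ i * t ^+ j) *: B (c i) (c' j))).
  rewrite Bsuml; apply: eq_bigr => i _; rewrite Bsumr; apply: eq_bigr => j _.
  by rewrite BZl BZr scalerA.
by move=> i j /orP[/c0|/c'0] ->; rewrite ?B0l ?B0r scaler0.
Qed.

Lemma curve_bilinear (c : nat -> V) (c' : nat -> V') m m' :
  exists2 d : nat -> W, d (m + m')%N = B (c m) (c' m') &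
    forall t, curve d (m + m').+1 t = B (curve c m.+1 t) (curve c' m'.+1 t).
Proof.
pose e i := if (i <= m)%N then c i else 0; pose e' i := if (i <= m')%N then c' i else 0.
pose F l := \sum_(i < l.+1) B (e i) (e' (l - i)%N).
exists F => [|t].
  have lt : (m < (m + m').+1)%N by lia.
  rewrite /F (bigD1 (Ordinal lt)) //= /e /e' leqnn addKn leqnn big1 ?addr0 // => i ne.
  case: leqP => // im; rewrite ?B0l //; case: leqP => // im'; rewrite ?B0r //.
  by case/eqP: ne; apply: val_inj => /=; lia.
have Ee : curve c m.+1 t = curve e m.+1 t.
  by apply: eq_bigr => i _; rewrite /e -ltnS ltn_ord.
have Ee' : curve c' m'.+1 t = curve e' m'.+1 t.
  by apply: eq_bigr => i _; rewrite /e' -ltnS ltn_ord.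
rewrite Ee Ee' bilinear_curves; last 2 first.
- by move=> i; rewrite /e ltnNge => /negPf ->.
- by move=> i; rewrite /e' ltnNge => /negPf ->.
have -> : (m.+1 + m'.+1 = (m + m').+2)%N by lia.
rewrite big_ord_recr /= [X in _ = _ + X]big1 ?addr0 => [|i _]; last first.
  rewrite /e /e'; case: leqP => im; rewrite ?B0l ?scaler0 //.
  by case: leqP => im'; rewrite ?B0r ?scaler0 //; lia.
apply: eq_bigr => l _; rewrite scaler_sumr; apply: eq_bigr => i _.
by rewrite -exprD subnKC // -ltnS.
Qed.

End Bilinear.

End CurveOperations.

Section Exponential.

Variables (K : numFieldType) (V : vectType K) (N : 'End(V)) (n : nat).
Hypothesis Nn : forall v, iter n N v = 0.

(* sealed against unwanted rewriting of its scalar factor *)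
Fact dpow_key : unit. Proof. exact: tt. Qed.
Definition dpow := locked_with dpow_key (fun i (v : V) => (i`!%:R : K)^-1 *: iter i N v).
Lemma dpowE i v : dpow i v = (i`!%:R)^-1 *: iter i N v.
Proof. by rewrite /dpow unlock. Qed.
(** The exponential of [t N], a finite sum because [N ^ n = 0]. *)
Definition expN t v := curve (dpow^~ v) n t.

Lemma dpow_linear i : linear (dpow i).
Proof.
move=> a u v; rewrite !dpowE iter_lfun_linear scalerDr !scalerA.
by rewrite [X in X *: _]mulrC.
Qed.
HB.instance Definition _ i := GRing.isLinear.Build K V V _ (dpow i) (dpow_linear i).

Lemma expN_linear t : linear (expN t).
Proof.
move=> a u v; rewrite /expN /curve scaler_sumr -big_split; apply: eq_bigr => i _ /=.
by rewrite linearP scalerDr !scalerA [a * _]mulrC.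
Qed.
HB.instance Definition _ t := GRing.isLinear.Build K V V _ (expN t) (expN_linear t).

Lemma dpowS i v : i.+1%:R *: dpow i.+1 v = N (dpow i v).
Proof.
rewrite !dpowE [RHS]linearZ scalerA factS natrM invfM mulrA divff ?mul1r //.
by rewrite pnatr_eq0.
Qed.

Lemma dpowZ i a v : dpow i (a *: v) = a *: dpow i v.
Proof. exact: linearZ. Qed.

Lemma dpow0 v : dpow 0 v = v. Proof. by rewrite !dpowE invr1 scale1r. Qed.

Lemma dpow_nilp i v : (n <= i)%N -> dpow i v = 0.
Proof.
have it0 j : iter j N 0 = 0 by elim: j => //= j ->; rewrite linear0.
by move=> /subnK <-; rewrite !dpowE iterD Nn it0 scaler0.
Qed.

Lemma expN_wide M t v : (n <= M)%N -> expN t v = curve (dpow^~ v) M t.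
Proof.
move=> nM; rewrite /expN /curve (big_ord_widen M (fun i => t ^+ i *: dpow i v)) //.
rewrite big_mkcond; apply: eq_bigr => i _; case: ltnP => // ni.
by rewrite dpow_nilp // scaler0.
Qed.

Lemma dpow_dpow i j v : dpow i (dpow j v) = 'C(i + j, i)%:R *: dpow (i + j) v.
Proof.
have lin : linear (iter i N) := iter_lfun_linear N i.
pose itL : {linear V -> V} := HB.pack (iter i N) (GRing.isLinear.Build _ _ _ _ (iter i N) lin).
rewrite (dpowE i) (dpowE j) -[iter i N _]/(itL _) linearZ /= !dpowE iterD !scalerA; congr (_ *: _).
have f0 k : k`!%:R != 0 :> K by rewrite pnatr_eq0 -lt0n fact_gt0.
apply: (mulIf (f0 (i + j)%N)); rewrite -[RHS]mulrA mulVf // mulr1.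
have := bin_fact (leq_addr j i); rewrite addKn => <-.
rewrite !natrM; field; rewrite ?f0 //.
Qed.

Lemma expND s t v : expN (s + t) v = expN s (expN t v).
Proof.
transitivity (\sum_(i < n) \sum_(j < n) (s ^+ i * t ^+ j) *: dpow i (dpow j v)).
  rewrite (triangle_sum (F := fun i j => (s ^+ i * t ^+ j) *: dpow i (dpow j v))).
    rewrite (@expN_wide (n + n)) ?leq_addr //; apply: eq_bigr => l _.
    rewrite addrC exprDn scaler_suml; apply: eq_bigr => i _.
    have il : (i <= l)%N by rewrite -ltnS.
    by rewrite dpow_dpow subnKC // [RHS]scalerA mulr_natr [_ * s ^+ i]mulrC.
  by move=> i j /orP[ni|nj]; [rewrite (dpow_nilp _ ni)|rewrite (dpow_nilp v nj) linear0]; rewrite scaler0.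
apply: eq_bigr => i _; rewrite /expN /curve linear_sum scaler_sumr.
by apply: eq_bigr => j _; rewrite -scalerA; congr (_ *: _); apply/esym/dpowZ.
Qed.

Lemma expN0 v : expN 0 v = v.
Proof.
rewrite (@expN_wide n.+1) // /curve big_ord_recl expr0 scale1r dpow0 big1 ?addr0 // => i _.
by rewrite expr0n scale0r.
Qed.

Lemma expNK t v : expN (- t) (expN t v) = v.
Proof. by rewrite -expND addNr expN0. Qed.

End Exponential.

Section DerivationExponential.

Variables (K : numFieldType) (L : lieAlgebraType K) (N : 'End(L)) (n : nat).
Hypotheses (Nn : forall v, iter n N v = 0) (dN : derivation N).

(** The Leibniz rule in terms of divided powers, where no binomial coefficients
    appear. *)
Lemma dpow_bracket l x y :
  dpow N l <|x, y|> = \sum_(i < l.+1) <|dpow N i x, dpow N (l - i) y|>.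
Proof.
elim: l => [|l IHl]; first by rewrite big_ord1 !dpow0.
have l0 : l.+1%:R != 0 :> K by rewrite pnatr_eq0.
apply: (scalerI l0); rewrite dpowS IHl [LHS]linear_sum.
under eq_bigr do rewrite /= dN -!dpowS bracketZl bracketZr.
rewrite big_split /= scaler_sumr.
transitivity (\sum_(i < l.+2) (i%:R *: <|dpow N i x, dpow N (l.+1 - i) y|> +
   (l.+1 - i)%:R *: <|dpow N i x, dpow N (l.+1 - i) y|>)).
  rewrite [RHS]big_split /= [X in _ = X + _]big_ord_recl scale0r add0r; congr (_ + _).
  rewrite [RHS]big_ord_recr /= subnn scale0r addr0; apply: eq_bigr => i _.
  by rewrite subSn // -ltnS.
apply: eq_bigr => i _; rewrite -scalerDl -natrD subnKC // -ltnS; exact: ltn_ord.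
Qed.

Lemma expN_bracket t x y : expN N n t <|x, y|> = <|expN N n t x, expN N n t y|>.
Proof.
rewrite (bilinear_curves (B := @bracket K L)).
- rewrite (expN_wide Nn (M := (n + n)%N)) ?leq_addr //; apply: eq_bigr => l _.
  rewrite dpow_bracket scaler_sumr; apply: eq_bigr => i _.
  by rewrite -exprD subnKC // -ltnS.
- exact: bracket_linearl.
- exact: bracket_linearr.
- by move=> i; apply: dpow_nilp.
- by move=> i; apply: dpow_nilp.
Qed.

Lemma expN_automorphism t : automorphism (linfun (expN N n t)).
Proof.
split; last by move=> x y; rewrite !lfunE /= expN_bracket.
by apply/lker0P; apply: (can_inj (g := expN N n (- t))) => v; rewrite lfunE /= expNK.
Qed.

End DerivationExponential.

(** * Degenerations of subspaces *)

(** What survives a passage to the limit of subspaces under automorphisms of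
    [L]. A limit preserves dimensions, but the lower bound is what limits give
    directly, and orthogonality supplies the other bound
    (see [degeneration_dimE]). *)
Record degeneration (K : fieldType) (L : lieAlgebraType K)
    (F : {vspace L} -> {vspace L}) : Prop := Degeneration {
  dgS : forall A B, (A <= B)%VS -> (F A <= F B)%VS;
  dg_bracket : forall A B C, bracket_sub A B C -> bracket_sub (F A) (F B) (F C);
  dg_dim : forall A, (\dim A <= \dim (F A))%N;
  dg_killing : forall A B : {vspace L}, (forall x y, x \in A -> y \in B -> killing x y = 0) ->
    forall x y, x \in F A -> y \in F B -> killing x y = 0
}.

Lemma degeneration_id (K : fieldType) (L : lieAlgebraType K) :
  degeneration (@id {vspace L}).
Proof. by split. Qed.

Lemma degeneration_comp (K : fieldType) (L : lieAlgebraType K)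
    (F G : {vspace L} -> {vspace L}) :
  degeneration F -> degeneration G -> degeneration (F \o G).
Proof.
move=> dF dG; split=> [A B /(dgS dG)/(dgS dF) //|A B C|A|A B].
- by move=> /(dg_bracket dG)/(dg_bracket dF).
- exact: leq_trans (dg_dim dG A) (dg_dim dF _).
- by move=> /(dg_killing dG)/(dg_killing dF).
Qed.


(** ** The limit under a semisimple one-parameter group *)

Section LexicographicOrder.

Variable K : numClosedFieldType.
Implicit Types a b c d : K.

(** The lexicographic order on real and imaginary parts: a total order on the
    scalars that is compatible with addition. *)
Definition lexlt a b := ('Re a < 'Re b) || (('Re a == 'Re b) && ('Im a < 'Im b)).

Lemma lexlt_irr a : lexlt a a = false.
Proof. by rewrite /lexlt !ltxx andbF. Qed.

Lemma lexlt_trans b a c : lexlt a b -> lexlt b c -> lexlt a c.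
Proof.
rewrite /lexlt => /orP[ab|/andP[/eqP -> ab]] /orP[bc|/andP[/eqP <- bc]].
- by rewrite (lt_trans ab bc).
- by rewrite ab.
- by rewrite bc.
- by rewrite eqxx (lt_trans ab bc) orbT.
Qed.

Lemma lexlt_total a b : a != b -> lexlt a b || lexlt b a.
Proof.
move=> ab; rewrite /lexlt.
have [||Re_eq] := real_ltgtP (Creal_Re a) (Creal_Re b); rewrite ?orbT //=.
have [||Im_eq] := real_ltgtP (Creal_Im a) (Creal_Im b); rewrite ?orbT //=.
by case/eqP: ab; rewrite [a]Crect [b]Crect Re_eq Im_eq.
Qed.

Lemma lexlt_add2l c a b : lexlt (c + a) (c + b) = lexlt a b.
Proof. by rewrite /lexlt !raddfD /= !ltrD2l (inj_eq (addrI _)). Qed.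

Lemma lexlt_opp a b : lexlt (- a) (- b) = lexlt b a.
Proof. by rewrite /lexlt !raddfN /= !ltrN2 eqr_opp eq_sym. Qed.

Lemma lexlt_sub c a b : lexlt (c - a) (c - b) = lexlt b a.
Proof. by rewrite lexlt_add2l lexlt_opp. Qed.

Lemma lexlt_max (A : seq K) : A != [::] ->
  exists2 a, a \in A & forall b, b \in A -> ~~ lexlt a b.
Proof.
elim: A => // a [_ _|b A IHA _]; first by exists a => [|c]; rewrite ?inE // => /eqP ->; rewrite lexlt_irr.
have [//|m mA mM] := IHA; have [am|am] := boolP (lexlt a m).
  exists m => [|c]; first by rewrite inE mA orbT.
  rewrite inE => /predU1P[->|]; last exact: mM.
  by apply/negP => /(lexlt_trans am); rewrite lexlt_irr.
exists a => [|c]; first exact: mem_head.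
rewrite inE => /predU1P[->|cA]; first by rewrite lexlt_irr.
apply/negP => ac; have [E|] := eqVneq a m; first by have := mM _ cA; rewrite -E ac.
by move=> /lexlt_total; rewrite (negPf am) /= => /lexlt_trans /(_ ac) mc; have := mM _ cA; rewrite mc.
Qed.

End LexicographicOrder.

Section SemisimpleLimit.

Variables (K : numClosedFieldType) (L : lieAlgebraType K) (D : 'End(L)).
Variables (A : seq K) (pi : K -> 'End(L)) (N : 'End(L)).
Hypothesis J : jordan_grading D A pi N.
Implicit Types (x y v w : L) (U : {vspace L}).

Lemma jg_idem a v : pi a (pi a v) = pi a v.
Proof. by apply: (jg_geneig J); apply: (jg_pi J). Qed.

Lemma jg_eq0 v : (forall a, pi a v = 0) -> v = 0.
Proof. by move=> v0; rewrite -(jg_sum J v) big1 // => a _. Qed.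

Lemma jg_pi_bracket c x y :
  pi c <|x, y|> = \sum_(a <- A) <|pi a x, pi (c - a) y|>.
Proof.
have hom a b : pi c <|pi a x, pi b y|> = if b == c - a then <|pi a x, pi b y|> else 0.
  have := jg_bracket J a b x y; case: eqP => [->|/eqP ne]; first by rewrite addrC subrK.
  by move=> <-; rewrite (jg_orth J) // eq_sym; apply: contra ne => /eqP <-; rewrite addrC addKr.
rewrite -[in LHS](jg_sum J x) bracket_suml linear_sum; apply: eq_bigr => a _ /=.
rewrite -[in LHS](jg_sum J y) bracket_sumr linear_sum /=.
have [cA|cA] := boolP (c - a \in A).
  rewrite (bigD1_seq (c - a)) ?(jg_uniq J) //= hom eqxx big1 ?addr0 // => b /negPf ne.
  by rewrite hom ne.
rewrite (jg_out J y cA) linear0 big1_seq // => b /andP[_ bA]; rewrite hom.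
by case: eqP => // E; rewrite -E bA in cA.
Qed.

Lemma jg_killing_sum x y : killing x y = \sum_(a <- A) killing (pi a x) (pi (- a) y).
Proof.
rewrite -[in LHS](jg_sum J x) killing_suml; apply: eq_bigr => a _ /=.
rewrite -[in LHS](jg_sum J y) killing_sumr.
have hom b : b != - a -> killing (pi a x) (pi b y) = 0.
  by move=> ne; apply: (jg_killing J); rewrite addrC addr_eq0.
have [cA|cA] := boolP (- a \in A).
  by rewrite (bigD1_seq (- a)) ?(jg_uniq J) //= big1 ?addr0.
rewrite (jg_out J y cA) linear0 big1_seq // => b /andP[_ bA]; apply: hom.
by apply: contraNneq cA => <-.
Qed.

(** The component of [x] in [a] when [x] has no component in a larger
    eigenvalue: up to rescaling, the limit of [x] under the one-parameter group
    of the semisimple part. *)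
Definition leading U a v :=
  exists x, [/\ x \in U, pi a x = v & forall b, lexlt a b -> pi b x = 0].

Lemma leading0 U a : leading U a 0.
Proof. by exists 0; rewrite mem0v linear0; split=> // b _; rewrite linear0. Qed.

Lemma leadingP U a k v w : leading U a v -> leading U a w -> leading U a (k *: v + w).
Proof.
move=> [x [xU <- x0]] [y [yU <- y0]]; exists (k *: x + y).
rewrite memvD ?memvZ // linearP; split=> // b ab.
by rewrite linearP /= x0 // y0 // scaler0 addr0.
Qed.

Lemma semisimple_limit_exists : exists F : {vspace L} -> {vspace L},
  forall U v, v \in F U <-> (forall a, leading U a (pi a v)).
Proof.
suff /choice[F HF] : forall U : {vspace L}, exists F : {vspace L},
    forall v, v \in F <-> (forall a, leading U a (pi a v)) by exists F.
move=> U; apply: vspace_of_pred => [a|k v w Hv Hw a]; first by rewrite linear0; apply: leading0.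
by rewrite linearP; apply: leadingP.
Qed.

(** Each homogeneous component of an element of the limit is the leading
    component, for the lexicographic order on the eigenvalues, of an element of
    the given subspace; since the order is compatible with addition, leading
    components multiply. *)
Lemma semisimple_limit : exists F : {vspace L} -> {vspace L},
  [/\ degeneration F,
      forall U a v, v \in F U -> pi a v \in F U &
      forall U, (forall u, u \in U -> D u \in U) -> (U <= F U)%VS].
Proof.
have [F HF] := semisimple_limit_exists; exists F.
have Fpi U a v : v \in F U -> pi a v \in F U.
  move=> /HF vU; apply/HF => b; have [->|ba] := eqVneq a b; first by rewrite jg_idem.
  by rewrite (jg_orth J) 1?eq_sym //; apply: leading0.
have single x y a b : (forall c, lexlt a c -> pi c x = 0) -> (forall c, lexlt b c -> pi c y = 0) ->
    forall a', a' != a -> forall c, ~~ lexlt c (a + b) -> pi a' x = 0 \/ pi (c - a') y = 0.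
  move=> x0 y0 a' ne c cab; have /orP[lt|lt] := lexlt_total ne; last by left; apply: x0.
  right; apply: y0; have : lexlt (a + b - a) (a + b - a') by rewrite lexlt_sub.
  rewrite [a + b]addrC addrK => lt'; have [->|/lexlt_total] := eqVneq c (a + b).
    by rewrite [a + b]addrC.
  rewrite (negPf cab) /= => lt2; apply: (lexlt_trans lt').
  by rewrite ![_ - a']addrC lexlt_add2l [b + a]addrC.
split=> //; last first.
  move=> U DU; apply/subvP => u uU; apply/HF => a; exists (pi a u).
  split; [exact: (jg_pi_stable J) | exact: jg_idem |].
  by move=> b ab; rewrite (jg_orth J) //; apply: contraTneq ab => ->; rewrite lexlt_irr.
split.
- move=> U V /subvP UV; apply/subvP => v /HF vU; apply/HF => a.
  by have [x [xU ? ?]] := vU a; exists x; split=> //; apply: UV.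
- move=> U V W UVW v w /HF vU /HF wV; apply/HF => c.
  have /choice[x Hx] := vU; have /choice[y Hy] := wV.
  exists (\sum_(a <- A) <|x a, y (c - a)|>); split.
  + apply: memv_suml => a _; apply: UVW; [by have [] := Hx a | by have [] := Hy (c - a)].
  + rewrite linear_sum jg_pi_bracket; apply: eq_big_seq => a aA /=.
    have [_ xa x0] := Hx a; have [_ ya y0] := Hy (c - a).
    rewrite jg_pi_bracket (bigD1_seq a) ?(jg_uniq J) //= xa ya big1 ?addr0 // => a' ne.
    have [|->|->] := single _ _ _ _ x0 y0 a' ne c; rewrite ?bracket0l ?bracket0r //.
    by rewrite [a + _]addrC subrK lexlt_irr.
  + move=> d cd; rewrite linear_sum big1 // => a _ /=; rewrite jg_pi_bracket big1 // => a' _.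
    have [_ xa x0] := Hx a; have [_ ya y0] := Hy (c - a).
    have [->|ne] := eqVneq a' a.
      by rewrite (y0 (d - a)) ?bracket0r // ![_ - a]addrC lexlt_add2l.
    have [|->|->] := single _ _ _ _ x0 y0 a' ne d; rewrite ?bracket0l ?bracket0r //.
    by rewrite [a + _]addrC subrK; apply/negP => /(lexlt_trans cd); rewrite lexlt_irr.
- move=> U; pose r : 'End(L) := \sum_(a <- A) (projv (pi a @: F U) \o pi a)%VF.
  have rE v : r v = \sum_(a <- A) projv (pi a @: F U) (pi a v).
    by rewrite sum_lfunE; apply: eq_bigr => a _; rewrite comp_lfunE.
  apply: (leq_dim_inj (f := r)) => u uU.
    rewrite rE; apply: memv_suml => a _; have := memv_proj (pi a @: F U)%VS (pi a u).
    by move=> /memv_imgP[v vF ->]; apply: Fpi.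
  move=> ru0; apply: contrapT => u0.
  have [|a] := @lexlt_max _ [seq a <- A | pi a u != 0].
    apply: contra_notN u0 => /eqP E; apply: jg_eq0 => a; apply: contrapT => /eqP au.
    have aA : a \in A by apply: contraNT au => aA; rewrite (jg_out J).
    have : a \in [seq a <- A | pi a u != 0] by rewrite mem_filter au.
    by rewrite E.
  rewrite mem_filter => /andP[au aA] amax.
  have top b : lexlt a b -> pi b u = 0.
    move=> ab; apply: contraTeq ab => bu; apply: amax; rewrite mem_filter bu.
    by apply: contraNT bu => bA; rewrite (jg_out J).
  have aF : pi a u \in F U.
    apply/HF => b; have [<-|ba] := eqVneq a b; first by rewrite jg_idem; exists u.
    by rewrite (jg_orth J) 1?eq_sym //; apply: leading0.
  case/eqP: au; have := congr1 (pi a) ru0; rewrite rE linear_sum linear0 (bigD1_seq a) ?(jg_uniq J) //=.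
  rewrite big1 ?addr0 => [|b ba]; last first.
    by have /memv_imgP[v _ ->] := memv_proj (pi b @: F U)%VS (pi b u); rewrite (jg_orth J) 1?eq_sym.
  by rewrite projv_id ?jg_idem //; rewrite -jg_idem; apply: memv_img.
- move=> U V UV v w /HF vU /HF wV; rewrite jg_killing_sum big1 // => a _.
  have [x [xU <- x0]] := vU a; have [y [yV <- y0]] := wV (- a).
  have := UV x y xU yV; rewrite jg_killing_sum.
  have [aA|aA] := boolP (a \in A); last by rewrite (jg_out J x aA) killing0l.
  rewrite (bigD1_seq a) ?(jg_uniq J) //= big1 ?addr0 // => a' ne.
  have [|->|] := single _ _ _ _ x0 y0 a' ne 0; rewrite ?killing0l //.
    by rewrite subrr lexlt_irr.
  by rewrite sub0r => ->; rewrite linear0.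
Qed.

End SemisimpleLimit.

(** ** The limit under a unipotent one-parameter group *)

Section UnipotentLimit.

Variables (K : numFieldType) (L : lieAlgebraType K) (N : 'End(L)) (n : nat).
Hypotheses (Nn : forall v, iter n N v = 0) (dN : derivation N).
Implicit Types (x y v w : L) (U : {vspace L}) (s t : K).
Local Notation E := (expN N n).

(** [v] is the coefficient of [t ^ m] in a polynomial curve of degree at most [m]
    that lies in [exp (t N) U] for all [t]: it belongs to the limit of these
    subspaces when [t] goes to infinity. *)
Definition tip U v := exists (m : nat) (c : nat -> L),
  c m = v /\ forall t, E (- t) (curve c m.+1 t) \in U.

Lemma tipP U k v w : tip U v -> tip U w -> tip U (k *: v + w).
Proof.
move=> [m [c [<- cU]]] [m' [c' [<- c'U]]].
have [d dm dE] := curve_widen c m m'; have [d' d'm d'E] := curve_widen c' m' m.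
rewrite [(m + m')%N]addnC in d'm d'E.
exists (m' + m)%N, (fun i => k *: d i + d' i); split=> [|t]; first by rewrite dm d'm.
have -> : curve (fun i => k *: d i + d' i) (m' + m).+1 t =
    k *: curve d (m' + m).+1 t + curve d' (m' + m).+1 t.
  rewrite /curve scaler_sumr -big_split; apply: eq_bigr => i _ /=.
  by rewrite scalerDr !scalerA [k * _]mulrC.
have EZ a u : E (- t) (a *: u) = a *: E (- t) u by apply: linearZ.
by rewrite dE d'E linearP /= !EZ memvD // !memvZ.
Qed.

Lemma unipotent_limit_exists : exists F : {vspace L} -> {vspace L},
  forall U v, v \in F U <-> tip U v.
Proof.
suff /choice[F HF] : forall U : {vspace L}, exists F : {vspace L},
    forall v, v \in F <-> tip U v by exists F.
move=> U; apply: vspace_of_pred => [|k v w]; last exact: tipP.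
exists 0%N, (fun=> 0); split=> // t.
by rewrite /curve big_ord1 scaler0 linear0 mem0v.
Qed.

Lemma expN_commute (P : 'End(L)) t v : (forall u, P (N u) = N (P u)) ->
  E t (P v) = P (E t v).
Proof.
move=> PN; rewrite /expN /curve linear_sum; apply: eq_bigr => i _; rewrite linearZ /=.
congr (_ *: _); rewrite !dpowE linearZ; congr (_ *: _).
by elim: (i : nat) => //= j ->; rewrite PN.
Qed.

(** The coefficients of [exp (t N) c], for [c] a polynomial curve in a subspace
    of dimension [d], give injective linear maps from a space of dimension
    [d * M] to one of dimension [r * (M + n)], where [r] is the dimension of
    the limit; letting [M] grow gives [d <= r]. *)
Lemma unipotent_limit_dim (U W : {vspace L}) :
  (forall v, tip U v -> v \in W) -> (\dim U <= \dim W)%N.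
Proof.
move=> tipW; pose M := (n * \dim W).+1.
pose e (c : {ffun 'I_M -> subvs_of U}) (j : nat) : L :=
  if (j < M)%N then vsval (c (inord j)) else 0.
pose c' c l := \sum_(i < l.+1) dpow N i (e c (l - i)%N).
pose f (c : {ffun 'I_M -> subvs_of U}) : {ffun 'I_(n + M) -> subvs_of W} :=
  [ffun l => vsproj W (c' c (l : 'I_(n + M)))].
have elin j : linear (e^~ j).
  move=> a u v; rewrite /e; case: ifP => _; last by rewrite scaler0 addr0.
  by rewrite !ffunE linearP.
have flin : linear f.
  move=> a u v; apply/ffunP => l; rewrite !ffunE -linearP; congr (vsproj W _).
  rewrite /c' scaler_sumr -big_split; apply: eq_bigr => i _ /=.
  by rewrite elin linearP.
pose fM := GRing.isLinear.Build _ _ _ _ f flin.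
pose fL : {linear {ffun 'I_M -> subvs_of U} -> {ffun 'I_(n + M) -> subvs_of W}} := HB.pack f fM.
have expE c t : E t (curve (e c) M t) = curve (c' c) (n + M) t.
  rewrite /curve /c'; under [RHS]eq_bigr do rewrite scaler_sumr.
  transitivity (\sum_(i < n) \sum_(j < M) t ^+ (i + j) *: dpow N i (e c j)).
    rewrite /expN /curve; apply: eq_bigr => i _; rewrite linear_sum scaler_sumr.
    by apply: eq_bigr => j _; rewrite /= dpowZ exprD -scalerA.
  rewrite (triangle_sum (F := fun i j => t ^+ (i + j) *: dpow N i (e c j))).
    by apply: eq_bigr => l _; apply: eq_bigr => i _; rewrite subnKC // -ltnS.
  move=> i j /orP[ni|Mj]; first by rewrite (dpow_nilp Nn) // scaler0.
  by rewrite /e ltnNge Mj linear0 scaler0.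
have inj c : f c = 0 -> c = 0.
  move=> fc0; have c'0 l : (l < n + M)%N -> c' c l = 0.
    move=> ltl; apply: contrapT => /eqP cl.
    pose P l := (l < n + M)%N && (c' c l != 0).
    have exP : exists l, P l by exists l; rewrite /P ltl.
    have ubP i : P i -> (i <= n + M)%N by move=> /andP[/ltnW].
    case: (ex_maxnP exP ubP) => m /andP[ltm cm] mmax.
    have : c' c m \in W.
      apply: tipW; exists m, (c' c); split=> // t.
      have -> : curve (c' c) m.+1 t = E t (curve (e c) M t).
        rewrite expE /curve (big_ord_widen (n + M) (fun i => t ^+ i *: c' c i)) //.
        rewrite big_mkcond; apply: eq_bigr => i _; case: ifP => // /negbT; rewrite -leqNgt => mi.
        have -> : c' c i = 0; last by rewrite scaler0.
        apply: contrapT => /eqP ci; have := mmax i; rewrite /P ltn_ord ci => /(_ isT).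
        by rewrite leqNgt mi.
      rewrite expNK //; apply: memv_suml => i _; apply: memvZ.
      by rewrite /e ltn_ord subvsP.
    have := congr1 (fun g : {ffun _ -> _} => vsval (g (Ordinal ltm))) fc0.
    by rewrite !ffunE /= => E0 cW; case/eqP: cm; rewrite -(vsprojK cW) E0.
  have e0 j : (j < M)%N -> e c j = 0.
    move=> jM; apply/eqP; rewrite -memv0; apply: (curve_mem (M := M)) jM => t.
    rewrite -[curve _ _ _](expNK Nn t) expE memv0 -(linear0 (E (- t))); apply/eqP; congr (E _ _).
    by rewrite /curve big1 // => i _; rewrite c'0 ?scaler0.
  apply/ffunP => j; apply: val_inj; rewrite !ffunE /=; have := e0 j (ltn_ord j).
  by rewrite /e ltn_ord inord_val.
have := @leq_dim_inj _ _ _ (linfun fL) fullv fullv (fun u _ => memvf _).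
have -> : \dim {:{ffun 'I_M -> subvs_of U}} = (M * \dim U)%N.
  by rewrite dimvf /= -[X in (X * _)%N](card_ord M).
have -> : \dim {:{ffun 'I_(n + M) -> subvs_of W}} = ((n + M) * \dim W)%N.
  by rewrite dimvf /= -[X in (X * _)%N](card_ord (n + M)).
have inj' u : u \in fullv -> linfun fL u = 0 -> u = 0 by rewrite lfunE => _; apply: inj.
move=> /(_ inj'); rewrite /M; move: (\dim U) (\dim W) => d r; nia.
Qed.

(** The limit is stable under [N] because translating the parameter of a curve
    shows that it is stable under every [exp (s N)]. *)
Lemma unipotent_limit : exists F : {vspace L} -> {vspace L},
  [/\ degeneration F,
      forall (P : 'End(L)) U, (forall u, P (N u) = N (P u)) ->
        (forall u, u \in U -> P u \in U) -> forall u, u \in F U -> P u \in F U,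
      forall U u, u \in F U -> N u \in F U &
      forall U, (forall u, u \in U -> N u \in U) -> (U <= F U)%VS].
Proof.
have [F HF] := unipotent_limit_exists; exists F; split.
- split.
  + move=> U V /subvP UV; apply/subvP => v /HF[m [c [<- cU]]]; apply/HF.
    by exists m, c; split=> // t; apply: UV.
  + move=> U V W UVW v w /HF[m [c [<- cU]]] /HF[m' [c' [<- c'V]]]; apply/HF.
    have [d <- dE] := curve_bilinear (@bracket_linearl K L) (@bracket_linearr K L) c c' m m'.
    by exists (m + m')%N, d; split=> // t; rewrite dE expN_bracket // UVW.
  + by move=> U; apply: unipotent_limit_dim => v /HF.
  + move=> U V UV v w /HF[m [c [<- cU]]] /HF[m' [c' [<- c'V]]].
    have [d <- dE] := @curve_bilinear K L L K^o (@killing K L) (@killing_linearl K L)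
      (fun x => @linearP _ _ _ _ (killing x)) c c' m m'.
    suff : d (m + m')%N \in (0%VS : {vspace K^o}) by rewrite memv0 => /eqP.
    apply: (curve_mem (M := (m + m').+1)) => // t.
    rewrite memv0 dE -(killing_automorphism _ _ (expN_automorphism Nn dN (- t))) !lfunE /=.
    by rewrite UV.
- move=> P U PN PU u /HF[m [c [<- cU]]]; apply/HF; exists m, (P \o c); split=> // t.
  have -> : curve (P \o c) m.+1 t = P (curve c m.+1 t).
    by rewrite /curve linear_sum; apply: eq_bigr => i _; rewrite linearZ.
  by rewrite expN_commute // PU.
- move=> U u uF; have Eu s : E s u \in F U.
    move: uF => /HF[m [c [<- cU]]]; apply/HF.
    have [d dm dE] := curve_shift c m (- s); exists m, (fun i => E s (d i)); split.
      by rewrite dm.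
    move=> t; have -> : curve (fun i => E s (d i)) m.+1 t = E s (curve d m.+1 t).
      by rewrite /curve linear_sum; apply: eq_bigr => i _; rewrite linearZ.
    by rewrite dE -expND // [- t + s]addrC -[s - t]opprB cU.
  case: (ltnP 1 n) => [n1|].
    have -> : N u = dpow N 1 u by rewrite dpowE invr1 scale1r.
    exact: (curve_mem (M := n)) Eu _ n1.
  by case: (n) Nn => [|[]] // H _; [rewrite -[u]/(iter 0 N u) H linear0 mem0v | rewrite -[N u]/(iter 1 N u) H mem0v].
- move=> U NU; apply/subvP => u uU; apply/HF; exists 0%N, (fun=> u); split=> // t.
  rewrite /curve big_ord1 scale1r; apply: memv_suml => i _; rewrite memvZ // dpowE memvZ //.
  by elim: (i : nat) => //= j; apply: NU.
Qed.

End UnipotentLimit.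

(** ** A fixed point theorem for solvable subalgebras *)

(** Apply the lower bound on dimensions to [A] and to its orthogonal, whose
    limits are still orthogonal. *)
Lemma degeneration_dimE (K : fieldType) (L : lieAlgebraType K) (F : {vspace L} -> {vspace L}) :
  nondegenerate L -> degeneration F -> forall A, \dim (F A) = \dim A.
Proof.
move=> nd dF A; have [W [WP dW]] := killing_perp A.
have AW x y : x \in F A -> y \in F W -> killing x y = 0.
  by apply: (dg_killing dF) => u v uA /WP; apply.
have := dim_killing_perp nd AW; have := dg_dim dF A; have := dg_dim dF W; lia.
Qed.


Lemma solvable_hyperplane (K : fieldType) (L : lieAlgebraType K) (s : {vspace L}) :
  lie_subalgebra s -> lie_solvable s -> s != 0%VS ->
  exists (a : {vspace L}) (y : L),
    [/\ (a + <[y]> = s)%VS, (\dim a < \dim s)%N & bracket_sub s s a].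
Proof.
move=> subs [n sn] s0; have ds : (lie_derived s <= s)%VS by apply/lie_derivedP.
have /subvPn[y ys yd] : ~~ (s <= lie_derived s)%VS.
  apply: contra s0 => sd; have E : lie_derived s = s by apply/eqP; rewrite eqEsubv ds.
  by rewrite -sn; elim: (n) => //= m /eqP <-; rewrite E.
pose W := (lie_derived s + <[y]>)%VS; pose a := (lie_derived s + (s :\: W))%VS.
have Ws : (W <= s)%VS by rewrite subv_add ds -memvE.
have ay : (a + <[y]> = s)%VS.
  rewrite /a -addvA [(_ + <[y]>)%VS]addvC addvA -/W addvC addv_diff.
  exact/addv_idPl.
exists a, y; split=> //; last by apply/lie_derivedP; apply: addvSl.
rewrite ltn_neqAle dimvS ?andbT; last by rewrite -ay addvSl.
apply/negP => /eqP da; have as_ : a = s by apply/eqP; rewrite eqEdim da leqnn -ay addvSl.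
move: ys; rewrite -as_ => /memv_addP[d dd [c cW yE]].
case/negP: yd; suff -> : y = d by [].
suff c0 : c = 0 by rewrite yE c0 addr0.
apply/eqP; rewrite -memv0 -(capv_diff s W) memv_cap cW /=.
by rewrite -[c](addKr d) -yE memv_add ?memvN ?memv_line.
Qed.

(** A solvable Lie algebra has a chain of ideals with one-dimensional
    quotients. Degenerating along the semisimple and then along the unipotent
    part of one more element at each step keeps what was already stable. *)
Lemma solvable_degeneration (K : numClosedFieldType) (L : lieAlgebraType K) (s : {vspace L}) :
  lie_subalgebra s -> lie_solvable s ->
  exists2 F : {vspace L} -> {vspace L}, degeneration F &
    forall U, bracket_sub s (F U) (F U).
Proof.
elim: {s}_.+1 {-2}s (ltnSn (\dim s)) => // d IHd s ltsd subs sols.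
have [->|s0] := eqVneq s 0%VS.
  exists id; first exact: degeneration_id.
  by move=> U x y; rewrite memv0 => /eqP -> _; rewrite bracket0l mem0v.
have [a [y [ay dima sa]]] := solvable_hyperplane subs sols s0.
have as_ : (a <= s)%VS by rewrite -ay addvSl.
have ys : y \in s by rewrite -ay memvE addvSr.
have suba : lie_subalgebra a.
  by move=> u v ua va; apply: sa; apply: (subvP as_).
have [F0 dF0 F0a] := IHd a (leq_trans dima ltsd) suba (lie_solvableS as_ sols).
have [A [pi [N J]]] := derivation_jordan (ad_derivation y).
have Da u : u \in a -> ad y u \in a.
  by move=> ua; rewrite adE sa // (subvP as_).
have [F1 [dF1 F1pi F1s]] := semisimple_limit J; have [n Nn] := jg_nilp J.
have [F2 [dF2 F2P F2N F2s]] := unipotent_limit Nn (jg_der J).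
exists (F2 \o (F1 \o F0)); first by apply: degeneration_comp => //; apply: degeneration_comp.
move=> U /=; rewrite -ay; apply: bracket_subDl.
  have := dg_bracket dF2 (dg_bracket dF1 (F0a U)); apply: bracket_subS => //.
  apply: subv_trans (dgS dF2 (F1s a Da)); apply: F2s; exact: (jg_N_stable J).
move=> _ u /vlineP[k ->] uF; rewrite bracketZl memvZ // -adE (jg_decomp J).
rewrite memvD ?F2N // memv_suml // => b _; apply: memvZ.
by apply: F2P uF => [v|]; [apply: (jg_comm J) | move=> v; apply: F1pi].
Qed.

(** Lie's theorem, in the form of a full flag for the adjoint action. *)
Lemma killing_solvable (K : numClosedFieldType) (L : lieAlgebraType K) (s : {vspace L}) x y n :
  nondegenerate L -> lie_subalgebra s -> lie_solvable s -> x \in s -> y \in s ->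
  (forall v, iter n (ad y) v = 0) -> killing x y = 0.
Proof.
move=> nd subs sols xs ys yn; have [F dF Fs] := solvable_degeneration subs sols.
pose G i := F <<take i (vbasis {:L})>>%VS.
apply: (@lftrace_flag _ _ G _ _ n) => //.
- move=> i li; rewrite /G (degeneration_dimE nd dF).
  have fr : free (take i (vbasis {:L})).
    by apply: (catl_free (Y := drop i (vbasis {:L}))); rewrite cat_take_drop (basis_free (vbasisP _)).
  by have /eqP -> := fr; rewrite size_takel ?size_tuple.
- move=> i; apply: (dgS dF); apply: sub_span => v.
  by rewrite -(take_takel _ (leqnSn i)) => /mem_take.
- by move=> i v vG; rewrite adE; apply: Fs.
- by move=> i v vG; rewrite adE; apply: Fs.
Qed.

(** The degeneration of a solvable subalgebra is again solvable; once it is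
    stable under a Borel subalgebra, their sum is solvable. *)
Lemma borel_dim_leq (K : numClosedFieldType) (L : lieAlgebraType K) (b c : {vspace L}) :
  nondegenerate L -> borel_subalgebra b -> lie_subalgebra c -> lie_solvable c ->
  (\dim c <= \dim b)%N.
Proof.
move=> nd [subb solb maxb] subc [m cm]; have [F dF Fb] := solvable_degeneration subb solb.
have Fder n : (iter n (@lie_derived _ _) (F c) <= F (iter n (@lie_derived _ _) c))%VS.
  elim: n => //= n IHn; apply: subv_trans (lie_derivedS IHn) _.
  apply/lie_derivedP/(dg_bracket dF)/lie_derivedP; exact: subvv.
have solFc : lie_solvable (F c).
  exists m; apply/eqP; rewrite -subv0; apply: subv_trans (Fder m) _.
  by rewrite cm subv0 -dimv_eq0 (degeneration_dimE nd dF) dimv0.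
have subFc : lie_subalgebra (F c) by apply: (dg_bracket dF) subc.
have subS : bracket_sub (b + F c)%VS (F c) (F c) by apply: bracket_subDl.
have subbF : lie_subalgebra (b + F c)%VS.
  apply: bracket_subDr; last by apply: bracket_subS subS => //; apply: addvSr.
  apply: bracket_subDl; first by apply: bracket_subS subb => //; apply: addvSl.
  by apply: bracket_sub_sym; apply: bracket_subS (Fb c) => //; apply: addvSr.
have derS n : (iter n (@lie_derived _ _) (b + F c) <= iter n (@lie_derived _ _) b + F c)%VS.
  elim: n => //= n IHn; apply: subv_trans (lie_derivedS IHn) _; apply/lie_derivedP.
  have bn : (iter n (@lie_derived _ _) b <= b)%VS.
    by elim: (n) => //= k IHk; apply: subv_trans (lie_derivedS IHk) _; apply/lie_derivedP.
  apply: bracket_subDr; last first.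
    by apply: bracket_subS subS; rewrite ?addvSr // addvS.
  set B := iter n _ b in bn *; have BB : bracket_sub B B (lie_derived B) by apply/lie_derivedP.
  apply: bracket_subDl; first by apply: bracket_subS BB => //; apply: addvSl.
  by apply: bracket_sub_sym; apply: bracket_subS (Fb c); rewrite ?addvSr.
have solbF : lie_solvable (b + F c)%VS.
  have [n bn] := solb; have := derS n; rewrite bn add0v => /lie_solvableS-/(_ solFc)[k Hk].
  by exists (k + n)%N; rewrite iterD.
rewrite -(degeneration_dimE nd dF c) dimvS //.
by rewrite -(maxb _ subbF solbF) ?addvSl ?addvSr.
Qed.

(** * The root system of type E7 *)

(** Vectors of the root lattice are lists of seven coordinates in the basis of
    simple roots, so that statements about the root system can be computed. *)
Notation vec := (seq int).

Definition vadd (u v : vec) : vec := mkseq (fun k => u`_k + v`_k) 7%N.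
Definition vneg (u : vec) : vec := mkseq (fun k => - u`_k) 7%N.
Definition simple_vec (i : nat) : vec := mkseq (fun k => if k == i then 1 else 0) 7%N.
Definition cartan_entry (i j : nat) : int :=
  if i == j then 2 else if ((i, j) \in E7_edges) || ((j, i) \in E7_edges) then -1 else 0.
(* the pairing of [v] with the simple coroot of index [i] *)
Definition coroot (i : nat) (v : vec) : int :=
  foldr (fun j s => v`_j * cartan_entry j i + s) 0 (iota 0%N 7%N).
Definition reflection (i : nat) (v : vec) : vec :=
  mkseq (fun k => if k == i then v`_k - coroot i v else v`_k) 7%N.
Arguments vadd : simpl never.
Arguments vneg : simpl never.
Arguments simple_vec : simpl never.
Arguments reflection : simpl never.
Definition height (v : vec) : int := foldr (fun j s => v`_j + s) 0 (iota 0%N 7%N).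

(* the roots of height one more than those of [l], which in a simply laced root
   system are obtained by reflections *)
Definition next_level (l : seq vec) : seq vec :=
  undup [seq reflection p.2 p.1 | p <- [seq (v, i) | v <- l, i <- iota 0%N 7%N] & coroot p.2 p.1 < 0].

(* the highest root has height 17 *)
Definition posroots : seq vec := Eval vm_compute in
  flatten (traject next_level [seq simple_vec i | i <- iota 0%N 7%N] 17%N).
Definition roots : seq vec := Eval vm_compute in posroots ++ map vneg posroots.

Lemma rootsE : roots = posroots ++ map vneg posroots. Proof. by vm_compute. Qed.

Lemma size_posroots : size posroots = 63%N. Proof. by vm_compute. Qed.

Lemma roots_size7 : all (fun v => size v == 7%N) roots. Proof. by vm_compute. Qed.

Lemma roots_uniq : uniq roots. Proof. by vm_compute. Qed.

Lemma simple_root : all (fun i => simple_vec i \in posroots) (iota 0%N 7%N).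
Proof. by vm_compute. Qed.

Lemma roots_reflection : all (fun v => all (fun i => reflection i v \in roots) (iota 0%N 7%N)) roots.
Proof. by vm_compute. Qed.

(* every root is simple or a reflection of a root listed before it *)
Lemma roots_generated :
  all (fun v => (v \in [seq simple_vec i | i <- iota 0%N 7%N]) ||
      has (fun i => reflection i v \in take (index v roots) roots) (iota 0%N 7%N)) roots.
Proof. by vm_compute. Qed.

Lemma reflectionK_roots :
  all (fun v => all (fun i => reflection i (reflection i v) == v) (iota 0%N 7%N)) roots.
Proof. by vm_compute. Qed.

Lemma reflection_posroots : all (fun i => perm_eq (map (reflection i) posroots)
  (vneg (simple_vec i) :: rem (simple_vec i) posroots)) (iota 0%N 7%N).
Proof. by vm_compute. Qed.

(* every positive root is simple or the sum of a simple root and a root listed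
   before it *)
Lemma posroots_generated :
  all (fun v => (v \in [seq simple_vec i | i <- iota 0%N 7%N]) ||
      has (fun i => has (fun u => vadd (simple_vec i) u == v) (take (index v posroots) posroots))
        (iota 0%N 7%N)) posroots.
Proof. by vm_compute. Qed.

(* the values at the simple roots of a functional separating the roots and zero;
   found by search *)
Definition regular_coweight : vec := [:: 12; 10; 6; 13; 3; 14; 7].
Definition weight_value (v : vec) : int := foldr (fun j s => v`_j * regular_coweight`_j + s) 0 (iota 0%N 7%N).

Lemma weight_value_uniq : uniq (map weight_value (nseq 7%N 0 :: roots)).
Proof. by vm_compute. Qed.

(* in a simply laced root system a root string not through zero has length at most two *)
Lemma root_strings : all (fun u => all (fun v => (u == v) || (u == vneg v) ||
   [&& vadd u (vadd u v) \notin roots, vadd u (vadd u v) != nseq 7%N 0 &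
     (vadd u v \notin roots) || (vadd (vneg u) v \notin roots)]) roots) roots.
Proof. vm_cast_no_check (erefl true). Qed.

Lemma roots_double : all (fun u => vadd u u \notin roots) roots.
Proof. by vm_compute. Qed.

Lemma posroots_height : all (fun u => (0 < height u) && (height u < 18)) posroots.
Proof. by vm_compute. Qed.

(* so that simplification and unification leave these lists alone *)
Opaque posroots roots.

(** * Positive systems *)

Lemma vecP (u v : vec) : size u = 7%N -> size v = 7%N ->
  (forall k, (k < 7)%N -> u`_k = v`_k) -> u = v.
Proof. by move=> su sv uv; apply: (@eq_from_nth _ 0) => [|k]; rewrite su ?sv //; apply: uv. Qed.

Lemma size_root v : v \in roots -> size v = 7%N.
Proof. by move=> vr; apply/eqP; apply: (allP roots_size7). Qed.

Lemma posroot_root v : v \in posroots -> v \in roots.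
Proof. by move=> vp; rewrite rootsE mem_cat vp. Qed.

Lemma posroots_uniq : uniq posroots.
Proof. by have := roots_uniq; rewrite rootsE cat_uniq => /and3P[]. Qed.

Lemma vnegK v : size v = 7%N -> vneg (vneg v) = v.
Proof.
by move=> sv; apply: vecP => [|//|k k7]; rewrite ?size_mkseq // !nth_mkseq // opprK.
Qed.

Lemma vneg_root v : (v \in roots) -> (vneg v \in roots).
Proof.
rewrite {1}rootsE mem_cat => /orP[vp|/mapP[u up ->]].
  by rewrite rootsE mem_cat map_f ?orbT.
by rewrite vnegK ?size_root ?posroot_root.
Qed.

Lemma reflection_root i v : (i < 7)%N -> v \in roots -> reflection i v \in roots.
Proof.
move=> i7 vr; apply: (allP (allP roots_reflection _ vr)).
by rewrite mem_iota.
Qed.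

Lemma reflectionK i v : (i < 7)%N -> v \in roots -> reflection i (reflection i v) = v.
Proof.
move=> i7 vr; apply/eqP; apply: (allP (allP reflectionK_roots _ vr)).
by rewrite mem_iota.
Qed.

Lemma corootD i u v : coroot i (vadd u v) = coroot i u + coroot i v.
Proof. by rewrite /coroot /vadd /vneg /=; ring. Qed.

Lemma corootN i v : coroot i (vneg v) = - coroot i v.
Proof. by rewrite /coroot /vadd /vneg /=; ring. Qed.

Lemma reflectionD i u v : reflection i (vadd u v) = vadd (reflection i u) (reflection i v).
Proof.
apply: vecP => [||k k7]; rewrite ?size_mkseq // !nth_mkseq // corootD.
by case: eqP => _ //; ring.
Qed.

Lemma reflectionN i v : reflection i (vneg v) = vneg (reflection i v).
Proof.
apply: vecP => [||k k7]; rewrite ?size_mkseq // !nth_mkseq // corootN.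
by case: eqP => _ //; ring.
Qed.

Section PositiveSystems.

Definition positive_system (P : pred vec) :=
  (forall u v, u \in roots -> v \in roots -> P u -> P v -> vadd u v \in roots -> P (vadd u v)) /\
  {in posroots, forall v, P (vneg v) = ~~ P v}.

(** [P] holds for at most one root of each pair of opposite roots, and for at least
    63 of the 126 roots. *)
Lemma positive_system_of_count (P : pred vec) :
  (forall u v, u \in roots -> v \in roots -> P u -> P v -> vadd u v \in roots -> P (vadd u v)) ->
  (forall v, v \in roots -> P v -> ~~ P (vneg v)) -> (63 <= count P roots)%N ->
  positive_system P.
Proof.
move=> clP disP; rewrite rootsE count_cat count_map => cP; split=> //.
have E : all (fun v => P v || P (vneg v)) posroots.
  rewrite all_count size_posroots eqn_leq -{1}size_posroots count_size /=.
  apply: leq_trans cP _; rewrite -count_predUI addnC.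
  rewrite [X in (X + _)%N](_ : _ = 0%N) ?add0n //; apply/eqP; rewrite eqn0Ngt -has_count.
  apply/hasPn => v vp /=; apply/negP => /andP[Pv].
  by apply/negP; apply: disP => //; apply: posroot_root.
move=> v vp; have vr := posroot_root vp; case/orP: (allP E v vp) => Pv.
  by rewrite Pv; apply/negbTE/disP.
by rewrite Pv; apply/esym/negP => Pv'; have := disP v vr Pv'; rewrite Pv.
Qed.

(** The Weyl group is transitive on the positive systems: as long as a positive
    system contains a negative root it contains the opposite of a simple root,
    and reflecting in that root lowers the number of its negative roots. *)
Lemma positive_system_weyl (P : pred vec) : positive_system P ->
  exists w w' : vec -> vec,
  [/\ {in roots, forall v, w v \in roots /\ w' v \in roots},
      {in roots, cancel w w'}, {in roots, cancel w' w},
      forall u v, w (vadd u v) = vadd (w u) (w v) /\ w' (vadd u v) = vadd (w' u) (w' v) &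
      {in roots, forall v, P (w v) = (v \in posroots)}].
Proof.
have [n] := ubnP (count (P \o vneg) posroots); elim: n P => // n IHn P ltn [clP disP].
case: (boolP (has (P \o vneg) posroots)) => [cnt|/hasPn noneg]; last first.
  exists id, id; split=> // v vr; move: (vr); rewrite rootsE mem_cat => /orP[vp|/mapP[u up ->]].
    by rewrite vp; have := noneg v vp; rewrite /= disP // negbK.
  have /= /negPf -> := noneg u up; apply/esym/negbTE/negP => vup.
  have := roots_uniq; rewrite rootsE cat_uniq => /and3P[_ /hasPn H _].
  by have := H (vneg u) (map_f _ up); rewrite vup.
have [i i7 Pi] : exists2 i, (i < 7)%N & ~~ P (simple_vec i).
  apply: contrapT => H; have simp i : (i < 7)%N -> P (simple_vec i).
    by move=> i7; apply: contrapT => /negP Pi; apply: H; exists i.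
  have simp' v : v \in [seq simple_vec i | i <- iota 0%N 7%N] -> P v.
    by move=> /mapP[k]; rewrite mem_iota => k7 ->; apply: simp.
  have pos j v : v \in take j posroots -> P v.
    elim: j v => [|j IHj] v; first by rewrite take0.
    case: (ltnP j (size posroots)) => ltj; last by rewrite !take_oversize // in IHj *; [exact: IHj|exact: leqW].
    rewrite (take_nth [::] ltj) mem_rcons inE => /predU1P[->|]; last exact: IHj.
    have := allP posroots_generated _ (mem_nth [::] ltj).
    rewrite index_uniq ?posroots_uniq //.
    move=> /orP[/simp' //|/hasP[k]]; rewrite mem_iota => k7 /hasP[u uj /eqP E].
    have kp : simple_vec k \in roots.
      by apply/posroot_root/(allP simple_root); rewrite mem_iota.
    rewrite -E; apply: clP; rewrite ?simp ?IHj //.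
      by apply: posroot_root; apply: mem_take uj.
    by rewrite E; apply/posroot_root/mem_nth.
  move: cnt => /hasP[v vp /=]; rewrite disP // => /negP; apply.
  by apply: (pos (size posroots)); rewrite take_size.
have i7' : i \in iota 0%N 7%N by rewrite mem_iota.
have ip := allP simple_root i i7'; have perm := allP reflection_posroots i i7'.
pose P' v := P (reflection i v).
have posP' : positive_system P'.
  split=> [u v ur vr Pu Pv uvr|v vp].
    by rewrite /P' reflectionD clP // -?reflectionD ?reflection_root.
  rewrite /P' reflectionN; have : reflection i v \in map (reflection i) posroots by apply: map_f.
  rewrite (perm_mem perm) inE => /predU1P[->|/mem_rem/disP //].
  by rewrite vnegK ?size_mkseq // disP // negbK.
have ltn' : (count (P' \o vneg) posroots < n)%N.
  have -> : count (P' \o vneg) posroots = count (P \o vneg) (map (reflection i) posroots).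
    rewrite count_map; apply: eq_count => v /=.
    by rewrite /P' reflectionN.
  rewrite (permP perm) /= vnegK ?size_mkseq // (negPf Pi) add0n.
  have := permP (perm_to_rem ip) (P \o vneg); rewrite /= disP // Pi add1n => E.
  by move: ltn; rewrite E ltnS.
have [w [w' [wr wK w'K wD wP]]] := IHn P' ltn' posP'.
have rr v : v \in roots -> reflection i v \in roots by apply: reflection_root.
exists (reflection i \o w), (w' \o reflection i); split=> [v vr|v vr|v vr|u v|v vr] /=.
- by split; [apply/rr/(wr v vr).1 | apply: (wr _ (rr v vr)).2].
- by rewrite reflectionK ?wK // (wr v vr).1.
- by rewrite w'K ?rr // reflectionK.
- by rewrite !reflectionD (wD _ _).1 (wD _ _).2 reflectionD.
- exact: wP.
Qed.

End PositiveSystems.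

(** * Abelian ideals of the poset of positive roots *)

Definition sums_above (u : vec) : seq vec :=
  [seq w <- [seq vadd u v | v <- posroots] | w \in posroots].
Definition partners (u : vec) : seq vec :=
  [seq v <- posroots | vadd u v \in posroots].

(** The combinatorial form of an abelian ideal of the standard Borel subalgebra. *)
Definition abelian_set (P : pred vec) :=
  (forall u v, u \in posroots -> P u -> v \in posroots -> vadd u v \in posroots -> P (vadd u v)) /\
  (forall u v, u \in posroots -> v \in posroots -> P u -> P v -> vadd u v \notin posroots).

(* Decide the roots from the highest down: [acc] collects the roots taken and
   [exc] those left out. *)
Fixpoint enum_abelian (l : seq (vec * (seq vec * seq vec))) (acc exc : seq vec) : seq (seq vec) :=
  if l is (u, (up, cf)) :: l' then
    (if all (fun v => v \notin exc) up && all (fun v => v \notin acc) cf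
     then enum_abelian l' (u :: acc) exc else [::]) ++ enum_abelian l' acc (u :: exc)
  else [:: acc].

Definition computed_abelian_sets : seq (seq vec) :=
  enum_abelian [seq (u, (sums_above u, partners u)) | u <- rev posroots] [::] [::].

(* sealed, so that it is computed only where asked for *)
Fact abelian_sets_key : unit. Proof. exact: tt. Qed.
Definition abelian_sets := locked_with abelian_sets_key computed_abelian_sets.

Lemma abelian_setsE : abelian_sets = computed_abelian_sets.
Proof. exact: unlock. Qed.

(** The tests made when taking a root hold for every abelian set, so the branch
    following its choices is never cut. *)
Lemma enum_abelian_complete (P : pred vec) l acc exc : abelian_set P ->
  {subset l <= posroots} -> all P acc -> {subset acc <= posroots} -> all (predC P) exc ->
  catrev (filter P l) acc \in enum_abelian [seq (u, (sums_above u, partners u)) | u <- l] acc exc.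
Proof.
move=> [idP abP]; elim: l acc exc => [|u l IHl] acc exc sub accP accpos excP /=.
  by rewrite inE.
have up : u \in posroots by apply: sub; rewrite mem_head.
have sub' : {subset l <= posroots} by move=> v vl; apply: sub; rewrite inE vl orbT.
case: ifPn => Pu; rewrite mem_cat; last by rewrite IHl ?orbT //= Pu.
suff -> : all (fun v => v \notin exc) (sums_above u) && all (fun v => v \notin acc) (partners u).
  rewrite IHl //= ?Pu // => v; rewrite inE => /predU1P[-> //|]; exact: accpos.
apply/andP; split; apply/allP => v; rewrite mem_filter => /andP[].
  move=> vp /mapP[w wp E]; apply/negP => /(allP excP) /=; rewrite E idP // -E //.
move=> vp vpos; apply/negP => vacc; have := abP u v up vpos Pu (allP accP v vacc).
by rewrite vp.
Qed.

Lemma abelian_sets_complete (P : pred vec) : abelian_set P -> filter P posroots \in abelian_sets.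
Proof.
move=> abP; have -> : filter P posroots = catrev (filter P (rev posroots)) [::].
  by rewrite -[RHS]/(rev _) filter_rev revK.
have sub : {subset rev posroots <= posroots} by move=> v; rewrite mem_rev.
rewrite abelian_setsE; exact: (enum_abelian_complete (acc := [::]) (exc := [::]) abP sub isT (fun v (vn : v \in [::]) => False_ind _ (notF vn)) isT).
Qed.

Lemma abelian_sets_sound :
  let table := [seq (u, (sums_above u, partners u)) | u <- posroots] in
  all (fun l => subseq l posroots && all (fun t => (t.1 \in l) ==>
      all (fun v => v \in l) t.2.1 && all (fun v => v \notin l) t.2.2) table)
    computed_abelian_sets.
Proof. vm_cast_no_check (erefl true). Qed.

Lemma abelian_setsP l : l \in abelian_sets -> subseq l posroots /\ abelian_set (mem l).
Proof.
rewrite abelian_setsE => /(allP abelian_sets_sound)/andP[sub /allP H]; split=> //.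
have {}H u : u \in posroots -> u \in l ->
    all (fun v => v \in l) (sums_above u) /\ all (fun v => v \notin l) (partners u).
  move=> up ul; have /H := map_f (fun u => (u, (sums_above u, partners u))) up.
  by rewrite /= ul => /andP[].
split=> [u v up ul vp uvp|u v up vp ul vl].
  have [/allP su _] := H u up ul; apply: su.
  by rewrite mem_filter uvp map_f.
have [_ /allP pu] := H u up ul; apply: contraL vl => uvp; apply: pu.
by rewrite mem_filter uvp.
Qed.

Lemma abelian_sets_uniq : uniq abelian_sets.
Proof. by rewrite abelian_setsE; vm_cast_no_check (erefl true). Qed.

Lemma abelian_sets_sizes :
  [seq count (fun l => size l == m) abelian_sets | m <- iota 0%N 28%N] =
  [:: 1; 1; 1; 1; 1; 2; 2; 3; 3; 4; 5; 6; 7; 8]%N ++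
  [:: 10; 11; 13; 15; 11; 7; 5; 3; 3; 1; 1; 1; 1; 1]%N.
Proof. by rewrite abelian_setsE; vm_compute. Qed.

Lemma size_abelian_sets : size abelian_sets = 128%N.
Proof. by rewrite abelian_setsE; vm_compute. Qed.

Lemma computed_abelian_sets_small : all (fun l => (size l < 28)%N) computed_abelian_sets.
Proof. by vm_compute. Qed.

(** * The root space decomposition *)

Definition row_of_vec (v : vec) : 'rV[int]_7 := \row_(i < 7) v`_i.

Lemma row_of_simple (i : 'I_7) : row_of_vec (simple_vec i) = delta_mx 0 i.
Proof. by apply/rowP => j; rewrite !mxE nth_mkseq //= -val_eqE; case: eqP. Qed.

Lemma row_of_reflection (i : 'I_7) v :
  row_of_vec (reflection i v) =
  row_of_vec v - (row_of_vec v *m E7_cartan_matrix) 0 i *: delta_mx 0 i.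
Proof.
have -> : (row_of_vec v *m E7_cartan_matrix) 0 i = coroot i v.
  rewrite mxE !big_ord_recl big_ord0 /coroot /= !mxE.
  by rewrite /cartan_entry.
apply/rowP => j; rewrite !mxE nth_mkseq //= -val_eqE /=.
by case: eqP => _; rewrite ?mulr1 // mulr0 subr0.
Qed.

Lemma weyl_rootP (v : 'rV[int]_7) :
  weyl_root E7_cartan_matrix v <-> exists2 s, s \in roots & v = row_of_vec s.
Proof.
split=> [|[s sr ->]].
  elim=> [i|i _ _ [s sr ->]].
    exists (simple_vec i); rewrite ?row_of_simple //.
    by apply/posroot_root/(allP simple_root); rewrite mem_iota ltn_ord.
  by exists (reflection i s); rewrite ?row_of_reflection ?reflection_root.
have [n] := ubnP (index s roots); elim: n s sr => // n IHn s sr ltn.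
have := allP roots_generated s sr => /orP[/mapP[k]|/hasP[k]]; rewrite mem_iota => /andP[_ k7].
  by move=> ->; rewrite (row_of_simple (Ordinal k7)); apply: weyl_root_simple.
move=> Hi; have rr := mem_take Hi.
have lt : (index (reflection k s) roots < index s roots)%N by rewrite -in_take.
rewrite -(reflectionK k7 sr) (row_of_reflection (Ordinal k7)); apply: weyl_root_reflect.
by apply: IHn => //; apply: leq_trans lt _.
Qed.

Definition vzero : vec := nseq 7%N 0.

(** The root spaces [G u] and the values [wt u t] of the weights, for [u] in the
    root lattice, together with the element [z] of [h] at which the simple roots
    take the values of [regular_coweight]. For [u] the zero vector, [G u] is the
    Cartan subalgebra. *)
Record root_datum (K : numClosedFieldType) (g : lieAlgebraType K) (h : {vspace g})
    (G : vec -> {vspace g}) (wt : vec -> g -> K) (z : g) : Prop := RootDatum {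
  rd_mem : forall u x, x \in G u <-> (forall t, t \in h -> <|t, x|> = wt u t *: x);
  rd_zero : G vzero = h;
  rd_wtD : forall u v t, wt (vadd u v) t = wt u t + wt v t;
  rd_wtN : forall u t, wt (vneg u) t = - wt u t;
  rd_out : forall u, size u = 7%N -> u \notin roots -> u != vzero -> G u = 0%VS;
  rd_full : forall W, (forall u, u \in vzero :: roots -> (G u <= W)%VS) -> W = fullv;
  rd_zh : z \in h;
  rd_z : forall u, wt u z = (weight_value u)%:~R;
  rd_nz : forall u, u \in roots -> G u != 0%VS;
  rd_sep : forall t, t \in h -> (forall u, u \in roots -> wt u t = 0) -> t = 0;
  rd_dimh : \dim h = 7%N;
  rd_abelian : lie_abelian h
}.

(** In a basis of eigenvectors of [ad t], a generalised eigenvector only involves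
    the eigenvectors for its own eigenvalue. *)
Lemma diagonalizable_geneig (K : fieldType) (L : lieAlgebraType K) (t : L) a v :
  ad_diagonalizable t -> geneig (ad t) a v -> <|t, v|> = a *: v.
Proof.
move=> [X bX HX] [n]; have /choice[mu Hmu] : forall i, exists b, <|t, X`_i|> = b *: X`_i.
  move=> i; case: (ltnP i (size X)) => ltiX; first by apply/HX/mem_nth.
  by exists 0; rewrite nth_default // bracket0r scaler0.
rewrite (coord_basis bX (memvf v)); set k := coord X.
have pevX i : pev (ad t) (('X - a%:P) ^+ n) X`_i = (mu i - a) ^+ n *: X`_i.
  rewrite (@pev_eigen _ _ _ _ (mu i)); last by rewrite adE Hmu.
  by rewrite horner_exp hornerXsubC.
rewrite linear_sum /= => E.
have E' : \sum_i (k i v * (mu i - a) ^+ n) *: X`_i = 0.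
  by rewrite -[RHS]E; apply: eq_bigr => i _; rewrite linearZ /= pevX scalerA.
have /freeP-/(_ _ E') Hk := basis_free bX.
rewrite bracket_sumr scaler_sumr; apply: eq_bigr => i _.
rewrite bracketZr Hmu !scalerA; congr (_ *: _).
have /eqP := Hk i; rewrite mulf_eq0 => /orP[/eqP ->|]; first by rewrite mul0r mulr0.
rewrite expf_eq0 subr_eq0 => /andP[_ /eqP ->]; exact: mulrC.
Qed.

(** The projections onto the eigenspaces of one more element [t] preserve the
    eigenspaces of the elements commuting with it, so each joint eigenvector
    splits further. *)
Lemma joint_eigenvectors_span (K : closedFieldType) (L : lieAlgebraType K) (h : {vspace L}) :
  lie_abelian h -> (forall t, t \in h -> ad_diagonalizable t) ->
  forall W : {vspace L},
  (forall y, (forall t, t \in h -> exists a, <|t, y|> = a *: y) -> y \in W) -> W = fullv.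
Proof.
move=> abh diagh W WP; apply/eqP; rewrite eqEsubv subvf /=; apply/subvP => x _.
suff H (ts : seq L) : {subset ts <= h} ->
    (forall y, (forall t, t \in ts -> exists a, <|t, y|> = a *: y) -> y \in W) -> x \in W.
  apply: (H (vbasis h)) => [t /vbasis_mem // | y yP]; apply: WP => t th.
  have /choice[a Ha] : forall i : 'I_(\dim h), exists a, <|(vbasis h)`_i, y|> = a *: y.
    by move=> i; apply/yP/mem_nth; rewrite size_tuple.
  exists (\sum_i coord (vbasis h) i t * a i); rewrite {1}(coord_vbasis th) bracket_suml scaler_suml.
  by apply: eq_bigr => i _; rewrite bracketZl Ha scalerA.
elim: ts => [|t ts IHts] sub HW; first by apply: HW.
have th : t \in h by apply: sub; rewrite mem_head.
apply: IHts => [s sts|y yts]; first by apply: sub; rewrite inE sts orbT.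
have [A [pi [N J]]] := derivation_jordan (ad_derivation t).
rewrite -(jg_sum J y); apply: memv_suml => a _; apply: HW => s; rewrite inE => /predU1P[->|sts].
  by exists a; apply: diagonalizable_geneig (diagh t th) (jg_pi J a y).
have [b Hb] := yts s sts; exists b.
have sh : s \in h by apply: sub; rewrite inE sts orbT.
have EU : exists U : {vspace L}, forall v, v \in U <-> <|s, v|> = b *: v.
  apply: vspace_of_pred => [|c u v Hu Hv]; first by rewrite bracket0r scaler0.
  by rewrite bracketDr bracketZr Hu Hv scalerDr !scalerA mulrC.
have [U HU] := EU; apply/HU; apply: (jg_pi_stable J); last exact/HU.
move=> u /HU uE; apply/HU; have := ad_derivation s t u; rewrite !adE (abh s t) //.
by rewrite bracket0l add0r uE bracketZr.
Qed.

(** A joint eigenvector of [h] has a weight; the weight is either zero, and then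
    the vector lies in [h] because [h] is its own centraliser, or a root. *)
Lemma root_datum_exists (K : numClosedFieldType) (g : lieAlgebraType K) :
  simple_of_type_E7 g -> exists h G wt z, @root_datum K g h G wt z.
Proof.
move=> [_ [h [[abh maxh diagh] [alpha [balpha rootP]]]]].
pose av (i : 'I_7) (t : g) : K := tnth alpha i (vsproj h t).
pose wt (u : vec) (t : g) : K := \sum_(i < 7) (u`_i)%:~R * av i t.
have /choice[G HG] : forall u : vec, exists G : {vspace g},
    forall x, x \in G <-> (forall t, t \in h -> <|t, x|> = wt u t *: x).
  move=> u; apply: vspace_of_pred => [t _|c x y Hx Hy t th]; first by rewrite bracket0r scaler0.
  by rewrite bracketDr bracketZr Hx // Hy // scalerDr !scalerA mulrC.
have dimh : \dim h = 7%N.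
  have := size_basis balpha; rewrite dimvf => /= <-.
  by rewrite -[LHS]muln1.
have wtD u v t : wt (vadd u v) t = wt u t + wt v t.
  rewrite /wt -big_split; apply: eq_bigr => i _ /=.
  by rewrite nth_mkseq // rmorphD mulrDl.
have wtN u t : wt (vneg u) t = - wt u t.
  rewrite /wt -sumrN; apply: eq_bigr => i _ /=.
  by rewrite nth_mkseq // rmorphN mulNr.
have wt0 t : wt vzero t = 0.
  by rewrite /wt big1 // => i _; rewrite nth_nseq if_same mul0r.
have sep0 t : t \in h -> (forall i, av i t = 0) -> t = 0.
  move=> th avt; rewrite -(vsprojK th).
  suff -> : vsproj h t = 0 by rewrite linear0.
  rewrite (coord_vbasis (memvf (vsproj h t))) big1 // => j _.
  pose f : lie_dual h := linfun (coord (vbasis {:subvs_of h}) j : subvs_of h -> K^o).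
  have -> : coord (vbasis {:subvs_of h}) j (vsproj h t) = f (vsproj h t) by rewrite lfunE.
  rewrite (coord_basis balpha (memvf f)) sum_lfunE big1 ?scale0r // => i _.
  have := avt i; rewrite /av scale_lfunE (tnth_nth 0) => ->; exact: scaler0.
have avsurj (c : 'I_7 -> K) : exists2 z, z \in h & forall i : 'I_7, av i z = c i.
  pose ev (t : subvs_of h) : 'rV[K]_7 := \row_i tnth alpha i t.
  have evlin : linear ev by move=> a u v; apply/rowP => i; rewrite !mxE linearP.
  pose evM := GRing.isLinear.Build _ _ _ _ ev evlin.
  pose evL : {linear subvs_of h -> 'rV[K]_7} := HB.pack ev evM.
  have inj : (fullv :&: lker (linfun evL))%VS = 0%VS.
    apply/eqP; rewrite -subv0; apply/subvP => t; rewrite memv_cap memv_ker lfunE /= memv0.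
    move=> /andP[_ /eqP/rowP H]; rewrite -(inj_eq val_inj) linear0; apply/eqP.
    apply: sep0; first exact: subvsP.
    by move=> i; have := H i; rewrite !mxE /av vsvalK.
  have surj : limg (linfun evL) = fullv.
    have dS : dim (subvs_of h) = 7%N by exact: dimh.
    by apply/eqP; rewrite eqEdim subvf (limg_dim_eq inj) !dimvf dS dim_matrix mul1r.
  have : \row_(i < 7) c i \in limg (linfun evL) by rewrite surj memvf.
  move=> /memv_imgP[t _ E]; exists (vsval t); first exact: subvsP.
  by move=> i; have /rowP/(_ i) := E; rewrite lfunE !mxE /av vsvalK.
have [z zh zav] := avsurj (fun i => (regular_coweight`_i)%:~R).
have wtz u : wt u z = (weight_value u)%:~R.
  rewrite /wt /weight_value; under eq_bigr do rewrite zav -intrM.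
  by rewrite -rmorph_sum; congr (_%:~R); rewrite !big_ord_recl big_ord0.
have root_of (beta : lie_dual h) s : beta = \sum_(i < 7) (row_of_vec s 0 i)%:~R *: tnth alpha i ->
    forall t, t \in h -> beta (vsproj h t) = wt s t.
  move=> -> t th; rewrite sum_lfunE; apply: eq_bigr => i _.
  by rewrite scale_lfunE mxE.
have G0 : G vzero = h.
  apply/vspaceP => x; apply/idP/idP => [/HG xG | xh]; last first.
    by apply/HG => t th; rewrite abh // wt0 scale0r.
  have <- : (h + <[x]>)%VS = h; last by rewrite memvE addvSr.
  apply: maxh (addvSl _ _) => _ _ /memv_addP[s sh [_ /vlineP[a ->] ->]] /memv_addP[t th [_ /vlineP[b ->] ->]].
  rewrite bracketDl !bracketDr !bracketZr !bracketZl (abh s t) // bracketxx (bracketC x t).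
  by rewrite !xG // !wt0 !scale0r oppr0 !scaler0 !addr0.
have weight_vec x : x != 0 -> (forall t, t \in h -> exists a, <|t, x|> = a *: x) ->
    exists2 u, u \in vzero :: roots & x \in G u.
  move=> x0 Hx; have /choice[f Hf] : forall t : subvs_of h, exists a, <|vsval t, x|> = a *: x.
    by move=> t; apply/Hx/subvsP.
  have xinj a b : a *: x = b *: x -> a = b.
    by move/eqP; rewrite -subr_eq0 -scalerBl scaler_eq0 (negPf x0) orbF subr_eq0 => /eqP.
  have flin : linear (f : subvs_of h -> K^o).
    move=> a u v; apply: xinj; rewrite -Hf linearP bracketDl bracketZl !Hf.
    by rewrite scalerDl scalerA.
  pose fM := GRing.isLinear.Build _ _ _ _ (f : subvs_of h -> K^o) flin.
  pose fL : {linear subvs_of h -> K^o} := HB.pack (f : subvs_of h -> K^o) fM.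
  pose beta : lie_dual h := linfun fL.
  have Hb t : <|vsval t, x|> = beta t *: x by rewrite Hf lfunE.
  have [b0|b0] := eqVneq beta 0.
    exists vzero; first exact: mem_head.
    apply/HG => t th; rewrite wt0 scale0r -(vsprojK th) Hb b0 zero_lfunE scale0r //.
  have : lie_root beta by split=> //; exists x.
  move=> /rootP[_ /weyl_rootP[s sr ->] E]; exists s; first by rewrite inE sr orbT.
  by apply/HG => t th; rewrite -(root_of beta s E) // -Hb vsprojK.
have nz s : s \in roots -> G s != 0%VS.
  move=> sr; pose beta : lie_dual h := \sum_(i < 7) (row_of_vec s 0 i)%:~R *: tnth alpha i.
  have /rootP[_ [x x0 Hx]] : exists2 v, weyl_root E7_cartan_matrix v &
      beta = \sum_(i < 7) (v 0 i)%:~R *: tnth alpha i.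
    by exists (row_of_vec s) => //; apply/weyl_rootP; exists s.
  apply: contra_neq x0 => Gs0; apply/eqP; rewrite -memv0 -Gs0; apply/HG => t th.
  by rewrite -(root_of beta s) // -Hx vsprojK.
exists h, G, wt, z; split=> //.
- move=> u su ur u0; apply/eqP; rewrite -subv0; apply/subvP => x xG; rewrite memv0.
  apply: contrapT => /negP x0; have Hx t : t \in h -> exists a, <|t, x|> = a *: x.
    by move=> th; exists (wt u t); have /HG := xG; apply.
  have [v vr xv] := weight_vec x x0 Hx.
  have sv : size v = 7%N by move: vr; rewrite inE => /predU1P[->|/size_root].
  suff E : u = v by move: vr; rewrite -E inE (negPf u0) (negPf ur).
  apply: vecP => // k k7; have [t th tav] := avsurj (fun i => (i == Ordinal k7)%:R).
  have wtt w : wt w t = (w`_k)%:~R.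
    rewrite /wt (bigD1 (Ordinal k7)) //= tav eqxx mulr1 big1 ?addr0 // => i /negPf ik.
    by rewrite tav ik mulr0.
  have := HG u x; have := HG v x; move=> [/(_ xv t th) + _] [/(_ xG t th) + _] => ->.
  move/eqP; rewrite -subr_eq0 -scalerBl scaler_eq0 (negPf x0) orbF !wtt subr_eq0.
  by rewrite eqr_int => /eqP.
- move=> W WP; apply: (joint_eigenvectors_span abh diagh) => y Hy.
  have [->|y0] := eqVneq y 0; first exact: mem0v.
  by have [u ur] := weight_vec y y0 Hy; apply: (subvP (WP u ur)).
- move=> t th Ht; apply: sep0 => // i; have := Ht (simple_vec i).
  rewrite /wt (bigD1 i) //= nth_mkseq // eqxx mul1r big1 ?addr0 => [|j ji].
    by apply; apply/posroot_root/(allP simple_root); rewrite mem_iota ltn_ord.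
  by rewrite nth_mkseq // (negPf (ji : (j : nat) != i)) mul0r.
Qed.

Notation weights := (vzero :: roots).

Lemma weight_valueD u v : weight_value (vadd u v) = weight_value u + weight_value v.
Proof. by rewrite /weight_value /vadd /=; ring. Qed.

Lemma weight_valueN u : weight_value (vneg u) = - weight_value u.
Proof. by rewrite /weight_value /vneg /=; ring. Qed.

Lemma uniq_map_inj (T T' : eqType) (f : T -> T') (s : seq T) :
  uniq (map f s) -> {in s &, injective f}.
Proof.
elim: s => //= a s IHs /andP[fa us] u v.
rewrite !inE => /predU1P[->|us1] /predU1P[->|vs1] // E; last exact: IHs.
  by case/negP: fa; rewrite E map_f.
by case/negP: fa; rewrite -E map_f.
Qed.

Lemma weight_value_inj : {in weights &, injective weight_value}.
Proof. exact: uniq_map_inj weight_value_uniq. Qed.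

Lemma weights_uniq : uniq weights.
Proof. exact: map_uniq weight_value_uniq. Qed.

Lemma weight_value0 : weight_value vzero = 0. Proof. by []. Qed.

Lemma vneg_weight u : u \in weights -> vneg u \in weights.
Proof.
rewrite !(in_cons vzero) => /predU1P[->|/vneg_root ->]; last by rewrite orbT.
by rewrite (_ : vneg vzero = vzero) ?eqxx.
Qed.

Lemma vzero_root : vzero \notin roots.
Proof. by have /andP[] := weights_uniq. Qed.

Section RootSpaces.

Variables (K : numClosedFieldType) (g : lieAlgebraType K) (h : {vspace g}).
Variables (G : vec -> {vspace g}) (wt : vec -> g -> K) (z : g).
Hypotheses (RD : root_datum h G wt z) (sg : lie_simple g).
Implicit Types (x y : g) (u v : vec).

Lemma root_space_z u x : x \in G u -> <|z, x|> = (weight_value u)%:~R *: x.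
Proof. by move=> /(rd_mem RD)/(_ _ (rd_zh RD)); rewrite (rd_z RD). Qed.

Lemma root_space_bracket u v : bracket_sub (G u) (G v) (G (vadd u v)).
Proof.
move=> x y /(rd_mem RD) xu /(rd_mem RD) yv; apply/(rd_mem RD) => t th.
have := ad_derivation t x y; rewrite !adE => ->.
by rewrite (xu t th) (yv t th) bracketZl bracketZr (rd_wtD RD) scalerDl.
Qed.

Lemma z_directv (I : finType) (W : I -> {vspace g}) (mu : I -> int) : injective mu ->
  (forall i x, x \in W i -> <|z, x|> = (mu i)%:~R *: x) -> directv (\sum_i W i).
Proof.
move=> muI HW; apply/directv_sum_independent => us Hus su0 i _.
apply: (@eigen_independent _ _ (ad z) _ (fun i => (mu i)%:~R)) => //.
  by move=> j k /eqP; rewrite eqr_int => /eqP/muI.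
by move=> j; rewrite adE (HW j) // Hus.
Qed.

Definition wspace (i : 'I_127) : {vspace g} := G (nth vzero weights i).

Lemma size_weights : size weights = 127%N.
Proof. by rewrite /= rootsE size_cat size_map size_posroots. Qed.

Lemma wspaceP u : u \in weights -> exists i : 'I_127, nth vzero weights i = u.
Proof.
by move=> uw; have := uw; rewrite -index_mem size_weights => lt; exists (Ordinal lt); rewrite nth_index.
Qed.

Lemma mem_weights (i : 'I_127) : nth vzero weights i \in weights.
Proof. by rewrite mem_nth // size_weights. Qed.

Lemma wspace_direct : directv (\sum_i wspace i).
Proof.
pose mu (i : 'I_127) := weight_value (nth vzero weights i).
have muI : injective mu.
  move=> i j E; have := weight_value_inj (mem_weights i) (mem_weights j) E.
  move/eqP; rewrite nth_uniq ?size_weights ?ltn_ord ?weights_uniq // => /eqP; exact: val_inj.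
apply: z_directv muI _ => i x; exact: root_space_z.
Qed.

Lemma wspace_full : (\sum_i wspace i)%VS = fullv.
Proof.
apply: (rd_full RD) => u /wspaceP[i <-]; exact: (sumv_sup i).
Qed.

Lemma weight_decomposition x : exists2 c : 'I_127 -> g, forall i, c i \in wspace i & x = \sum_i c i.
Proof.
have : x \in (\sum_i wspace i)%VS by rewrite wspace_full memvf.
by move=> /memv_sumP[c Hc ->]; exists c => // i; apply: Hc.
Qed.

Lemma killing_root_spaces u v x y : u \in weights -> v \in weights ->
  x \in G u -> y \in G v -> v != vneg u -> killing x y = 0.
Proof.
move=> uw vw xu yv ne; have := killing_invariant z x y.
rewrite (root_space_z xu) (root_space_z yv) killingZl killingZr => /eqP.
rewrite -addr_eq0 -mulrDl mulf_eq0 -rmorphD intr_eq0 => /orP[|/eqP //].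
rewrite addrC addr_eq0 -weight_valueN => /eqP E; case/eqP: ne.
by apply: weight_value_inj => //; apply: vneg_weight.
Qed.

(** The radical of the Killing form is an ideal. It is not the whole algebra,
    since [killing z z] is a sum of squares of integers, not all zero. *)
Lemma killing_nondegenerate : nondegenerate g.
Proof.
have [R HR] : exists R : {vspace g}, forall x, x \in R <-> (forall y, killing x y = 0).
  apply: vspace_of_pred => [y|a u v Hu Hv y]; first exact: killing0l.
  by rewrite killingDl killingZl Hu Hv mulr0 addr0.
have idR : lie_ideal fullv R.
  split=> [|x y _ /HR yR]; first exact: subvf.
  by apply/HR => w; rewrite killing_invariant yR oppr0.
have [R0|Rf] := sg.2 R idR.
  by move=> x /HR; rewrite R0 memv0 => /eqP.
have /HR/(_ z) : z \in R by rewrite Rf memvf.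
rewrite /killing (lftrace_diag (c := fun i : 'I_127 => (weight_value (nth vzero weights i))%:~R ^+ 2)
  wspace_direct wspace_full) => [|i x xW]; last first.
  by rewrite comp_lfunE !adE (root_space_z xW) bracketZr (root_space_z xW) scalerA expr2.
move=> /eqP; rewrite psumr_eq0 => [/allP H|i _]; last first.
  by rewrite mulr_ge0 ?ler0n // -rmorphXn ler0z sqr_ge0.
have r0 : nth vzero roots 0 \in roots by rewrite mem_nth // rootsE size_cat size_posroots.
have [i Ei] : exists i : 'I_127, nth vzero weights i = nth vzero roots 0.
  by apply: wspaceP; rewrite (in_cons vzero) r0 orbT.
have := H i (mem_index_enum i); rewrite /= mulf_eq0 sqrf_eq0 intr_eq0 pnatr_eq0 dimv_eq0.
rewrite /wspace Ei (negPf (rd_nz RD r0)) orbF -weight_value0 => /eqP E.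
have := weight_value_inj _ _ E; rewrite !(in_cons vzero) r0 orbT eqxx => /(_ isT isT) E'.
by have := vzero_root; rewrite -E' r0.
Qed.

(** Only [G (vneg u)] pairs nontrivially with [G u]. *)
Lemma root_vector_pair u : u \in roots ->
  exists x y, [/\ x \in G u, y \in G (vneg u) & killing x y != 0].
Proof.
move=> ur; have uw : u \in weights by rewrite (in_cons vzero) ur orbT.
exists (vpick (G u)); have x0 : vpick (G u) != 0 by rewrite vpick0 (rd_nz RD).
have [y xy] : exists y, killing (vpick (G u)) y != 0.
  apply: contrapT => H; case/eqP: x0; apply: killing_nondegenerate => y.
  by apply: contrapT => /eqP xy; apply: H; exists y.
have [c Hc Ey] := weight_decomposition y; have [i Ei] := wspaceP (vneg_weight uw).
exists (c i); have := Hc i; rewrite /wspace Ei => ci; split=> //; first exact: memv_pick.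
move: xy; rewrite Ey killing_sumr (bigD1 i) //= big1 ?addr0 // => j ji.
apply: (killing_root_spaces uw (mem_weights j)) (memv_pick _) (Hc j) _.
apply: contra ji => /eqP E; apply/eqP/val_inj/eqP.
have lt (k : 'I_127) : (k < size weights)%N by rewrite size_weights.
by rewrite -(nth_uniq vzero (lt j) (lt i) weights_uniq) Ei E.
Qed.

Lemma vadd_neg u : vadd u (vneg u) = vzero.
Proof. by apply: vecP => [||k k7]; rewrite ?size_mkseq // !nth_mkseq // subrr nth_nseq if_same. Qed.

Lemma vaddC u v : vadd u v = vadd v u.
Proof. by apply: vecP => [||k k7]; rewrite ?size_mkseq // !nth_mkseq // addrC. Qed.

Lemma vaddNK u v : size v = 7%N -> vadd u (vadd (vneg u) v) = v.
Proof. by move=> sv; apply: vecP => [|//|k k7]; rewrite ?size_mkseq // !nth_mkseq // addrA subrr add0r. Qed.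

Lemma vaddKN u v : size v = 7%N -> vadd (vneg u) (vadd u v) = v.
Proof. by move=> sv; apply: vecP => [|//|k k7]; rewrite ?size_mkseq // !nth_mkseq // addrA addNr add0r. Qed.

Lemma root_weight u : u \in roots -> u \in weights.
Proof. by move=> ur; rewrite (in_cons vzero) ur orbT. Qed.

Lemma root_value_neq0 u : u \in roots -> weight_value u != 0.
Proof.
move=> ur; apply/eqP => E; have := vzero_root.
by rewrite -(weight_value_inj (root_weight ur) (mem_head _ _) E) ur.
Qed.

Lemma root_string u v : u \in roots -> v \in roots -> v != u -> v != vneg u ->
  G (vadd u (vadd u v)) = 0%VS.
Proof.
move=> ur vr vu vnu; have := allP (allP root_strings u ur) v vr.
rewrite eq_sym (negPf vu) /=.
have -> : (u == vneg v) = false.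
  by apply: contraNF vnu => /eqP ->; rewrite vnegK ?size_root.
move=> /and3P[n1 n2 _]; apply: (rd_out RD) => //; exact: size_mkseq.
Qed.

Lemma root_string_short u v : u \in roots -> v \in roots -> vadd u v \in roots ->
  G (vadd (vneg u) v) = 0%VS /\ G (vadd u (vadd u v)) = 0%VS.
Proof.
move=> ur vr uvr.
have vu : v != u by apply: contraTneq uvr => ->; apply: (allP roots_double).
have vnu : v != vneg u by apply: contraTneq uvr => ->; rewrite vadd_neg vzero_root.
split; last exact: root_string.
have := allP (allP root_strings u ur) v vr; rewrite eq_sym (negPf vu) /=.
have -> : (u == vneg v) = false.
  by apply: contraNF vnu => /eqP ->; rewrite vnegK ?size_root.
move=> /and3P[_ _]; rewrite uvr /= => n; apply: (rd_out RD) n _; first exact: size_mkseq.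
by apply: contra vu => /eqP E; rewrite -(vaddNK u (size_root vr)) E; apply/eqP/vecP => [|//|k k7];
  rewrite ?size_mkseq ?size_root // nth_mkseq // nth_nseq if_same addr0.
Qed.

Lemma root_double u : u \in roots -> G (vadd u u) = 0%VS.
Proof.
move=> ur; apply: (rd_out RD); rewrite ?size_mkseq ?(allP roots_double) //.
have := root_value_neq0 ur; apply: contra => /eqP/(congr1 weight_value).
rewrite weight_valueD weight_value0 -mulr2n => /eqP; by rewrite mulrn_eq0.
Qed.

Section Coroot.

Variables (u : vec) (x y : g).
Hypotheses (ur : u \in roots) (xu : x \in G u) (yu : y \in G (vneg u)).
Hypothesis xy : killing x y != 0.
Let tau := <|x, y|>.

Lemma tau_h : tau \in h.
Proof. by rewrite -(rd_zero RD) -(vadd_neg u) root_space_bracket. Qed.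

Lemma tau_bracket w : <|x, <|y, w|>|> - <|y, <|x, w|>|> = <|tau, w|>.
Proof. by have := ad_derivation x y w; rewrite !adE => ->; rewrite addrK. Qed.

(** [tau] acts as the commutator of [ad x] and [ad y] on every subspace that both
    preserve, hence with trace zero. *)
Lemma stable_trace n (W : 'I_n -> {vspace g}) (mu : 'I_n -> int) (c : 'I_n -> K) : injective mu ->
  (forall i w, w \in W i -> <|z, w|> = (mu i)%:~R *: w) ->
  (forall i w, w \in W i -> <|tau, w|> = c i *: w) ->
  (forall i w, w \in W i -> <|x, w|> \in (\sum_i W i)%VS /\ <|y, w|> \in (\sum_i W i)%VS) ->
  \sum_i c i * (\dim (W i))%:R = 0.
Proof.
move=> muI Wz Wt Wxy; apply: (@lftrace_commutator _ _ _ W c (ad x) (ad y)).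
- exact: z_directv muI Wz.
- by move=> i w wW; rewrite adE; have [] := Wxy i w wW.
- by move=> i w wW; rewrite adE; have [] := Wxy i w wW.
- by move=> i w wW; rewrite !adE tau_bracket (Wt i).
Qed.

(* [z] separates the spaces of a root string *)
Lemma string_values v : injective (fun i : 'I_3 => weight_value v + weight_value u * (i%:Z - 1)).
Proof.
move=> i j /addrI/(mulfI (root_value_neq0 ur))/addIr/eqP; rewrite eqz_nat => /eqP; exact: val_inj.
Qed.

(** If [u] vanished at [tau], the trace of [tau] on the [u]-string through a root
    [v] would be [v] at [tau] times the dimension of the string. So all the roots
    would vanish at [tau], and [tau] would be zero, whereas
    [killing z tau] is not. *)
Lemma root_tau_neq0 : wt u tau != 0.
Proof.
apply/eqP => ut0; have tau0 : tau = 0.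
  apply: (rd_sep RD tau_h) => v vr; have [->|vu] := eqVneq v u; first exact: ut0.
  have [->|vnu] := eqVneq v (vneg u); first by rewrite (rd_wtN RD) ut0 oppr0.
  pose W (i : 'I_3) := nth 0%VS [:: G (vadd (vneg u) v); G v; G (vadd u v)] i.
  have sW w : w \in G (vadd (vneg u) v) \/ w \in G v \/ w \in G (vadd u v) -> w \in (\sum_i W i)%VS.
    rewrite !big_ord_recl big_ord0 addv0 /W /= => -[|[]] H.
    - by apply: subvP H; apply: addvSl.
    - by apply: subvP H; apply: subv_trans (addvSr _ _); apply: addvSl.
    - by apply: subvP H; apply: subv_trans (addvSr _ _); apply: addvSr.
  have nur := vneg_root ur; have sv := size_root vr.
  have Wz (i : 'I_3) w : w \in W i ->
      <|z, w|> = (weight_value v + weight_value u * (i%:Z - 1))%:~R *: w.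
    case: i => [[|[|[|//]]] ?] /= /root_space_z ->; congr (_%:~R *: _);
    by rewrite ?weight_valueD ?weight_valueN; ring.
  have Wt (i : 'I_3) w : w \in W i -> <|tau, w|> = wt v tau *: w.
    case: i => [[|[|[|//]]] ?] /= /(rd_mem RD)/(_ _ tau_h) ->; congr (_ *: _);
    by rewrite ?(rd_wtD RD) ?(rd_wtN RD) ut0 ?oppr0 ?add0r.
  have Wxy (i : 'I_3) w : w \in W i ->
      <|x, w|> \in (\sum_i W i)%VS /\ <|y, w|> \in (\sum_i W i)%VS.
    have X v' : w \in G v' -> <|x, w|> \in G (vadd u v') /\ <|y, w|> \in G (vadd (vneg u) v').
      by move=> wv; split; apply: root_space_bracket.
    case: i => [[|[|[|//]]] ?] /= /X[]; rewrite ?vaddNK ?vaddKN // => xw yw; split; apply: sW; auto.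
      move: yw; rewrite root_string ?vnegK ?(size_root ur) //.
      by rewrite memv0 => /eqP ->; left; exact: mem0v.
    by move: xw; rewrite root_string // memv0 => /eqP ->; left; exact: mem0v.
  have := stable_trace (@string_values v) Wz Wt Wxy.
  rewrite -mulr_sumr => /eqP; rewrite mulf_eq0 => /orP[/eqP //|].
  rewrite -natr_sum pnatr_eq0 sum_nat_eq0 => /forallP/(_ 1)/=.
  by rewrite /W /= dimv_eq0 (negPf (rd_nz RD vr)).
have := killing_invariant x y z; rewrite -/tau tau0 killing0l => /esym/eqP.
rewrite oppr_eq0 bracketC (root_space_z xu) -scaleNr killingZr mulf_eq0 oppr_eq0 intr_eq0.
by rewrite (negPf (root_value_neq0 ur)) killingC (negPf xy).
Qed.

(** On the sum of the line of [y], of [h] and of [G u], the trace of [tau] is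
    [u] at [tau] times [\dim (G u) - 1]. *)
Lemma dim_root_space_coroot : \dim (G u) = 1%N.
Proof.
pose W (i : 'I_3) := nth 0%VS [:: <[y]>%VS; h; G u] i.
pose c (i : 'I_3) := nth 0 [:: - wt u tau; 0; wt u tau] i.
have sW w : w \in <[y]>%VS \/ w \in h \/ w \in G u -> w \in (\sum_i W i)%VS.
  rewrite !big_ord_recl big_ord0 addv0 /W /= => -[|[]] H.
  - by apply: subvP H; apply: addvSl.
  - by apply: subvP H; apply: subv_trans (addvSr _ _); apply: addvSl.
  - by apply: subvP H; apply: subv_trans (addvSr _ _); apply: addvSr.
have hz w : w \in h -> <|z, w|> = 0 by move=> wh; rewrite (rd_abelian RD) ?(rd_zh RD).
have Wz (i : 'I_3) w : w \in W i ->
    <|z, w|> = (weight_value vzero + weight_value u * (i%:Z - 1))%:~R *: w.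
  case: i => [[|[|[|//]]] ?] /=.
  - move=> /vlineP[k ->]; rewrite bracketZr (root_space_z yu) weight_valueN !scalerA mulrC.
    by congr ((_ * _) *: _); congr (_%:~R); rewrite weight_value0; ring.
  - by move=> /hz ->; rewrite weight_value0 subrr mulr0 addr0 scale0r.
  - by move=> /root_space_z ->; congr (_%:~R *: _); rewrite weight_value0; ring.
have Wt (i : 'I_3) w : w \in W i -> <|tau, w|> = c i *: w.
  case: i => [[|[|[|//]]] ?] /=.
  - move=> /vlineP[k ->]; have /(rd_mem RD)/(_ _ tau_h) E := yu.
    by rewrite bracketZr E (rd_wtN RD) /c !scalerA mulrC.
  - by move=> wh; rewrite (rd_abelian RD tau_h wh) scale0r.
  - by move=> /(rd_mem RD)/(_ _ tau_h).
have Wxy (i : 'I_3) w : w \in W i ->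
    <|x, w|> \in (\sum_i W i)%VS /\ <|y, w|> \in (\sum_i W i)%VS.
  case: i => [[|[|[|//]]] ?] /=.
  - move=> /vlineP[k ->]; rewrite !bracketZr bracketxx scaler0 mem0v; split=> //.
    by apply: sW; right; left; rewrite memvZ // tau_h.
  - move=> wh; rewrite [<|x, w|>]bracketC [<|y, w|>]bracketC.
    have /(rd_mem RD)/(_ _ wh) -> := xu; have /(rd_mem RD)/(_ _ wh) -> := yu.
    split; rewrite memvN; apply: sW; first by right; right; rewrite memvZ.
    by left; rewrite memvZ ?memv_line.
  - move=> wu; split; apply: sW.
      by have := root_space_bracket xu wu; rewrite root_double // memv0 => /eqP ->; left; apply: mem0v.
    right; left; rewrite -(rd_zero RD) -(vadd_neg u) vaddC; exact: root_space_bracket.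
have := stable_trace (@string_values vzero) Wz Wt Wxy.
rewrite !big_ord_recl big_ord0 /W /c /= mul0r add0r addr0.
have y0 : y != 0 by apply: contra_neq xy => ->; rewrite linear0.
rewrite dim_vline y0 mulr1 addrC => /eqP; rewrite subr_eq0 -[X in _ == X]mulr1.
by rewrite (inj_eq (mulfI root_tau_neq0)) pnatr_eq1 => /eqP.
Qed.

End Coroot.

Lemma dim_root_space u : u \in roots -> \dim (G u) = 1%N.
Proof.
by move=> ur; have [x [y [xu yu xy]]] := root_vector_pair ur; apply: dim_root_space_coroot xy.
Qed.

End RootSpaces.

(** * The standard Borel subalgebra *)

Lemma heightD u v : height (vadd u v) = height u + height v.
Proof. by rewrite /height /vadd /=; ring. Qed.

Lemma heightN u : height (vneg u) = - height u.
Proof. by rewrite /height /vneg /=; ring. Qed.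

Lemma weight_height u : u \in weights -> height u < 18 /\ - 18 < height u.
Proof.
have pos v : v \in posroots -> 0 < height v /\ height v < 18.
  by move=> vp; have /andP[] := allP posroots_height v vp.
rewrite (in_cons vzero) rootsE mem_cat => /predU1P[->|/orP[/pos|/mapP[v /pos ? ->]]] //;
  rewrite ?heightN; lia.
Qed.

Lemma height_gt0 u : u \in weights -> (0 < height u) = (u \in posroots).
Proof.
have pos v : v \in posroots -> 0 < height v /\ height v < 18.
  by move=> vp; have /andP[] := allP posroots_height v vp.
move=> uw; apply/idP/idP => [|/pos[] //]; move: uw.
rewrite (in_cons vzero) rootsE mem_cat => /predU1P[->|/orP[//|/mapP[v /pos ? ->]]] //.
rewrite heightN; lia.
Qed.

Lemma height_eq0 u : u \in weights -> (height u == 0) = (u == vzero).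
Proof.
have pos v : v \in posroots -> 0 < height v /\ height v < 18.
  by move=> vp; have /andP[] := allP posroots_height v vp.
move=> uw; apply/idP/idP => [|/eqP -> //]; move: uw.
rewrite (in_cons vzero) rootsE mem_cat => /predU1P[->|/orP[/pos|/mapP[v /pos ? ->]]] //;
  rewrite ?heightN; lia.
Qed.

Section RootSpaceSums.

Variables (K : numClosedFieldType) (g : lieAlgebraType K) (h : {vspace g}).
Variables (G : vec -> {vspace g}) (wt : vec -> g -> K) (z : g).
Hypotheses (RD : root_datum h G wt z) (sg : lie_simple g).
Implicit Types (x y : g) (u v : vec) (P Q : pred vec) (W : {vspace g}).


(** The sum of the root spaces, and of the Cartan subalgebra, selected by [P]. *)
Definition wspan P : {vspace g} := (\sum_(i < 127 | P (nth vzero weights i)) wspace G i)%VS.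

Lemma wspan_sup P u : u \in weights -> P u -> (G u <= wspan P)%VS.
Proof. by move=> /wspaceP[i <-] Pu; apply: (sumv_sup i). Qed.

Lemma wspan_sub P W : (forall u, u \in weights -> P u -> (G u <= W)%VS) -> (wspan P <= W)%VS.
Proof. by move=> H; apply/subv_sumP => i Pi; apply: H => //; apply: mem_weights. Qed.

Lemma wspanS P Q : (forall u, u \in weights -> P u -> Q u) -> (wspan P <= wspan Q)%VS.
Proof. by move=> H; apply: wspan_sub => u uw Pu; apply: wspan_sup => //; apply: H. Qed.

Lemma wspanT : wspan xpredT = fullv.
Proof. exact: (wspace_full RD). Qed.

Lemma wspan0 P : (forall u, u \in weights -> ~~ P u) -> wspan P = 0%VS.
Proof. by move=> H; rewrite /wspan big_pred0 // => i; apply/negbTE/H/mem_weights. Qed.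

Lemma wspan_bracket P Q W :
  (forall u v, u \in weights -> v \in weights -> P u -> Q v -> bracket_sub (G u) (G v) W) ->
  bracket_sub (wspan P) (wspan Q) W.
Proof.
move=> H x y /memv_sumP[c Hc ->] /memv_sumP[d Hd ->].
rewrite bracket_suml; apply: memv_suml => i Pi; rewrite bracket_sumr; apply: memv_suml => j Qj.
by apply: (H _ _ (mem_weights i) (mem_weights j) Pi Qj); [apply: Hc | apply: Hd].
Qed.

(* [G (vadd u v)] is zero when [vadd u v] is not a weight *)
Lemma root_space_bracket_sub u v W :
  (vadd u v \in weights -> (G (vadd u v) <= W)%VS) -> bracket_sub (G u) (G v) W.
Proof.
move=> H x y xu yv; have xy := root_space_bracket RD xu yv.
have [uv|uv] := boolP (vadd u v \in weights); first by apply: subvP xy; apply: H.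
move: xy; rewrite (rd_out RD (u := vadd u v) (size_mkseq _ _)) ?memv0 => [/eqP ->| |]; first exact: mem0v.
  by apply: contra uv; rewrite (in_cons vzero) => ->; rewrite orbT.
by apply: contra uv => /eqP ->; apply: mem_head.
Qed.

Lemma wspan_killing P Q x y :
  (forall u v, u \in weights -> v \in weights -> P u -> Q v -> v != vneg u) ->
  x \in wspan P -> y \in wspan Q -> killing x y = 0.
Proof.
move=> H /memv_sumP[c Hc ->] /memv_sumP[d Hd ->].
rewrite killing_suml big1 // => i Pi; rewrite killing_sumr big1 // => j Qj.
apply: (killing_root_spaces RD (mem_weights i) (mem_weights j)); [exact: Hc|exact: Hd|].
exact: H (mem_weights i) (mem_weights j) Pi Qj.
Qed.

Lemma dim_wspan P : \dim (wspan P) = ((P vzero) * 7 + count P roots)%N.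
Proof.
have dP : directv (\sum_(i < 127 | P (nth vzero weights i)) wspace G i).
  apply/directv_sum_independent => us Hus su0 i Pi.
  pose c (j : 'I_127) := if P (nth vzero weights j) then us j else 0.
  have /directv_sum_independent/(_ c) H := wspace_direct RD.
  have -> : us i = c i by rewrite /c Pi.
  apply: H => // [j _|]; last by rewrite -big_mkcond.
  by rewrite /c; case: ifP => [/Hus //|_]; exact: mem0v.
rewrite /wspan; have /directvP/= -> := dP.
rewrite big_mkcond /= big_ord_recl /= {1}/wspace /= (rd_zero RD) (rd_dimh RD).
congr (_ + _)%N; first by case: (P vzero).
have sr : size roots = 126%N by rewrite rootsE size_cat size_map size_posroots.
rewrite -sum1_count (big_nth vzero) sr big_mkord.
rewrite [RHS]big_mkcond; apply: eq_bigr => i _ /=.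
by rewrite /wspace /= add0n (dim_root_space RD sg) // mem_nth // sr.
Qed.

Definition hspan (k : int) := wspan (fun u => k <= height u).

Lemma hspanS k l : l <= k -> (hspan k <= hspan l)%VS.
Proof. by move=> lk; apply: wspanS => u _; apply: le_trans. Qed.

Lemma hspan_bracket k l : bracket_sub (hspan k) (hspan l) (hspan (k + l)).
Proof.
apply: wspan_bracket => u v uw vw ku lv; apply: root_space_bracket_sub => uvw.
by apply: wspan_sup => //; rewrite heightD lerD.
Qed.

Lemma hspan_top k : 18 <= k -> hspan k = 0%VS.
Proof.
by move=> k18; apply: wspan0 => u /weight_height[u18 _]; rewrite -ltNge (lt_le_trans u18).
Qed.

Lemma hspan_bot k : k <= - 18 -> hspan k = fullv.
Proof.
move=> k18; apply/eqP; rewrite eqEsubv subvf -wspanT; apply: wspanS => u /weight_height[_ u18] _.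
exact: ltW (le_lt_trans k18 u18).
Qed.

(** The sum of two heights that are at least 0 is positive unless both are zero, and
    [h] is abelian. *)
Lemma hspan_derived0 : (lie_derived (hspan 0) <= hspan 1)%VS.
Proof.
apply/lie_derivedP/wspan_bracket => u v uw vw ku lv; have [u0|u0] := eqVneq u vzero.
  have [v0|v0] := eqVneq v vzero.
    move=> x y; rewrite u0 v0 (rd_zero RD) => xh yh.
    by rewrite (rd_abelian RD xh yh) mem0v.
  apply: root_space_bracket_sub => uvw; apply: wspan_sup => //.
  by move: ku lv v0; rewrite -(height_eq0 vw) heightD; lia.
apply: root_space_bracket_sub => uvw; apply: wspan_sup => //.
by move: ku lv u0; rewrite -(height_eq0 uw) heightD; lia.
Qed.

Lemma hspan0_subalgebra : lie_subalgebra (hspan 0).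
Proof. by apply: bracket_subS (hspan_bracket (k := 0) (l := 0)). Qed.

Lemma hspan0_solvable : lie_solvable (hspan 0).
Proof.
have H n : (iter n.+1 (@lie_derived _ _) (hspan 0) <= hspan n.+1%:Z)%VS.
  elim: n => [|n IHn]; first exact: hspan_derived0.
  rewrite iterS; apply: subv_trans (lie_derivedS IHn) _; apply/lie_derivedP.
  apply: bracket_subS (hspan_bracket (k := n.+1%:Z) (l := n.+1%:Z)) => //.
  by apply: hspanS; lia.
by exists 18%N; apply/eqP; rewrite -subv0 -(hspan_top (k := 18)) //; apply: (H 17).
Qed.

Lemma dim_hspan0 : \dim (hspan 0) = 70%N.
Proof.
rewrite /hspan dim_wspan lexx rootsE count_cat count_map mul1n.
rewrite (eq_in_count (a2 := xpredT)) => [|v vp]; last first.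
  by have /andP[/ltW] := allP posroots_height v vp.
rewrite count_predT size_posroots (eq_in_count (a2 := pred0)) => [|v vp]; last first.
  by have /andP[v0 _] := allP posroots_height v vp; rewrite /= heightN oppr_ge0 leNgt v0.
by rewrite count_pred0.
Qed.

Lemma dim_hspan1 : \dim (hspan 1) = 63%N.
Proof.
rewrite /hspan dim_wspan rootsE count_cat count_map.
rewrite (eq_in_count (a2 := xpredT)) => [|v vp]; last first.
  by have /andP[] := allP posroots_height v vp.
rewrite count_predT size_posroots (eq_in_count (a2 := pred0)) => [|v vp]; last first.
  have /andP[v0 _] := allP posroots_height v vp; rewrite /= heightN; apply/negbTE; lia.
by rewrite count_pred0.
Qed.

Lemma dim_g : \dim {:g} = 133%N.
Proof. by rewrite -wspanT dim_wspan count_predT rootsE size_cat size_map size_posroots. Qed.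

Lemma hspan1_nilpotent y (v : g) : y \in hspan 1 -> iter 36%N (ad y) v = 0.
Proof.
move=> y1; have H n : iter n (ad y) v \in hspan (n%:Z - 18).
  elim: n => [|n IHn]; first by rewrite hspan_bot ?memvf.
  rewrite iterS adE (_ : n.+1%:Z - 18 = 1 + (n%:Z - 18)); last by lia.
  exact: hspan_bracket.
by apply/eqP; rewrite -memv0 -(hspan_top (k := 36%:Z - 18)) //; apply: H.
Qed.

Lemma hspan_killing x y : x \in hspan 1 -> y \in hspan 0 -> killing x y = 0.
Proof.
apply: wspan_killing => u v uw vw ku lv; apply: contraTneq lv => ->.
by rewrite heightN; lia.
Qed.

(** A Borel subalgebra [b] has dimension at least that of the standard one,
    [hspan 0], and its ad-nilpotent elements are orthogonal to it. Counting
    dimensions, [b] meets every coset of the standard nilradical [hspan 1] in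
    [hspan 0]. *)
Lemma borel_meets_coset (b : {vspace g}) : borel_subalgebra b ->
  exists2 y, y \in b & y - z \in hspan 1.
Proof.
move=> bb; have nd := killing_nondegenerate RD sg; have [subb solb _] := bb.
have db := borel_dim_leq nd bb hspan0_subalgebra hspan0_solvable.
have n01 : (hspan 1 <= hspan 0)%VS by apply: hspanS.
pose p := (b :&: hspan 0)%VS.
have perp : (\dim (b + hspan 0) + \dim (p :&: hspan 1) <= \dim {:g})%N.
  apply: (dim_killing_perp nd) => _ y /memv_addP[s sb [t t0 ->]].
  rewrite !memv_cap => /andP[/andP[yb _] y1]; rewrite killingDl killingC [killing t y]killingC.
  rewrite [killing y t]hspan_killing // addr0 killingC.
  exact: (killing_solvable nd subb solb sb yb (fun x => hspan1_nilpotent x y1)).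
have dbp := dimv_sum_cap b (hspan 0); have dpn := dimv_sum_cap p (hspan 1).
have pn : (p + hspan 1 <= hspan 0)%VS by rewrite subv_add capvSr.
have E : (p + hspan 1)%VS = hspan 0.
  apply/eqP; rewrite eqEdim pn /=; move: db perp dbp dpn.
  rewrite -/p dim_hspan0 dim_hspan1 dim_g; lia.
have : z \in hspan 0.
  apply: (subvP (wspan_sup (u := vzero) _ _)); rewrite ?mem_head //.
  by rewrite (rd_zero RD) (rd_zh RD).
rewrite -E => /memv_addP[y yp [w w1 zE]]; exists y.
  by move: yp; rewrite memv_cap => /andP[].
by rewrite zE opprD addrA subrr add0r memvN.
Qed.

Lemma automorphism_comp (s t : 'End(g)) : automorphism s -> automorphism t ->
  automorphism (s \o t)%VF.
Proof.
move=> [/lker0P s0 sb] [/lker0P t0 tb]; split; last by move=> x y; rewrite !comp_lfunE tb sb.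
by apply/lker0P => x y; rewrite !comp_lfunE => /s0/t0.
Qed.

Lemma automorphism1 : automorphism (\1%VF : 'End(g)).
Proof. by split=> [|x y]; rewrite ?id_lfunE //; apply/lker0P => x y; rewrite !id_lfunE. Qed.

(** The elements of [z + hspan 1] are conjugate to [z] under exponentials of
    elements of [hspan 1], since [ad z] is invertible on [hspan 1]. *)
Lemma coset_conjugate y : y - z \in hspan 1 -> exists2 s : 'End(g), automorphism s & s y = z.
Proof.
suff H n : forall k, (18 <= k.+1 + n)%N -> y - z \in hspan k.+1%:Z ->
    exists2 s : 'End(g), automorphism s & s y = z by apply: (H 17%N 0%N).
elim: n y => [|n IHn] {}y k kn yk.
  have : y - z \in hspan k.+1%:Z by []. 
  rewrite hspan_top ?memv0 ?subr_eq0 => [/eqP ->|]; last by lia.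
  by exists \1%VF; [exact: automorphism1 | rewrite id_lfunE].
set w := y - z in yk; have /memv_sumP[c Hc wE] := yk.
pose u := \sum_(i < 127 | k.+1%:Z <= height (nth vzero weights i))
   ((weight_value (nth vzero weights i))%:~R)^-1 *: c i.
have uk : u \in hspan k.+1%:Z by apply: memv_suml => i ki; apply/memvZ/(subvP (sumv_sup i ki (subvv _)))/Hc.
have u1 : u \in hspan 1 by apply: subvP uk; apply: hspanS; lia.
have uz : <|u, z|> = - w.
  rewrite bracketC wE bracket_sumr; congr (- _); apply: eq_bigr => i ki.
  rewrite bracketZr (root_space_z RD (Hc i ki)) scalerA mulVf ?scale1r // intr_eq0.
  apply: root_value_neq0; move: (mem_weights i); rewrite (in_cons vzero) => /predU1P[E|//].
  by move: ki; rewrite E.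
pose n0 := 36%N; have adn x : iter n0 (ad u) x = 0 by apply: hspan1_nilpotent.
pose s : 'End(g) := linfun (expN (ad u) n0 1).
have as_ : automorphism s by apply: expN_automorphism adn (ad_derivation u) 1.
have yE : y = z + w by rewrite addrC subrK.
have wk2 : <|u, w|> \in hspan k.+2%:Z.
  have := hspan_bracket uk yk; apply: subvP; apply: hspanS; lia.
have uy : <|u, y|> = <|u, w|> - w by rewrite yE bracketDr uz addrC.
have uyk : <|u, y|> \in hspan k.+1%:Z.
  by rewrite uy memvB //; apply: subvP wk2; apply: hspanS; lia.
have iterk j : iter j.+2 (ad u) y \in hspan k.+2%:Z.
  elim: j => [|j IHj]; rewrite iterS adE.
    rewrite iterS adE /=; have := hspan_bracket uk uyk; apply: subvP; apply: hspanS; lia.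
  have := hspan_bracket uk IHj; apply: subvP; apply: hspanS; lia.
have sy : s y - z \in hspan k.+2%:Z.
  have -> : s y = y + (<|u, y|> + \sum_(i < 34) dpow (ad u) i.+2 y).
    rewrite lfunE /= /expN /curve /n0 2!big_ord_recl !expr1n !scale1r dpow0.
    rewrite [dpow _ (lift _ _) y]dpowE invr1 scale1r [iter _ _ _]adE.
    by congr (_ + (_ + _)); apply: eq_bigr => i _; rewrite expr1n scale1r.
  rewrite uy addrA [y + _]addrC -addrA [y + _]addrC addrA addrAC -!addrA memvD //.
  rewrite addrA {1}yE [_ + w]addrC addKr addrCA subrr addr0.
  by apply: memv_suml => i _; rewrite dpowE memvZ.
have [|s' as' s'y] := IHn (s y) k.+1 _ sy; first by lia.
by exists (s' \o s)%VF; [apply: automorphism_comp | rewrite comp_lfunE].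
Qed.

End RootSpaceSums.

(** * Borel subalgebras containing the regular element *)

Section BorelRoots.

Variables (K : numClosedFieldType) (g : lieAlgebraType K) (h : {vspace g}).
Variables (G : vec -> {vspace g}) (wt : vec -> g -> K) (z : g).
Hypotheses (RD : root_datum h G wt z) (sg : lie_simple g).
Implicit Types (x y : g) (u v : vec) (P Q : pred vec) (W I : {vspace g}).

(** The bracket [[G u, G v]] is not zero: otherwise [ad x] and [ad y] would preserve
    both [G v] and [G v + G (u + v)], and the traces of [tau] on these would give
    [v] and then [u] zero at [tau]. As [G (u + v)] is a line, any subspace containing
    the brackets contains it. *)
Lemma root_bracket_sub u v W : u \in roots -> v \in roots -> vadd u v \in roots ->
  bracket_sub (G u) (G v) W -> (G (vadd u v) <= W)%VS.
Proof.
move=> ur vr uvr uvW; have [x [y [xu yu xy]]] := root_vector_pair RD sg ur.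
have tw s w : w \in G s -> <| <|x, y|>, w|> = wt s <|x, y|> *: w.
  by move=> /(rd_mem RD); apply; apply: (tau_h RD xu yu).
have [Gm Gp] := root_string_short RD ur vr uvr.
have y0 w : w \in G v -> <|y, w|> = 0.
  by move=> wv; have := root_space_bracket RD yu wv; rewrite Gm memv0 => /eqP.
have [w wv xw] : exists2 w, w \in G v & <|x, w|> != 0.
  apply: contrapT => H; have x0 w : w \in G v -> <|x, w|> = 0.
    by move=> wv; apply: contrapT => /eqP xw; apply: H; exists w.
  have natneq0 s : s \in roots -> (\dim (G s))%:R != 0 :> K.
    by move=> sr; rewrite (dim_root_space RD sg sr) oner_neq0.
  have v0 : wt v <|x, y|> = 0.
    have muI : injective (fun _ : 'I_1 => weight_value v) by move=> i k _; rewrite !ord1.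
    have := @stable_trace _ _ z x y _ (fun=> G v) _ (fun=> wt v <|x, y|>) muI.
    rewrite !big_ord1 => T; have /eqP : wt v <|x, y|> * (\dim (G v))%:R = 0; last first.
      by rewrite mulf_eq0 (negPf (natneq0 v vr)) orbF => /eqP.
    apply: T => [_ w|_ w|_ w wv]; [exact: (root_space_z RD) | exact: tw |].
    by rewrite x0 // y0 // mem0v.
  pose W2 (i : 'I_2) := nth 0%VS [:: G v; G (vadd u v)] i.
  pose c2 (i : 'I_2) := nth 0 [:: 0; wt u <|x, y|>] i.
  have sumW : (\sum_i W2 i)%VS = (G v + G (vadd u v))%VS.
    by rewrite !big_ord_recl big_ord0 addv0.
  have muI : injective (fun i : 'I_2 => weight_value v + weight_value u * i%:Z).
    move=> i j /addrI/(mulfI (root_value_neq0 ur))/eqP; rewrite eqz_nat => /eqP; exact: val_inj.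
  have := @stable_trace _ _ z x y _ W2 _ c2 muI; rewrite sumW => T.
  have : \sum_i c2 i * (\dim (W2 i))%:R = 0.
    apply: T => [[[|[|//]] ?] w|[[|[|//]] ?] w|[[|[|//]] ?] w] /= wW.
    - by rewrite (root_space_z RD wW) mulr0 addr0.
    - by rewrite (root_space_z RD wW) weight_valueD mulr1 addrC.
    - by rewrite (tw _ _ wW) v0 /c2.
    - by rewrite (tw _ _ wW) (rd_wtD RD) v0 addr0.
    - by rewrite x0 // y0 // mem0v.
    - have := root_space_bracket RD xu wW; rewrite Gp memv0 => /eqP ->; rewrite mem0v; split=> //.
      have := root_space_bracket RD yu wW; rewrite vaddKN ?size_root // => yw.
      exact: subvP (addvSl _ _) _ yw.
  rewrite !big_ord_recl big_ord0 /c2 /W2 /= mul0r add0r addr0 => /eqP.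
  rewrite mulf_eq0 (negPf (natneq0 _ uvr)) orbF.
  by rewrite (negPf (root_tau_neq0 RD ur xu yu xy)).
have <- : (<[ <|x, w|> ]>)%VS = G (vadd u v).
  apply/eqP; rewrite eqEdim dim_vline xw (dim_root_space RD sg uvr) leqnn andbT.
  by rewrite -memvE; apply: (root_space_bracket RD).
by rewrite -memvE; apply: uvW.
Qed.

(** [z] separates the weights, so the weight components are polynomials in [ad z]
    applied to the vector. *)
Lemma root_component_mem W : (forall x, x \in W -> <|z, x|> \in W) ->
  forall c : 'I_127 -> g, (forall i, c i \in wspace G i) -> \sum_i c i \in W ->
  forall i, c i \in W.
Proof.
move=> zW c Hc cW i; pose mu (j : 'I_127) : K := (weight_value (nth vzero weights j))%:~R.
have muI j : mu j = mu i -> j = i.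
  move=> /eqP; rewrite eqr_int => /eqP/(weight_value_inj (mem_weights j) (mem_weights i)).
  by move=> /eqP; rewrite nth_uniq ?size_weights ?ltn_ord ?weights_uniq // => /eqP/val_inj.
pose p := \prod_(j < 127 | j != i) ('X - (mu j)%:P).
have pc j : pev (ad z) p (c j) = p.[mu j] *: c j.
  by apply: pev_eigen; rewrite adE (root_space_z RD (Hc j)).
have : pev (ad z) p (\sum_i c i) \in W.
  by apply: pev_stable cW => x xW; rewrite adE zW.
rewrite linear_sum (bigD1 i) //= pc big1 ?addr0 => [|j ji]; last first.
  rewrite pc /p horner_prod (bigD1 j) //= hornerXsubC subrr mul0r scale0r //.
move=> /(memvZ (p.[mu i])^-1); rewrite scalerA mulVf ?scale1r //.
rewrite /p horner_prod; apply/prodf_neq0 => j ji; rewrite hornerXsubC subr_eq0 eq_sym.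
by apply: contra ji => /eqP/muI ->.
Qed.

Lemma wspanP P u : u \in roots -> (G u <= wspan G P)%VS = P u.
Proof.
move=> ur; apply/idP/idP => [GuP|]; last exact/wspan_sup/root_weight.
apply: contraT => nPu; have [i Ei] := wspaceP (root_weight ur).
have /subvPn[x xu] : ~~ (G u <= 0)%VS by rewrite subv0 (rd_nz RD).
rewrite memv0; have := subvP GuP x xu => /memv_sumP[c Hc xE].
have /directv_sum_independent H := wspace_direct RD.
pose d (j : 'I_127) := (if P (nth vzero weights j) then c j else 0) - (if j == i then x else 0).
have -> : x = - d i by rewrite /d Ei (negPf nPu) eqxx sub0r opprK.
rewrite H ?oppr0 ?eqxx // => [j _|].
  apply: memvB; first by case: ifP => [/Hc //|_]; exact: mem0v.
  by case: eqP => [->|_]; [rewrite /wspace Ei | exact: mem0v].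
by rewrite sumrB -big_mkcond -xE -big_mkcond big_pred1_eq subrr.
Qed.

Variable b : {vspace g}.
Hypotheses (bb : borel_subalgebra b) (zb : z \in b).

(** [h] normalises [b], so [h + b] is solvable, hence equal to [b]. *)
Lemma borel_cartan_sub : (h <= b)%VS.
Proof.
have [subb solb maxb] := bb.
have hb : bracket_sub h b b.
  move=> t x th xb; have [c Hc xE] := weight_decomposition RD x.
  have cb : forall i, c i \in b.
    by apply: root_component_mem => //; [move=> y; apply: subb zb | rewrite -xE].
  rewrite xE bracket_sumr; apply: memv_suml => i _.
  by have /(rd_mem RD)/(_ t th) -> := Hc i; rewrite memvZ.
have hbb : bracket_sub (h + b)%VS (h + b)%VS b.
  apply: bracket_subDl; apply: bracket_subDr => //; last by apply: bracket_sub_sym.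
  by move=> s t sh th; rewrite (rd_abelian RD) // mem0v.
have E : (h + b)%VS = b.
  apply: maxb; last exact: addvSr.
    by apply: bracket_subS hbb => //; apply: addvSr.
  by apply: lie_solvable_ext solb; apply/lie_derivedP.
by rewrite -E addvSl.
Qed.

Definition borel_roots : pred vec := fun u => (G u <= b)%VS.

(** Root spaces are lines. *)
Lemma root_space_sub W (i : 'I_127) x : nth vzero weights i \in roots -> x \in wspace G i -> x != 0 -> x \in W ->
  (G (nth vzero weights i) <= W)%VS.
Proof.
move=> ir xi x0 xW; have <- : (<[x]>)%VS = G (nth vzero weights i).
  by apply/eqP; rewrite eqEdim dim_vline x0 (dim_root_space RD sg ir) leqnn andbT -memvE.
by rewrite -memvE.
Qed.

Lemma borel_wspan : b = wspan G borel_roots.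
Proof.
have [subb _ _] := bb; apply/eqP; rewrite eqEsubv; apply/andP; split; last exact: wspan_sub.
apply/subvP => x xb; have [c Hc xE] := weight_decomposition RD x.
have cb : forall i, c i \in b.
  by apply: root_component_mem => //; [move=> y; apply: subb zb | rewrite -xE].
rewrite xE; apply: memv_suml => i _; have [->|ci0] := eqVneq (c i) 0; first exact: mem0v.
apply: (subvP _ _ (Hc i)); rewrite /wspace; apply: wspan_sup (mem_weights i) _; rewrite /borel_roots.
have := mem_weights i; rewrite (in_cons vzero) => /predU1P[->|ir].
  by rewrite (rd_zero RD) borel_cartan_sub.
exact: root_space_sub (Hc i) ci0 (cb i).
Qed.

(** Opposite root vectors would generate a copy of sl2, which survives in all the
    derived algebras of [b]. *)
Lemma borel_roots_opp u : u \in roots -> borel_roots u -> ~~ borel_roots (vneg u).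
Proof.
move=> ur /subvP ub; apply/negP => /subvP nub.
have [x [y [xu yu xy]]] := root_vector_pair RD sg ur.
have [_ [n bn] _] := bb; have th := tau_h RD xu yu; have t0 := root_tau_neq0 RD ur xu yu xy.
have x0 : x != 0 by apply: contra_neq xy => ->; rewrite killing0l.
suff /(_ n)[] : forall n, [/\ x \in iter n (@lie_derived _ _) b, y \in iter n (@lie_derived _ _) b
    & <|x, y|> \in iter n (@lie_derived _ _) b] by rewrite bn memv0 (negPf x0).
elim=> [|m [xm ym tm]] /=; first by split; [exact: ub | exact: nub | exact: subvP borel_cartan_sub _ th].
have D : bracket_sub _ _ (lie_derived _) := (lie_derivedP _ _).1 (subvv (lie_derived (iter m (@lie_derived _ _) b))).
split; last exact: D.
  have /(rd_mem RD)/(_ _ th) E := xu; rewrite -[x](scalerK t0) -E memvZ //; exact: D.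
have /(rd_mem RD)/(_ _ th) E := yu; rewrite (rd_wtN RD) in E.
have nt0 : - wt u <|x, y|> != 0 by rewrite oppr_eq0.
by rewrite -[y](scalerK nt0) -E memvZ //; exact: D.
Qed.

(** The roots of [b] number at least 63 because the dimension of [b] is at
    least 70. *)
Lemma borel_positive_system : positive_system borel_roots.
Proof.
have [subb _ _] := bb; apply: positive_system_of_count.
- move=> u v ur vr ub vb uvr; apply: root_bracket_sub => // x y xu yv.
  by apply: subb; [apply: subvP ub x xu | apply: subvP vb y yv].
- exact: borel_roots_opp.
have := borel_dim_leq (killing_nondegenerate RD sg) bb (hspan0_subalgebra RD) (hspan0_solvable RD).
rewrite (dim_hspan0 RD sg) [in X in (_ <= X)%N]borel_wspan (dim_wspan RD sg).
by case: (borel_roots vzero); lia.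
Qed.

Variables w w' : vec -> vec.
Hypothesis wr : {in roots, forall v, w v \in roots /\ w' v \in roots}.
Hypotheses (wK : {in roots, cancel w w'}) (w'K : {in roots, cancel w' w}).
Hypothesis wD : forall u v, w (vadd u v) = vadd (w u) (w v) /\ w' (vadd u v) = vadd (w' u) (w' v).
Hypothesis wP : {in roots, forall v, borel_roots (w v) = (v \in posroots)}.

Definition ideal_of (l : seq vec) : {vspace g} := wspan G (mem (map w l)).

Lemma mem_map_w (l : seq vec) v : {subset l <= roots} -> v \in roots ->
  (w v \in map w l) = (v \in l).
Proof.
move=> lr vr; apply/idP/idP => [/mapP[u ul E]|]; last exact: map_f.
by rewrite -(wK vr) E wK // lr.
Qed.

Lemma posroot_sum u v : u \in posroots -> v \in posroots -> vadd u v \in roots ->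
  vadd u v \in posroots.
Proof.
move=> up vp uvr; rewrite -(height_gt0 (root_weight uvr)) heightD.
have /andP[u0 _] := allP posroots_height u up; have /andP[v0 _] := allP posroots_height v vp.
exact: addr_gt0.
Qed.

Lemma posroot_w v : v \in posroots -> [/\ v \in roots, w v \in roots & borel_roots (w v)].
Proof. by move=> vp; have vr := posroot_root vp; rewrite wP // vp (wr vr).1. Qed.

(* sums in the positive system of [b] are images of sums of positive roots *)
Lemma borel_sum u v : u \in posroots -> v \in posroots -> vadd (w u) (w v) \in weights ->
  vadd u v \in posroots.
Proof.
move=> up vp; have [ur wur bu] := posroot_w up; have [vr wvr bv] := posroot_w vp.
rewrite (in_cons vzero) => /predU1P[E|sr].
  have := borel_roots_opp wur bu; rewrite (_ : vneg (w u) = w v) ?bv //.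
  by rewrite -(vaddKN (w u) (size_root wvr)) E; apply: vecP => [||k k7];
    rewrite ?size_mkseq // !nth_mkseq // nth_nseq if_same addr0.
apply: posroot_sum => //; have := (wr sr).2.
by rewrite (wD _ _).2 !wK.
Qed.

Lemma abelian_sets_sub l : l \in abelian_sets -> {subset l <= posroots}.
Proof. by move=> /abelian_setsP[/mem_subseq]. Qed.

Lemma ideal_of_abelian l : l \in abelian_sets -> abelian_ideal b (ideal_of l).
Proof.
move=> lA; have sub := abelian_sets_sub lA; have [_ [idl abl]] := abelian_setsP lA.
have lb : (ideal_of l <= b)%VS.
  apply: wspan_sub => u uw /mapP[v vl ->]; by have [] := posroot_w (sub v vl).
split; last first.
  suff H : bracket_sub (ideal_of l) (ideal_of l) 0%VS.
    by move=> x y xI yI; apply/eqP; rewrite -memv0; apply: H.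
  apply: wspan_bracket => u v uw vw /mapP[u' u'l ->] /mapP[v' v'l ->].
  apply: (root_space_bracket_sub RD) => /(borel_sum (sub _ u'l) (sub _ v'l)).
  by rewrite (negPf (abl u' v' (sub _ u'l) (sub _ v'l) u'l v'l)).
split=> //; suff H : bracket_sub (wspan G borel_roots) (ideal_of l) (ideal_of l).
  by move=> x y; rewrite {1}borel_wspan; apply: H.
apply: wspan_bracket => u v uw vw ub /mapP[v' v'l ->].
have v'p := sub v' v'l; have [v'r wv'r _] := posroot_w v'p.
have vI : (G (w v') <= ideal_of l)%VS by apply: wspan_sup; [exact: root_weight | apply: map_f].
move: uw; rewrite (in_cons vzero) => /predU1P[->|ur].
  rewrite (rd_zero RD) => t x th xv; have /(rd_mem RD)/(_ t th) -> := xv.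
  by rewrite memvZ // (subvP vI).
have [w'ur uE] := ((wr ur).2, w'K ur).
have up : w' u \in posroots by rewrite -wP // uE.
rewrite -uE; apply: (root_space_bracket_sub RD) => uvw; apply: wspan_sup => //.
have sp := borel_sum up v'p uvw; rewrite -(wD _ _).1 /=; apply: map_f.
by rewrite vaddC; apply: (idl v' (w' u)) => //; rewrite vaddC.
Qed.

Lemma dim_ideal_of l : l \in abelian_sets -> \dim (ideal_of l) = size l.
Proof.
move=> lA; have sub := abelian_sets_sub lA; have [ssub _] := abelian_setsP lA.
have subr : {subset map w l <= roots} by move=> _ /mapP[v vl ->]; have [] := posroot_w (sub v vl).
rewrite /ideal_of (dim_wspan RD sg) /=.
have -> : (vzero \in map w l) = false by apply/negbTE; apply: contra vzero_root => /subr.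
rewrite mul0n add0n -(size_map w l) -size_filter.
have ul : uniq (map w l).
  rewrite map_inj_in_uniq ?(subseq_uniq ssub posroots_uniq) // => u v ul vl E.
  by rewrite -(wK (posroot_root (sub u ul))) E wK // posroot_root ?sub.
apply/perm_size/uniq_perm => // [|v]; first exact: filter_uniq roots_uniq.
rewrite mem_filter; apply: andb_idr; exact: subr.
Qed.

Lemma ideal_of_inj : {in abelian_sets &, injective ideal_of}.
Proof.
move=> l m lA mA E.
have Hm k : k \in abelian_sets -> k = filter (fun v => (G (w v) <= ideal_of k)%VS) posroots.
  move=> kA; have [ssub _] := abelian_setsP kA; have sub := abelian_sets_sub kA.
  rewrite {1}(subseq_uniqP posroots_uniq ssub); apply: eq_in_filter => v vp.
  have [vr wvr _] := posroot_w vp; rewrite wspanP //= mem_map_w //.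
  by move=> u /sub/posroot_root.
by rewrite (Hm l lA) (Hm m mA) E.
Qed.

(** An element of the ideal lying in [h] commutes with its brackets with the root
    vectors of [b], so all the roots vanish at it. *)
Lemma abelian_ideal_of I : abelian_ideal b I ->
  exists2 l, l \in abelian_sets & I = ideal_of l.
Proof.
move=> [[Ib idI] abI]; have zI x : x \in I -> <|z, x|> \in I by apply: idI.
have Ih t : t \in I -> t \in h -> t = 0.
  move=> tI th; have wt0 v : v \in roots -> borel_roots v -> wt v t = 0.
    move=> vr vb; have /subvPn[e ev] : ~~ (G v <= 0)%VS by rewrite subv0 (rd_nz RD).
    rewrite memv0 => e0; have eb := subvP vb e ev; have /(rd_mem RD)/(_ t th) te := ev.
    have teI : <|t, e|> \in I by rewrite bracketC memvN idI.
    have /eqP := abI _ _ tI teI; rewrite te bracketZr te !scaler_eq0 (negPf e0) orbF orbb.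
    by move/eqP.
  apply: (rd_sep RD th) => v vr; have [_ opp] := borel_positive_system.
  have [vb|vb] := boolP (borel_roots v); first exact: wt0.
  have nb : borel_roots (vneg v).
    move: (vr); rewrite rootsE mem_cat => /orP[/opp -> //|/mapP[u up E]].
    by rewrite E vnegK ?size_root ?posroot_root //; move: vb; rewrite E opp // negbK.
  by have := wt0 _ (vneg_root vr) nb; rewrite (rd_wtN RD) => /eqP; rewrite oppr_eq0 => /eqP.
pose P v := (G (w v) <= I)%VS.
have Pb u : (G u <= I)%VS -> borel_roots u by move=> uI; apply: subv_trans Ib.
have abP : abelian_set P.
  split=> [u v up uI vp uvp|u v up vp uI vI].
    have [ur wur _] := posroot_w up; have [vr wvr vb] := posroot_w vp.
    have [uvr wuvr _] := posroot_w uvp.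
    rewrite /P (wD _ _).1 vaddC; apply: root_bracket_sub => //; first by rewrite vaddC -(wD _ _).1.
    by move=> x y xv yu; apply: idI; [apply: subvP vb x xv | apply: subvP uI y yu].
  have [ur wur _] := posroot_w up; have [vr wvr vb] := posroot_w vp.
  apply/negP => uvp; have [uvr wuvr _] := posroot_w uvp.
  case/negP: (rd_nz RD wuvr); rewrite -subv0 (wD _ _).1; apply: root_bracket_sub => //.
    by rewrite -(wD _ _).1.
  by move=> x y xu yv; rewrite memv0; apply/eqP/abI; [apply: subvP uI x xu | apply: subvP vI y yv].
exists (filter P posroots); first exact: abelian_sets_complete.
apply/eqP; rewrite eqEsubv; apply/andP; split; last first.
  by apply: wspan_sub => u _ /mapP[v]; rewrite mem_filter => /andP[Pv _] ->.
apply/subvP => x xI; have [c Hc xE] := weight_decomposition RD x.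
have cI : forall i, c i \in I by apply: root_component_mem => //; rewrite -xE.
rewrite xE; apply: memv_suml => i _; have [->|ci0] := eqVneq (c i) 0; first exact: mem0v.
have := mem_weights i; rewrite (in_cons vzero) => /predU1P[E|ir].
  case/eqP: ci0; apply: Ih (cI i) _; have := Hc i.
  by rewrite /wspace E (rd_zero RD).
apply: (subvP _ _ (Hc i)); rewrite /wspace; apply: wspan_sup (mem_weights i) _.
have iI := root_space_sub ir (Hc i) ci0 (cI i).
rewrite /= -(w'K ir); apply: map_f; rewrite mem_filter /P (w'K ir) iI /=.
by rewrite -wP ?w'K ?(wr ir).2 //; apply: Pb.
Qed.

End BorelRoots.

Lemma abelian_ideals_enumerated_at_z (K : numClosedFieldType) (g : lieAlgebraType K) h G wt z
    (b : {vspace g}) :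
  root_datum h G wt z -> lie_simple g -> borel_subalgebra b -> z \in b ->
  exists F : seq vec -> {vspace g},
  [/\ {in abelian_sets &, injective F},
      forall I, abelian_ideal b I <-> (exists2 l, l \in abelian_sets & I = F l) &
      {in abelian_sets, forall l, \dim (F l) = size l}].
Proof.
move=> RD sg bb zb.
have [w [w' [wr wK w'K wD wP]]] := positive_system_weyl (borel_positive_system RD sg bb zb).
exists (ideal_of G w); split.
- exact: (ideal_of_inj RD wr wK wP).
- move=> I; split; first exact: (abelian_ideal_of RD sg bb zb wr w'K wD wP).
  by move=> [l lA ->]; apply: (ideal_of_abelian RD sg bb zb wr wK w'K wD wP).
- move=> l lA; exact: (dim_ideal_of RD sg wr wK wP lA).
Qed.

(** * Conjugation and the count *)

Section Transport.

Variables (K : fieldType) (g : lieAlgebraType K).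
Implicit Types (s : 'End(g)) (b c I U : {vspace g}).

Lemma bracket_sub_img s (A B C : {vspace g}) : automorphism s -> bracket_sub A B C ->
  bracket_sub (s @: A)%VS (s @: B)%VS (s @: C)%VS.
Proof.
move=> [_ sb] H _ _ /memv_imgP[x xA ->] /memv_imgP[y yB ->].
by rewrite -sb memv_img // H.
Qed.

Lemma automorphism_inv s : automorphism s -> automorphism (s^-1)%VF.
Proof.
move=> [s0 sb]; have inj : injective s by apply/lker0P.
split=> [|x y]; last by apply: inj; rewrite sb !lker0_lfunVK.
by apply/lker0P; exact: (can_inj (lker0_lfunVK s0)).
Qed.

Lemma lfun_imgK s U : automorphism s -> (s^-1 @: (s @: U))%VS = U /\ (s @: (s^-1 @: U))%VS = U.
Proof.
by move=> [s0 _]; rewrite -!limg_comp lker0_compVf // lker0_compfV // lim1g.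
Qed.

Lemma lie_solvable_img s U : automorphism s -> lie_solvable U -> lie_solvable (s @: U)%VS.
Proof.
move=> as_ [n Un]; exists n; apply/eqP; rewrite -subv0.
suff : (iter n (@lie_derived _ _) (s @: U) <= s @: iter n (@lie_derived _ _) U)%VS.
  by rewrite Un limg0.
elim: (n) => //= m IHm; apply: subv_trans (lie_derivedS IHm) _; apply/lie_derivedP.
by apply: bracket_sub_img => //; apply/lie_derivedP.
Qed.

Lemma borel_subalgebra_img s b : automorphism s -> borel_subalgebra b ->
  borel_subalgebra (s @: b)%VS.
Proof.
move=> as_ [subb solb maxb]; have aV := automorphism_inv as_.
split=> [||c subc solc bc]; [exact: bracket_sub_img | exact: lie_solvable_img |].
rewrite -(lfun_imgK c as_).2; congr (_ @: _)%VS; apply: maxb.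
- exact: bracket_sub_img.
- exact: lie_solvable_img.
- by rewrite -[b](lfun_imgK b as_).1 limgS.
Qed.

Lemma abelian_ideal_img s b I : automorphism s -> abelian_ideal b I ->
  abelian_ideal (s @: b)%VS (s @: I)%VS.
Proof.
move=> as_ [[Ib idI] abI]; split; first by split; [exact: limgS | exact: bracket_sub_img].
move=> x y xI yI; apply/eqP; rewrite -memv0 -(limg0 s).
by apply: (bracket_sub_img as_ (A := I) (B := I)) xI yI => u v uI vI; rewrite abI ?mem0v.
Qed.

End Transport.

Lemma abelian_ideals_enumerated (K : numClosedFieldType) (g : lieAlgebraType K) (b : {vspace g}) :
  simple_of_type_E7 g -> borel_subalgebra b ->
  exists F : seq vec -> {vspace g},
  [/\ {in abelian_sets &, injective F},
      forall I, abelian_ideal b I <-> (exists2 l, l \in abelian_sets & I = F l) &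
      {in abelian_sets, forall l, \dim (F l) = size l}].
Proof.
move=> hg bb; have [sg _] := hg; have [h [G [wt [z RD]]]] := root_datum_exists hg.
have [y yb yz] := borel_meets_coset RD sg bb.
have [s as_ sy] := coset_conjugate RD yz.
have zb : z \in (s @: b)%VS by rewrite -sy memv_img.
have [F [Finj FP Fdim]] := abelian_ideals_enumerated_at_z RD sg (borel_subalgebra_img as_ bb) zb.
have aV := automorphism_inv as_; exists (fun l => s^-1 @: F l)%VS; split.
- move=> l m lA mA /(congr1 (lfun_img s)); rewrite !(lfun_imgK _ as_).2; exact: Finj.
- move=> I; split=> [idI|[l lA ->]].
    have /FP[l lA E] := abelian_ideal_img as_ idI; exists l => //.
    by rewrite -E (lfun_imgK I as_).1.
  have /FP : exists2 l', l' \in abelian_sets & F l = F l' by exists l.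
  by move=> /(abelian_ideal_img aV); rewrite (lfun_imgK b as_).1.
- move=> l lA; rewrite -(Fdim l lA); apply: limg_dim_eq.
  by have [/eqP -> _] := aV; rewrite capv0.
Qed.

Local Open Scope classical_set_scope.
Local Open Scope card_scope.

Lemma card_uniq_seq (T : eqType) (s : seq T) (A : set T) : uniq s ->
  (forall x, A x <-> x \in s) -> A #= `I_(size s).
Proof.
move=> us As; apply/card_set_bijP; exists (index^~ s); split.
- by move=> x /As; rewrite -index_mem.
- move=> x y /set_mem/As xs /set_mem/As ys E.
  by rewrite -(nth_index x xs) E nth_index.
- move=> n /= ns; have [a _] : exists a, a \in s.
    by case: (s) ns => // a l _; exists a; apply: mem_head.
  by exists (nth a s n); [apply/As/mem_nth | apply: index_uniq].
Qed.

Lemma abelian_ideals_of_dim_card (K : numClosedFieldType) (g : lieAlgebraType K)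
    (b : {vspace g}) (m : nat) :
  simple_of_type_E7 g -> borel_subalgebra b ->
  abelian_ideals_of_dim b m #= `I_(count (fun l => size l == m) abelian_sets).
Proof.
move=> hg bb; have [F [Finj FP Fdim]] := abelian_ideals_enumerated hg bb.
rewrite -size_filter -(size_map F); apply: card_uniq_seq => [|I].
  rewrite map_inj_in_uniq ?filter_uniq ?abelian_sets_uniq // => k l.
  by rewrite !mem_filter => /andP[_ kA] /andP[_ lA]; apply: Finj.
split=> [[/FP[l lA ->]]|/mapP[l]].
  by rewrite Fdim // => lm; apply: map_f; rewrite mem_filter lm eqxx.
rewrite mem_filter => /andP[/eqP lm lA] ->; split; last by rewrite Fdim.
by apply/FP; exists l.
Qed.

Lemma abelian_ideals_card (K : numClosedFieldType) (g : lieAlgebraType K) (b : {vspace g}) :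
  simple_of_type_E7 g -> borel_subalgebra b -> abelian_ideals b #= `I_(size abelian_sets).
Proof.
move=> hg bb; have [F [Finj FP Fdim]] := abelian_ideals_enumerated hg bb.
rewrite -(size_map F); apply: card_uniq_seq => [|I].
  by rewrite map_inj_in_uniq ?abelian_sets_uniq.
split=> [/FP[l lA ->]|/mapP[l lA ->]]; first exact: map_f.
by apply/FP; exists l.
Qed.

Lemma abelian_sets_small l : l \in abelian_sets -> (size l < 28)%N.
Proof. by rewrite abelian_setsE => lA; have := allP computed_abelian_sets_small l lA. Qed.

Theorem mainTheorem8 (R : realType) (g : lieAlgebraType R[i])
    (b : {vspace g}) (hg : simple_of_type_E7 g) (hb : borel_subalgebra b) :
  [/\ forall m : nat, (m < 14)%N ->
        abelian_ideals_of_dim b m #=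
        `I_(nth 0%N [:: 1; 1; 1; 1; 1; 2; 2; 3; 3; 4; 5; 6; 7; 8]%N m),
      forall m : nat, (14 <= m < 28)%N ->
        abelian_ideals_of_dim b m #=
        `I_(nth 0%N [:: 10; 11; 13; 15; 11; 7; 5; 3; 3; 1; 1; 1; 1; 1]%N
              (m - 14)%N),
      forall m : nat, (28 <= m)%N -> abelian_ideals_of_dim b m = set0 &
      abelian_ideals b #= `I_128].
Proof.
have count_nth m : (m < 28)%N -> count (fun l => size l == m) abelian_sets =
    nth 0%N [seq count (fun l : seq vec => size l == k) abelian_sets | k <- iota 0%N 28%N] m.
  by move=> m28; rewrite (nth_map 0%N) ?size_iota // nth_iota.
split=> [m m14|m /andP[m14 m28]|m m28|].
- have m28 : (m < 28)%N by apply: ltn_trans m14 _.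
  have := abelian_ideals_of_dim_card m hg hb.
  by rewrite count_nth // abelian_sets_sizes nth_cat m14.
- have := abelian_ideals_of_dim_card m hg hb.
  by rewrite count_nth // abelian_sets_sizes nth_cat ltnNge m14.
- rewrite -subset0 => I [abI dI]; have [F [_ FP Fdim]] := abelian_ideals_enumerated hg hb.
  have /FP[l lA E] := abI; have := abelian_sets_small lA.
  by rewrite -(Fdim l lA) -E dI ltnNge m28.
- by rewrite -size_abelian_sets; apply: abelian_ideals_card.
Qed.
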